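(* Let $K$ be an $\omega$-Calderón–Zygmund kernel on $\mathbb{R}^{d}$, let $r>2$, and assume that the operator $\mathcal{N}_{0}\circ\dot{\mathcal{V}}^{r}\circ\mathcal{T}$ has weak type $(1,1)$, where $\mathcal{T}$ is the truncation operator associated with $K$. Then for every $a>0$ the operator $\mathcal{N}_{a}\circ\dot{\mathcal{V}}^{r}\circ\mathcal{T}$ also has weak type $(1,1)$.
   Context: Work on $\mathbb{R}^{d}$ with Euclidean distance and Lebesgue measure, and put $\mathcal{X}:=\{(x,s,t)\in\mathbb{R}^{d}\times(0,\infty)\times(0,\infty): s\le t\}$. An $\omega$-Calderón–Zygmund kernel is a (measurable) function $K:\{(x,y)\in\mathbb{R}^{d}\times\mathbb{R}^{d}:x\ne y\}\to\mathbb{C}$ satisfying the size estimate $|K(x,y)|\le C_{K}|x-y|^{-d}$ for some $C_{K}<\infty$ and the smoothness estimate \[ |K(x,y)-K(x',y)|+|K(y,x)-K(y,x')|\le \omega\Big(\frac{|x-x'|}{|x-y|}\Big)\frac{1}{|x-y|^{d}} \quad\text{for } |x-y|>2|x-x'|>0, \] where $\omega:[0,\infty)\to[0,\infty)$ is a modulus of continuity (a subadditive function: $\omega(t+s)\le\omega(t)+\omega(s)$) satisfying the Dini condition $\|\omega\|_{\mathrm{Dini}}:=\int_{0}^{1}\omega(t)\frac{dt}{t}<\infty$. Truncation operator: $\mathcal{T}f(x,s,t):=\int_{s<|x-y|<t}K(x,y)f(y)\,dy$, a function on $\mathcal{X}$. Homogeneous variation operator on functions $F$ on $\mathcal{X}$,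 for $1\le r<\infty$: \[ (\dot{\mathcal{V}}^{r}F)(x,s,t):=\sup_{s\le t_{1}<\dots<t_{J}\le t}\Big(\sum_{j=1}^{J-1}|F(x,t_{j},t_{j+1})|^{r}\Big)^{1/r}, \] and analogously for $r=\infty$ with the $\ell^{\infty}$ norm in place of the $\ell^{r}$ norm. Nontangential maximal operator of aperture $a>0$ for $F:\mathcal{X}\to[0,\infty]$: $(\mathcal{N}_{a}F)(x):=\sup\{F(y,s,t): y\in\mathbb{R}^{d},\ 0<s<t<\infty,\ |x-y|<as\}$. For aperture $0$: $(\mathcal{N}_{0}F)(x):=\sup_{0<s<t<\infty}F(x,s,t)$. An operator $S$ mapping $L^{1}(\mathbb{R}^{d})$ to nonnegative functions has weak type $(1,1)$ if there is $C<\infty$ with $|\{Sf>\lambda\}|\le C\lambda^{-1}\|f\|_{1}$ for all $f\in L^{1}(\mathbb{R}^{d})$ and $\lambda>0$. *)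

(* Defs.v *)
From HB Require Import structures.
From mathcomp Require Import all_boot all_order all_algebra.
From mathcomp Require Import complex.
From mathcomp Require Import all_classical all_reals all_analysis.

Set Implicit Arguments.
Unset Strict Implicit.
Unset Printing Implicit Defensive.

Import Order.TTheory GRing.Theory Num.Theory.
Import numFieldNormedType.Exports.

Local Open Scope classical_set_scope.
Local Open Scope ring_scope.

(* R^d is d.-tuple R, which the library equips with the product (Borel)
   sigma-algebra. Lebesgue measure on it is the d-fold product of the
   one-dimensional Lebesgue measure, transported along the bijection
   R * R^n -> R^(n+1), (a, x) |-> a :: x. *)
Section lebesgue_measure_rd.
Context {R : realType}.

Section step.
Variables (n : nat) (mu : {sigma_finite_measure set (n.-tuple R) -> \bar R}).

Definition cons_pair (p : measurableTypeR R * n.-tuple R) : n.+1.-tuple R :=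
  [tuple of p.1 :: p.2].

Definition uncons (x : n.+1.-tuple R) : measurableTypeR R * n.-tuple R :=
  (thead x, [tuple of behead x]).

Lemma cons_pairK : cancel cons_pair uncons.
Proof. by move=> [a t]; congr (_, _); exact: val_inj. Qed.

Lemma measurable_cons_pair : measurable_fun [set: _] cons_pair.
Proof. exact: (@measurable_cons _ _ _ R fst n snd). Qed.

Lemma measurable_uncons : measurable_fun [set: _] uncons.
Proof.
apply/measurable_fun_pairP; split.
  exact: (@measurable_tnth _ R n.+1 ord0).
exact: (@measurable_behead _ R n).
Qed.

Definition lebesgue_cons : set (n.+1.-tuple R) -> \bar R :=
  pushforward (@lebesgue_measure R \x mu)%E cons_pair.

Let lebesgue_cons0 : lebesgue_cons set0 = 0%E.
Proof. by rewrite /lebesgue_cons /pushforward preimage_set0 measure0. Qed.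

Let lebesgue_cons_ge0 A : (0 <= lebesgue_cons A)%E.
Proof. by rewrite /lebesgue_cons /pushforward measure_ge0. Qed.

Let lebesgue_cons_additive : semi_sigma_additive lebesgue_cons.
Proof.
move=> F mF tF mUF; rewrite /lebesgue_cons /pushforward preimage_bigcup.
have mpre B : measurable B -> measurable (cons_pair @^-1` B).
  by move=> mB; rewrite -[X in measurable X]setTI; exact: measurable_cons_pair.
apply: measure_semi_sigma_additive.
- by move=> k; exact: mpre.
- apply/trivIsetP => /= i j _ _ ij; rewrite -preimage_setI.
  by move/trivIsetP : tF => /(_ _ _ _ _ ij) ->//; rewrite preimage_set0.
- by rewrite -preimage_bigcup; exact: mpre.
Qed.

HB.instance Definition _ := isMeasure.Build _ _ _ lebesgue_cons
  lebesgue_cons0 lebesgue_cons_ge0 lebesgue_cons_additive.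

Let lebesgue_cons_sigma_finite : sigma_finite setT lebesgue_cons.
Proof.
have /sigma_finiteP[F [FT ndF Foo]] := sigma_finiteT (@lebesgue_measure R).
have /sigma_finiteP[G [GT ndG Goo]] := sigma_finiteT mu.
exists (fun k => uncons @^-1` (F k `*` G k)).
  apply/esym; rewrite -subTset => x _.
  have [i _ Fi] : (\bigcup_i F i) (uncons x).1 by rewrite -FT.
  have [j _ Gj] : (\bigcup_i G i) (uncons x).2 by rewrite -GT.
  exists (maxn i j) => //; split.
  - by move: Fi; exact/subsetPset/ndF/leq_maxl.
  - by move: Gj; exact/subsetPset/ndG/leq_maxr.
move=> k; have [mF Fk] := Foo k; have [mG Gk] := Goo k; split.
  rewrite -[X in measurable X]setTI; apply: measurable_uncons => //.
  exact: measurableX.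
rewrite /lebesgue_cons /pushforward -comp_preimage.
rewrite (_ : uncons \o cons_pair = id); last exact/funext/cons_pairK.
by rewrite preimage_id product_measure1E// lte_mul_pinfty// ge0_fin_numE.
Qed.

HB.instance Definition _ := Measure_isSigmaFinite.Build _ _ _ lebesgue_cons
  lebesgue_cons_sigma_finite.

End step.

Fixpoint lebesgue_rd (d : nat) :
    {sigma_finite_measure set (d.-tuple R) -> \bar R} :=
  match d with
  | 0 => dirac [tuple]
  | n.+1 => lebesgue_cons (lebesgue_rd n)
  end.

Lemma measurable_box d (a b : d.-tuple R) :
  measurable [set x : d.-tuple R |
    forall i, tnth a i <= tnth x i <= tnth b i].
Proof.
rewrite (_ : [set x | _] = \bigcap_(i in [set: 'I_d])
    ((fun x => tnth x i) @^-1` `[tnth a i, tnth b i])).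
  apply: fin_bigcap_measurable => [|i _]; first exact: finite_finset.
  by rewrite -[X in measurable X]setTI; exact: measurable_tnth.
apply/seteqP; split => x /= h.
  by move=> i _ /=; rewrite in_itv /= h.
by move=> i; have := h i I; rewrite /= in_itv.
Qed.

(* As a check on the normalisation: boxes have the expected volume. *)
Lemma lebesgue_rd_box d (a b : d.-tuple R) :
  (forall i, tnth a i <= tnth b i) ->
  lebesgue_rd d [set x | forall i, tnth a i <= tnth x i <= tnth b i] =
  (\prod_(i < d) (tnth b i - tnth a i))%:E.
Proof.
elim: d a b => [|d IH] a b leab.
  rewrite big_ord0 /= (_ : [set x | _] = setT) ?diracT//.
  by apply/seteqP; split => // x _ [].
rewrite big_ord_recl /= /lebesgue_cons /pushforward.
set a' : d.-tuple R := [tuple of behead a].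
set b' : d.-tuple R := [tuple of behead b].
have a'E i : tnth a' i = tnth a (lift ord0 i).
  by rewrite [in RHS](tuple_eta a) tnthS.
have b'E i : tnth b' i = tnth b (lift ord0 i).
  by rewrite [in RHS](tuple_eta b) tnthS.
rewrite (_ : @cons_pair d @^-1` _ = `[tnth a ord0, tnth b ord0]%classic `*`
    [set x | forall i, tnth a' i <= tnth x i <= tnth b' i]); last first.
  apply/seteqP; split => -[u x] /=.
    move=> h; split; first by have := h ord0; rewrite tnth0 in_itv.
    by move=> i; have := h (lift ord0 i); rewrite tnthS a'E b'E.
  move=> [hu hx] i; have [j ->|->] := unliftP ord0 i.
    by rewrite tnthS -a'E -b'E.
  by rewrite tnth0; move: hu; rewrite in_itv.
rewrite product_measure1E//; last exact: measurable_box.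
rewrite IH; last by move=> i; rewrite a'E b'E.
rewrite EFinM; congr (_ * _)%E.
  transitivity (@lebesgue_measure R `[tnth a ord0, tnth b ord0]%classic) => //.
  rewrite lebesgue_measure_itv/= lte_fin; case: ltP => // ba.
  by rewrite (@le_anti _ _ (tnth b ord0) (tnth a ord0)) ?subrr// ba leab.
by congr EFin; apply: eq_bigr => i _; rewrite a'E b'E.
Qed.

End lebesgue_measure_rd.

Section variational_truncations.
Context {R : realType} {d : nat}.
Local Notation Rd := (d.-tuple R).
Local Notation C := R[i].
Local Notation normc := Normc.normc.
Local Notation mu := (lebesgue_rd (R := R) d).

Definition eucl_dist (x y : Rd) : R :=
  Num.sqrt (\sum_(i < d) (tnth x i - tnth y i) ^+ 2).

(* Complex-valued functions are measured and integrated through their real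
   and imaginary parts. *)
Definition cmeasurable_fun dd (T : measurableType dd) (D : set T)
    (f : T -> C) :=
  measurable_fun D (fun x => complex.Re (f x)) /\
  measurable_fun D (fun x => complex.Im (f x)).

Definition cintegral (D : set Rd) (f : Rd -> C) : C :=
  Complex (\int[mu]_(y in D) complex.Re (f y))
          (\int[mu]_(y in D) complex.Im (f y)).

Definition L1norm (f : Rd -> C) : \bar R :=
  (\int[mu]_y (normc (f y))%:E)%E.

Definition inL1 (f : Rd -> C) :=
  cmeasurable_fun setT f /\ (L1norm f < +oo)%E.

(* A modulus is a function on [0, oo); its values at negative reals are never
   used. *)
Definition modulus_of_continuity (omega : R -> R) :=
  (forall t, 0 <= t -> 0 <= omega t) /\
  (forall t s, 0 <= t -> 0 <= s -> omega (t + s) <= omega t + omega s).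

Definition dini_norm (omega : R -> R) : \bar R :=
  (\int[lebesgue_measure]_(t in `]0%R, 1%R[) (omega t / t)%:E)%E.

(* A kernel is only relevant off the diagonal: no condition below, and no value
   of [truncation], involves K x x. *)
Record CZ_kernel (omega : R -> R) (K : Rd -> Rd -> C) : Prop := {
  CZ_modulus : modulus_of_continuity omega ;
  CZ_modulus_measurable : measurable_fun (`]0, 1[ : set R) omega ;
  CZ_dini : (dini_norm omega < +oo)%E ;
  CZ_measurable :
    cmeasurable_fun [set p : Rd * Rd | p.1 <> p.2] (fun p => K p.1 p.2) ;
  CZ_size : exists CK : R, forall x y, x <> y ->
    normc (K x y) <= CK * (eucl_dist x y ^+ d)^-1 ;
  CZ_smooth : forall x x' y,
    2 * eucl_dist x x' < eucl_dist x y -> 0 < eucl_dist x x' ->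
    normc (K x y - K x' y) + normc (K y x - K y x')
      <= omega (eucl_dist x x' / eucl_dist x y) * (eucl_dist x y ^+ d)^-1 }.

(* Functions on {(x, s, t) | 0 < s <= t} are represented by total functions of
   (x, s, t); the operators below evaluate them only on that set. *)
Definition truncation (K : Rd -> Rd -> C) (f : Rd -> C)
    (x : Rd) (s t : R) : C :=
  cintegral [set y | s < eucl_dist x y < t] (fun y => K x y * f y).

(* The l^r norm of a finite sequence of nonnegative reals, 1 <= r <= oo; the
   value for r = -oo is irrelevant. *)
Definition lr_norm (r : \bar R) (v : seq R) : R :=
  match r with
  | r%:E => (\sum_(u <- v) u `^ r) `^ r^-1
  | +oo%E => \big[Num.max/0]_(u <- v) u
  | -oo%E => 0
  end.

(* The sup runs over s <= t_1 < ... < t_J <= t, J >= 1, with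
   t_1 :: ts = [:: t_1; ...; t_J]. *)
Definition homogeneous_variation (r : \bar R) (F : Rd -> R -> R -> C)
    (x : Rd) (s t : R) : \bar R :=
  ereal_sup [set v | exists t1 ts,
    [/\ s <= t1, path <%R t1 ts, last t1 ts <= t &
        v = (lr_norm r (pairmap (fun u w => normc (F x u w)) t1 ts))%:E]].

Definition nontangential_max (a : R) (F : Rd -> R -> R -> \bar R)
    (x : Rd) : \bar R :=
  ereal_sup [set v | exists y s t,
    [/\ 0 < s, s < t, eucl_dist x y < a * s & v = F y s t]].

Definition nontangential_max0 (F : Rd -> R -> R -> \bar R)
    (x : Rd) : \bar R :=
  ereal_sup [set v | exists s t, [/\ 0 < s, s < t & v = F x s t]].

(* The measure of a non-Borel set is meaningless here; for the operators of
   interest the level sets are Borel. *)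
Definition weak_type11 (S : (Rd -> C) -> Rd -> \bar R) :=
  exists A : R, forall f, inL1 f -> forall lambda : R, 0 < lambda ->
    (mu [set x | lambda%:E < S f x] <= (A / lambda)%:E * L1norm f)%E.

End variational_truncations.

(* Main.v *)
Require Import Defs.
From mathcomp Require Import all_boot all_order all_algebra.
From mathcomp Require Import complex.
From mathcomp Require Import all_classical all_reals all_analysis.
From mathcomp Require Import measurable_realfun.
From mathcomp Require Import ring lra.

(* Write V for the variation at a point and let |x - y| < a s. Comparing the
   truncations centred at y and at x, V f(y, s, t) is at most V f(x, S, t) plus
   three errors, where S is a dyadic scale comparable to s. The region
   |y - z| <= C S contributes a maximal function by the size estimate, the
   smoothness estimate contributes a maximal function by the Dini condition, and
   the symmetric differences of the annuli leave a sum over the segments, in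
   l^r, of |x - z|^-d |f(z)| integrated over shells around x of thickness about
   S. As r > 2, it is enough to bound the l^2 sum of the last terms.

   Stop the dyadic averages of |f| at height lambda. Outside a small exceptional
   set, x is far from every maximal heavy cell. The square of a shell integral
   is a double integral over pairs (z, w) in a common shell, ordered so that the
   maximal cell of w is not larger than that of z. If both points are in light
   cells of side S, the shell may be smeared out at scale S, where |f| has mass
   at most lambda S^d per cell, and the volume of a shell gives the bound. If w
   is near the heavy cell of z, maximality bounds the mass around z. If it is
   far, we integrate over x: the points at comparable distance to z and w form a
   slab, of volume proportional to S / |z - w|, and this gains a factor
   S / (side of the cell of z), which can be summed over the dyadic scales S.
   Hence the square function is at most C lambda^2 off an exceptional set of
   measure at most C |f|_1 / lambda. *)

Set Implicit Arguments.
Unset Strict Implicit.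
Unset Printing Implicit Defensive.

Import Order.TTheory GRing.Theory Num.Theory.
Import numFieldNormedType.Exports.

Local Open Scope classical_set_scope.
Local Open Scope ring_scope.

Ltac nonneg := repeat first [done | by apply: ltW | apply: mulr_ge0 |
  apply: exprn_ge0 | apply: addr_ge0 | rewrite invr_ge0].

(** * Integrals of non-measurable functions, Euclidean distance *)

Section integral_without_measurability.
Context dd (T : measurableType dd) (R : realType).
Variable m : {measure set T -> \bar R}.

(* For nonnegative functions the integral is a supremum over the simple
   functions below the integrand, so it is monotone even on functions that are
   not measurable. *)
Lemma ge0_le_integralW (f g : T -> \bar R) :
  (forall x, 0 <= f x)%E -> (forall x, f x <= g x)%E ->
  (\int[m]_x f x <= \int[m]_x g x)%E.
Proof.
move=> f0 fg; have g0 x : (0 <= g x)%E by exact: le_trans (f0 x) (fg x).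
rewrite !ge0_integralTE//; apply: ereal_sup_le => _ [h hf <-].
by exists h => // x; exact: le_trans (hf x) (fg x).
Qed.

End integral_without_measurability.

Lemma lebesgue_rd_mono (R : realType) d (A B : set (d.-tuple R)) :
  A `<=` B -> (lebesgue_rd d A <= lebesgue_rd d B)%E.
Proof.
elim: d A B => [|d IH] A B AB /=.
  rewrite /dirac/= /dirac lee_fin !indicE; case: (boolP (_ \in A)) => // /set_mem.
  by move=> /AB /mem_set ->.
rewrite /lebesgue_cons /pushforward /product_measure1.
apply: ge0_le_integralW => x /=; first exact: measure_ge0.
apply: IH => y; rewrite /xsection/= !inE /=; exact: AB.
Qed.

Section euclidean.
Context {R : realType} {d : nat}.
Local Notation Rd := (d.-tuple R).
Implicit Types x y z : Rd.

Lemma cauchy_schwarz_sum (I : finType) (u v : I -> R) :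
  (\sum_i u i * v i) ^+ 2 <= (\sum_i u i ^+ 2) * (\sum_i v i ^+ 2).
Proof.
set A := \sum_i u i ^+ 2; set B := \sum_i v i ^+ 2; set C := \sum_i u i * v i.
have A0 : 0 <= A by apply: sumr_ge0 => i _; exact: sqr_ge0.
have H t s : 0 <= t ^+ 2 * A - 2 * t * s * C + s ^+ 2 * B.
  have -> : t ^+ 2 * A - 2 * t * s * C + s ^+ 2 * B =
      \sum_i (t * u i - s * v i) ^+ 2.
    rewrite /A /B /C !mulr_sumr -sumrB -big_split /=; apply: eq_bigr => i _.
    by ring.
  by apply: sumr_ge0 => i _; exact: sqr_ge0.
have [A00|A0'] := eqVneq A 0.
  have C0 : C = 0.
    rewrite /C big1// => i _.
    have /eqP : u i ^+ 2 = 0.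
      by apply: (psumr_eq0P _ A00) => // j _; exact: sqr_ge0.
    by rewrite sqrf_eq0 => /eqP ->; rewrite mul0r.
  by rewrite C0 A00 mul0r expr0n.
have Ap : 0 < A by rewrite lt0r A0'.
have := H C A.
have -> : C ^+ 2 * A - 2 * C * A * C + A ^+ 2 * B = A * (A * B - C ^+ 2) by ring.
by rewrite pmulr_rge0// subr_ge0.
Qed.

Lemma eucl_dist_ge0 x y : 0 <= eucl_dist x y.
Proof. exact: sqrtr_ge0. Qed.

Lemma eucl_dist_sqr x y :
  eucl_dist x y ^+ 2 = \sum_(i < d) (tnth x i - tnth y i) ^+ 2.
Proof. by rewrite sqr_sqrtr// sumr_ge0// => i _; exact: sqr_ge0. Qed.

Lemma eucl_distC x y : eucl_dist x y = eucl_dist y x.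
Proof.
by congr Num.sqrt; apply: eq_bigr => i _; rewrite -sqrrN opprB.
Qed.

Lemma eucl_dist_triangle y x z :
  eucl_dist x z <= eucl_dist x y + eucl_dist y z.
Proof.
rewrite -(@ler_pXn2r _ 2)// ?nnegrE ?addr_ge0 ?eucl_dist_ge0//.
have -> : eucl_dist x z ^+ 2 = eucl_dist x y ^+ 2 + eucl_dist y z ^+ 2 +
    2 * \sum_(i < d) (tnth x i - tnth y i) * (tnth y i - tnth z i).
  rewrite !eucl_dist_sqr mulr_sumr -!big_split/=.
  by apply: eq_bigr => i _; ring.
rewrite (_ : (eucl_dist x y + eucl_dist y z) ^+ 2 = eucl_dist x y ^+ 2 +
  eucl_dist y z ^+ 2 + 2 * (eucl_dist x y * eucl_dist y z)); last by ring.
rewrite lerD2l ler_wpM2l//.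
rewrite (le_trans (ler_norm _))// -(@ler_pXn2r _ 2)// ?nnegrE ?normr_ge0//; last first.
  by rewrite mulr_ge0 ?eucl_dist_ge0.
by rewrite real_normK ?num_real// exprMn !eucl_dist_sqr cauchy_schwarz_sum.
Qed.

Lemma eucl_dist_tnth x y i : `|tnth x i - tnth y i| <= eucl_dist x y.
Proof.
rewrite -(@ler_pXn2r _ 2)// ?nnegrE ?normr_ge0 ?eucl_dist_ge0//.
rewrite eucl_dist_sqr real_normK ?num_real// (bigD1 i)//= lerDl.
by apply: sumr_ge0 => j _; exact: sqr_ge0.
Qed.

Lemma eucl_dist_coord x y : (0 < d)%N ->
  exists i, eucl_dist x y <= d%:R * `|tnth x i - tnth y i|.
Proof.
move=> d0.
pose i := [arg max_(j > Ordinal d0) `|tnth x j - tnth y j|]%O.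
have iP j : `|tnth x j - tnth y j| <= `|tnth x i - tnth y i|.
  by rewrite /i; case: arg_maxP => // k _ /(_ j); exact.
exists i; rewrite -(@ler_pXn2r _ 2)// ?nnegrE ?mulr_ge0 ?eucl_dist_ge0//.
rewrite eucl_dist_sqr exprMn.
apply: (@le_trans _ _ (\sum_(j < d) `|tnth x i - tnth y i| ^+ 2)).
  apply: ler_sum => j _; rewrite -[X in X <= _]real_normK ?num_real//.
  by rewrite ler_pXn2r ?nnegrE.
rewrite sumr_const card_ord -[leLHS]mulr_natl ler_wpM2r ?sqr_ge0//.
by rewrite expr2 -natrM ler_nat leq_pmulr.
Qed.

Lemma eucl_dist_le x y c : 0 <= c ->
  (forall i, `|tnth x i - tnth y i| <= c) -> eucl_dist x y <= d%:R * c.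
Proof.
move=> c0 h; case: (posnP d) => [d0|d0].
  rewrite /eucl_dist big1 ?sqrtr0 ?mulr_ge0// => i; exfalso.
  by case: i => i; rewrite d0.
have [i hi] := eucl_dist_coord x y d0.
by rewrite (le_trans hi)// ler_wpM2l.
Qed.

Lemma eucl_distxx x : eucl_dist x x = 0.
Proof. by rewrite /eucl_dist big1 ?sqrtr0// => i _; rewrite subrr expr0n. Qed.

Lemma eucl_dist_eq0 x y : eucl_dist x y = 0 -> x = y.
Proof.
move=> h; apply: eq_from_tnth => i; apply/eqP; rewrite -subr_eq0 -normr_le0.
by rewrite -h eucl_dist_tnth.
Qed.

Lemma measurable_eucl_dist :
  measurable_fun [set: Rd * Rd] (fun p => eucl_dist p.1 p.2).
Proof.
apply: (@measurableT_comp _ _ _ _ _ _ (@Num.sqrt R)).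
  by apply: continuous_measurable_fun; exact: sqrt_continuous.
apply: measurable_sum => i; apply: measurable_funX.
apply: measurable_funB.
  exact: (measurableT_comp (measurable_tnth i) measurable_fst).
exact: (measurableT_comp (measurable_tnth i) measurable_snd).
Qed.

End euclidean.

(** * Volumes of thin sets *)

Lemma lebesgue_measure_diam (R : realType) (B : set (measurableTypeR R)) (h : R) :
  measurable B -> 0 <= h -> (forall x y : R, B x -> B y -> `|x - y| <= h :> R) ->
  (@lebesgue_measure R B <= h%:E)%E.
Proof.
move=> mB h0 dB; have [->|/set0P[b Bb]] := eqVneq B set0.
  by rewrite measure0 lee_fin.
have sub (u v : R) : `|u - v| <= h -> u - h <= v.
  by rewrite ler_norml => /andP[? ?]; lra.
have lB : has_lbound (B : set R).
  by exists ((b : R) - h) => y By; apply: (@sub b y); exact: dB.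
pose a : R := inf (B : set R).
apply: (@le_trans _ _ (@lebesgue_measure R `[a, a + h]%classic)).
  apply: le_measure; rewrite ?inE//.
  move=> x Bx; rewrite /= in_itv/=; apply/andP; split; first exact: ge_inf.
  rewrite -lerBlDr; apply: lb_le_inf; first by exists b.
  by move=> y By; apply: (@sub x y); exact: dB.
rewrite (@lebesgue_measure_itv R) /= lte_fin ltrDl.
by case: ifPn => // _; rewrite lee_fin addrAC subrr add0r.
Qed.

Lemma lebesgue_rd_cube (R : realType) d (c : d.-tuple R) (rho : R) : 0 <= rho ->
  lebesgue_rd d [set x | forall i, `|tnth x i - tnth c i| <= rho] =
  ((2 * rho) ^+ d)%:E.
Proof.
move=> r0.
pose a := [tuple tnth c i - rho | i < d]; pose b := [tuple tnth c i + rho | i < d].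
rewrite (_ : [set x | _] = [set x : d.-tuple R |
    forall i, tnth a i <= tnth x i <= tnth b i]); last first.
  apply/seteqP; split => x /= + i => /(_ i);
    by rewrite ler_norml !tnth_mktuple; move=> /andP[? ?]; apply/andP; split; lra.
rewrite lebesgue_rd_box; last by move=> i; rewrite !tnth_mktuple; lra.
congr EFin; rewrite -[in RHS](card_ord d) -prodr_const.
by apply: eq_bigr => i _; rewrite !tnth_mktuple; ring.
Qed.

Lemma measurable_cube (R : realType) d (c : d.-tuple R) (rho : R) :
  measurable [set x : d.-tuple R | forall i, `|tnth x i - tnth c i| <= rho].
Proof.
pose a := [tuple tnth c i - rho | i < d]; pose b := [tuple tnth c i + rho | i < d].
rewrite (_ : [set x | _] = [set x : d.-tuple R |
    forall i, tnth a i <= tnth x i <= tnth b i]); first exact: measurable_box.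
apply/seteqP; split => x /= + i => /(_ i);
  by rewrite ler_norml !tnth_mktuple; move=> /andP[? ?]; apply/andP; split; lra.
Qed.

Lemma lebesgue_rd_thin (R : realType) d (A : set (d.-tuple R))
    (c : d.-tuple R) (rho h : R) (i : 'I_d) :
  measurable A -> 0 <= rho -> 0 <= h ->
  (forall x, A x -> forall j, `|tnth x j - tnth c j| <= rho) ->
  (forall x y, A x -> A y -> (forall j, j != i -> tnth x j = tnth y j) ->
    `|tnth x i - tnth y i| <= h) ->
  (lebesgue_rd d A <= ((2 * rho) ^+ d.-1 * h)%:E)%E.
Proof.
elim: d A c i => [|n IH] A c i mA r0 h0 Ac Ai; first by have := ltn_ord i.
have mpre : measurable (@cons_pair R n @^-1` A).
  by rewrite -[X in measurable X]setTI; exact: measurable_cons_pair.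
pose c0 := tnth c ord0; pose c' : n.-tuple R := [tuple of behead c].
have c'E j : tnth c' j = tnth c (lift ord0 j).
  by rewrite [in RHS](tuple_eta c) tnthS.
rewrite /= /lebesgue_cons /pushforward.
set B := (X in product_measure1 _ _ X).
have [j ij|i0] := unliftP ord0 i.
- have n0 : (0 < n)%N := leq_ltn_trans (leq0n j) (ltn_ord j).
  rewrite /product_measure1.
  pose J : set (measurableTypeR R) := `[c0 - rho, c0 + rho]%classic.

  apply: (@le_trans _ _
      (\int[@lebesgue_measure R]_a (((2 * rho) ^+ n.-1 * h)%:E * (\1_J a)%:E))%E).
    apply: ge0_le_integralW => a /=; first exact: measure_ge0.
    case: (boolP (a \in J)) => [aJ|/negP aJ].
      rewrite indicE aJ mule1; apply: (IH _ c' j) => //.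
      + exact: measurable_xsection.
      + move=> x; rewrite /xsection/= inE => /Ac Acx k.
        by have := Acx (lift ord0 k); rewrite tnthS c'E.
      + move=> x y; rewrite /xsection/= !inE => Ax Ay xy.
        have := Ai _ _ Ax Ay; rewrite ij !tnthS; apply => k kj.
        have [l kl|->] := unliftP ord0 k; last by rewrite !tnth0.
        rewrite kl !tnthS; apply: xy; apply: contraNneq kj => lj.
        by rewrite kl lj.
    rewrite (_ : xsection _ _ = set0) ?measure0 ?mule_ge0 ?lee_fin ?mulr_ge0 ?exprn_ge0 ?mulr_ge0//.
    rewrite -subset0 => x; rewrite /xsection/= inE => /Ac /(_ ord0).
    rewrite tnth0 => ac; apply: aJ; rewrite inE /J /= in_itv/=.
    by move: ac; rewrite /= ler_norml -/c0 => /andP[? ?]; apply/andP; split; lra.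
  rewrite ge0_integralZl//=; first last.
    by rewrite lee_fin mulr_ge0 ?exprn_ge0 ?mulr_ge0.
    by apply/measurable_EFinP; apply: measurable_indic; exact: measurable_itv.
  rewrite integral_indic//= ?setIT; last exact: measurable_itv.
  have -> : @lebesgue_measure R J = (2 * rho)%:E.
    rewrite (@lebesgue_measure_itv R) /= lte_fin.
    case: ltP => H; last by congr EFin; lra.
    by rewrite -EFinD; congr EFin; lra.
  rewrite -EFinM lee_fin -[in leRHS](prednK n0) exprS; lra.
- have -> : (@lebesgue_measure R \x lebesgue_rd n)%E B =
      (\int[lebesgue_rd n]_y (@lebesgue_measure R) (ysection B y))%E.
    have := @indic_fubini_tonelli _ _ _ _ R (@lebesgue_measure R) (lebesgue_rd n) B mpre.
    by rewrite indic_fubini_tonelli_FE// indic_fubini_tonelli_GE.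
  pose Q : set (n.-tuple R) := [set x | forall k, `|tnth x k - tnth c' k| <= rho].
  have mQ : measurable Q by exact: measurable_cube.
  apply: (@le_trans _ _ (\int[lebesgue_rd n]_y (h%:E * (\1_Q y)%:E))%E).
    apply: ge0_le_integralW => y /=; first exact: measure_ge0.
    have [->|/set0P[a Ba]] := eqVneq (ysection B y) set0.
      by rewrite measure0 mule_ge0// lee_fin.
    rewrite indicE mem_set ?mule1; last first.
      move=> k; move: Ba; rewrite /ysection/= inE => /Ac /(_ (lift ord0 k)).
      by rewrite tnthS c'E.
    apply: lebesgue_measure_diam => //; first exact: measurable_ysection.
    move=> u v; rewrite /ysection/= !inE => Au Av.
    have := Ai _ _ Au Av; rewrite i0 !tnth0; apply => k.
    by have [l -> _|-> //] := unliftP ord0 k; rewrite ?eqxx// !tnthS.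
  rewrite ge0_integralZl//=; last exact/measurable_EFinP/measurable_indic.
  rewrite integral_indic//= ?setIT lebesgue_rd_cube//.
  by rewrite -EFinM lee_fin mulrC.
Qed.

Section balls.
Context {R : realType} {d : nat}.
Local Notation Rd := (d.-tuple R).
Local Notation mu := (lebesgue_rd (R := R) d).
Implicit Types x y z : Rd.

Lemma lebesgue_rd_ball_le x (rho : R) : 0 <= rho ->
  (mu [set y | (eucl_dist x y <= rho)%R] <= ((2 * rho) ^+ d)%:E)%E.
Proof.
move=> r0; rewrite -(lebesgue_rd_cube x r0); apply: lebesgue_rd_mono => y /= h i.
by rewrite distrC (le_trans (eucl_dist_tnth _ _ _)).
Qed.

End balls.

Section measurable_bool.
Context dd (T : measurableType dd) (R : realType).
Implicit Type b : T -> bool.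

Lemma measurable_set_bool b : measurable_fun setT b -> measurable [set x | b x].
Proof.
move=> mb; have := mb measurableT [set true] => /=; rewrite setTI.
by rewrite (_ : b @^-1` [set true] = [set x | b x])//; apply.
Qed.

Lemma measurable_natr_bool b : measurable_fun setT b ->
  measurable_fun setT (fun x => (b x)%:R : R).
Proof.
move=> mb; rewrite (_ : (fun x => _) = \1_[set x | b x]).
  exact/measurable_indic/measurable_set_bool.
by apply/funext => x; rewrite indicE; congr (nat_of_bool _)%:R; apply/idP/idP;
  rewrite inE.
Qed.

Lemma measurable_forall_ord n (b : T -> 'I_n -> bool) :
  (forall i, measurable_fun setT (b ^~ i)) ->
  measurable_fun setT (fun x => [forall i, b x i]).
Proof.
move=> mb; apply: (measurable_fun_bool true); rewrite setTI.
rewrite (_ : _ @^-1` _ = \bigcap_(i in [set: 'I_n]) [set x | b x i]).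
  apply: fin_bigcap_measurable => [|i _]; first exact: finite_finset.
  exact: measurable_set_bool.
apply/seteqP; split => x /=; first by move=> /forallP h i _; exact: h.
by move=> h; apply/forallP => i; exact: h.
Qed.

Lemma measurable_fun_eucl_dist d (f g : T -> d.-tuple R) :
  measurable_fun setT f -> measurable_fun setT g ->
  measurable_fun setT (fun t => eucl_dist (f t) (g t)).
Proof.
move=> mf mg.
exact: (measurableT_comp measurable_eucl_dist (measurable_fun_pair mf mg)).
Qed.

End measurable_bool.

Section slab_annulus.
Context {R : realType} {d : nat}.
Local Notation Rd := (d.-tuple R).
Local Notation mu := (lebesgue_rd (R := R) d).
Implicit Types x y z w : Rd.

(* The difference of the squared distances to z and w is affine in the point,
   so the shells around z and w meet in a slab orthogonal to z - w. *)
Lemma lebesgue_rd_slab z w (S rho : R) : (0 < d)%N -> 0 < eucl_dist z w ->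
  0 <= S -> S <= rho ->
  (mu [set x | (eucl_dist x z <= rho)%R &&
        (`|eucl_dist x z - eucl_dist x w| <= 2 * S)%R] <=
   ((2 * rho) ^+ d.-1 * (8 * d%:R * S * rho / eucl_dist z w))%:E)%E.
Proof.
move=> d0 D0 S0 Sr; have r0 : 0 <= rho by exact: le_trans Sr.
have [i Di] := eucl_dist_coord z w d0.
have dR : 0 < d%:R :> R by rewrite ltr0n.
apply: (@lebesgue_rd_thin _ _ _ z _ _ i) => //.
- apply: measurable_set_bool; apply: measurable_and.
    by apply: measurable_fun_ler => //; apply: measurable_fun_eucl_dist.
  apply: measurable_fun_ler => //; apply: measurableT_comp => //.
  by apply: measurable_funB; apply: measurable_fun_eucl_dist.
- by rewrite divr_ge0 ?mulr_ge0 ?eucl_dist_ge0.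
- by move=> x /andP[xz _] j; rewrite (le_trans (eucl_dist_tnth _ _ _)).
move=> x y /andP[xz hx] /andP[yz hy] xy.
pose q x := eucl_dist x z ^+ 2 - eucl_dist x w ^+ 2.
have qle u : eucl_dist u z <= rho -> `|eucl_dist u z - eucl_dist u w| <= 2 * S ->
    `|q u| <= 8 * S * rho.
  move=> uz hu; have uz0 := eucl_dist_ge0 u z; have uw0 := eucl_dist_ge0 u w.
  rewrite /q subr_sqr normrM.
  have -> : 8 * S * rho = 2 * S * (4 * rho) by ring.
  apply: ler_pM => //; rewrite ger0_norm ?addr_ge0//.
  by move: hu; rewrite ler_norml => /andP[? ?]; lra.
have qE : q x - q y = 2 * (tnth w i - tnth z i) * (tnth x i - tnth y i).
  rewrite /q !eucl_dist_sqr -!sumrB (bigD1 i)//= big1 ?addr0 => [|j ji].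
    by ring.
  by rewrite xy//; ring.
have : `|q x - q y| <= 16 * S * rho.
  rewrite (le_trans (ler_normB _ _))//.
  by have := qle _ xz hx; have := qle _ yz hy; lra.
rewrite qE !normrM ger0_norm// distrC => H.
rewrite ler_pdivlMr//.
apply: (@le_trans _ _ (`|tnth x i - tnth y i| * (d%:R * `|tnth z i - tnth w i|))).
  by rewrite ler_wpM2l.
have -> : `|tnth x i - tnth y i| * (d%:R * `|tnth z i - tnth w i|) =
  d%:R * (`|tnth z i - tnth w i| * `|tnth x i - tnth y i|) by ring.
have -> : 8 * d%:R * S * rho = d%:R * (8 * S * rho) by ring.
by rewrite ler_wpM2l//; lra.
Qed.

Lemma lebesgue_rd_annulus x (al be : R) : (0 < d)%N -> 0 < al -> al <= be ->
  (mu [set y | (al <= eucl_dist x y <= be)%R] <=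
   ((2 * d)%:R * ((2 * be) ^+ d.-1 * (d%:R * (be ^+ 2 - al ^+ 2) / (2 * al))))%:E)%E.
Proof.
move=> d0 al0 albe; have be0 : 0 <= be by lra.
have dR : 0 < d%:R :> R by rewrite ltr0n.
pose A (p : bool * 'I_d) := [set y : Rd | (al <= eucl_dist x y <= be)%R &&
  (al / d%:R <= (-1) ^+ p.1 * (tnth y p.2 - tnth x p.2))].
have mdist : measurable_fun [set: Rd] (fun y => eucl_dist x y).
  by apply: measurable_fun_eucl_dist.
have mann : measurable_fun [set: Rd] (fun y => al <= eucl_dist x y <= be).
  by apply: measurable_and; apply: measurable_fun_ler.
have mA p : measurable (A p).
  apply: measurable_set_bool; apply: measurable_and => //.
  apply: measurable_fun_ler => //; apply: measurable_funM => //.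
  by apply: measurable_funB => //; exact: measurable_tnth.
set c := (2 * be) ^+ d.-1 * _.
have Ac p : (mu (A p) <= c%:E)%E.
  apply: (@lebesgue_rd_thin _ _ _ x _ _ p.2) => //.
  - rewrite divr_ge0 ?mulr_ge0 ?subr_ge0 ?ler_pXn2r ?nnegrE//; lra.
  - move=> y /andP[/andP[_ yb] _] j; rewrite distrC.
    by rewrite (le_trans (eucl_dist_tnth _ _ _)).
  move=> y z /andP[/andP[ya yb] hy] /andP[/andP[za zb] hz] yz.
  pose t u := (-1) ^+ p.1 * (tnth u p.2 - tnth x p.2).
  have sq (u : Rd) : t u ^+ 2 = (tnth x p.2 - tnth u p.2) ^+ 2.
    by rewrite /t exprMn sqrr_sign mul1r -sqrrN opprB.
  have tE : `|tnth y p.2 - tnth z p.2| = `|t y - t z|.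
    by rewrite /t -mulrBr normrM normr_sign mul1r; congr Num.norm; ring.
  have dE : eucl_dist x y ^+ 2 - eucl_dist x z ^+ 2 = t y ^+ 2 - t z ^+ 2.
    rewrite !sq !eucl_dist_sqr -!sumrB (bigD1 p.2)//= big1 ?addr0// => j jp.
    by rewrite yz// subrr.
  have ty : al / d%:R <= t y by [].
  have tz : al / d%:R <= t z by [].
  have ad0 : 0 < al / d%:R by rewrite divr_gt0.
  have b2 u : al <= eucl_dist x u -> eucl_dist x u <= be ->
      al ^+ 2 <= eucl_dist x u ^+ 2 <= be ^+ 2.
    by move=> ua ub; rewrite !ler_pXn2r ?nnegrE ?ua ?ub ?eucl_dist_ge0//; lra.
  have /andP[y1 y2] := b2 _ ya yb; have /andP[z1 z2] := b2 _ za zb.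
  have : `|t y - t z| * `|t y + t z| <= be ^+ 2 - al ^+ 2.
    by rewrite -normrM -subr_sqr -dE ler_norml; apply/andP; split; lra.
  rewrite tE (ger0_norm (_ : 0 <= t y + t z)); last by lra.
  move=> H; rewrite ler_pdivlMr; last by lra.
  have : `|t y - t z| * (2 * (al / d%:R)) <= be ^+ 2 - al ^+ 2.
    by apply: le_trans H; rewrite ler_wpM2l//; lra.
  rewrite mulrA mulrA ler_pdivrMr//; lra.
apply: (@le_trans _ _ (\sum_(p \in [set: bool * 'I_d]) mu (A p))%E).
  apply: content_sub_fsum => //.
  - exact: finite_finset.
  - exact: measurable_set_bool.
  move=> y /= ay; have [i hi] := eucl_dist_coord x y d0.
  have : al / d%:R <= `|tnth y i - tnth x i|.
    rewrite ler_pdivrMr// mulrC distrC (le_trans _ hi)//.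
    by case/andP: ay.
  rewrite /A; case: (ger0P (tnth y i - tnth x i)) => _ h.
    by exists (false, i) => //=; rewrite ay expr0 mul1r.
  by exists (true, i) => //=; rewrite ay expr1 mulN1r.
rewrite (@fsbigE _ _ _ _ setT (index_enum (bool * 'I_d)%type)); last 3 first.
- exact: index_enum_uniq.
- by [].
- by move=> i _; rewrite mem_index_enum.
rewrite big_mkcond /= (eq_bigr (fun p => mu (A p))) => [|p _]; last first.
  by rewrite in_setT.
apply: (@le_trans _ _ (\sum_(p : bool * 'I_d) c%:E)%E); first exact: lee_sum.
by rewrite sumEFin sumr_const card_prod card_bool card_ord -[X in (X%:E <= _)%E]mulr_natl.
Qed.

End slab_annulus.

(** * Dyadic cells *)

Section cells.
Context {R : realType} {d : nat}.
Local Notation Rd := (d.-tuple R).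
Local Notation mu := (lebesgue_rd (R := R) d).
Implicit Types (s : R) (x y z : Rd).

Definition same_cell s x y : bool :=
  [forall i, Num.floor (tnth x i / s) == Num.floor (tnth y i / s)].

Lemma same_cell_refl s x : same_cell s x x.
Proof. exact/forallP. Qed.

Lemma same_cell_sym s x y : same_cell s x y = same_cell s y x.
Proof. by apply: eq_forallb => i; rewrite eq_sym. Qed.

Lemma same_cell_trans s y x z : same_cell s x y -> same_cell s y z ->
  same_cell s x z.
Proof.
by move=> /forallP xy /forallP yz; apply/forallP => i; rewrite (eqP (xy i)).
Qed.

Lemma same_cell_double s x y : same_cell s x y -> same_cell (2 * s) x y.
Proof.
move=> /forallP xy; apply/forallP => i.
have h (a b : R) : Num.floor a = Num.floor b -> Num.floor (a / 2) <= Num.floor (b / 2).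
  move=> ab; rewrite floor_ge_int.
  have h1 : (2 * Num.floor (a / 2))%:~R <= a.
    by rewrite intrM; have := floor_le (a / 2); lra.
  have : (2 * Num.floor (a / 2))%:~R <= b by rewrite -floor_ge_int -ab floor_ge_int.
  rewrite intrM; lra.
have E (a : R) : a / (2 * s) = a / s / 2 by rewrite invfM mulrCA mulrC -mulrA.
by rewrite !E eq_le !h//; apply/eqP; rewrite ?(eqP (xy i)).
Qed.

Lemma same_cell_dist s x y : 0 < s -> same_cell s x y -> eucl_dist x y <= d%:R * s.
Proof.
move=> s0 /forallP xy; apply: eucl_dist_le => [|i]; first exact: ltW.
have := eqP (xy i); set a := tnth x i; set b := tnth y i => ab.
have := floor_itv (a / s); have := floor_itv (b / s).
rewrite ab !ler_pdivlMr// !ltr_pdivrMr// intrD mulrDl mul1r.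
by move=> /andP[? ?] /andP[? ?]; rewrite ler_norml; apply/andP; split; lra.
Qed.

Lemma lebesgue_rd_cell s x : 0 < s ->
  (((s / 2) ^+ d)%:E <= mu [set y | same_cell s x y])%E.
Proof.
move=> s0.
pose c := [tuple ((Num.floor (tnth x i / s))%:~R + 4^-1) * s | i < d].
have -> : s / 2 = 2 * (s / 4) by lra.
rewrite -(@lebesgue_rd_cube _ _ c); last by lra.
apply: lebesgue_rd_mono => y /= yc; apply/forallP => i; apply/eqP/esym.
have := yc i; rewrite tnth_mktuple ler_norml => /andP[? ?].
apply: floor_def.
rewrite ler_pdivlMr// ltr_pdivrMr// intrD; apply/andP; split; lra.
Qed.

Lemma measurable_same_cell dd (T : measurableType dd) s (f g : T -> Rd) :
  measurable_fun setT f -> measurable_fun setT g ->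
  measurable_fun setT (fun t => same_cell s (f t) (g t)).
Proof.
move=> mf mg; apply: measurable_forall_ord => i.
have mfl : measurable_fun [set: R] (fun r : R => (Num.floor (r / s))%:~R : R).
  apply: (@measurableT_comp _ _ _ _ _ _ (fun r : R => (Num.floor r)%:~R : R)).
    by apply: nondecreasing_measurable => // a b ab; rewrite ler_int le_floor.
  exact: mulrr_measurable.
rewrite (_ : (fun t => _) = (fun t => (Num.floor (tnth (f t) i / s))%:~R ==
    (Num.floor (tnth (g t) i / s))%:~R :> R)); last first.
  by apply/funext => t; rewrite eqr_int.
by apply: measurable_fun_eqr; apply: (measurableT_comp mfl);
  exact: (measurableT_comp (measurable_tnth i)).
Qed.

End cells.

Lemma measurable_funV_ge0 dd (T : measurableType dd) (R : realType) (f : T -> R) :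
  (forall x, 0 <= f x) -> measurable_fun setT f ->
  measurable_fun setT (fun x => (f x)^-1).
Proof.
move=> f0 mf; rewrite (_ : (fun x => _) = (fun x => powR (f x) (-1))).
  exact: (measurableT_comp (measurable_powR (-1)) mf).
by apply/funext => x; rewrite powR_inv1.
Qed.

Lemma nneseries_le_bound (R : realType) (u : nat -> \bar R) (B : \bar R) :
  (forall n, 0 <= u n)%E -> (forall n, \sum_(0 <= k < n) u k <= B)%E ->
  (\sum_(k <oo) u k <= B)%E.
Proof.
move=> u0 uB; apply: lime_le; first exact: is_cvg_nneseries.
by apply: nearW => n.
Qed.

Lemma sum_geometric_half_le (R : realType) n :
  \sum_(0 <= k < n) ((2 : R) ^+ k)^-1 <= 2.
Proof.
suff : \sum_(0 <= k < n) ((2 : R) ^+ k)^-1 <= 2 - (2 ^+ n)^-1 * 2.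
  by move=> /le_trans; apply; rewrite gerBl mulr_ge0// invr_ge0 exprn_ge0.
elim: n => [|n IH]; first by rewrite big_nil expr0; lra.
rewrite big_nat_recr//= exprS invfM.
by set a := (2 ^+ n)^-1 in IH *; lra.
Qed.

Section real_integrands.
Context dd (T : measurableType dd) (R : realType).
Variable m : {measure set T -> \bar R}.

Lemma integral_realZl (k : R) (g : T -> R) : 0 <= k -> measurable_fun setT g ->
  (forall x, 0 <= g x) ->
  (\int[m]_x (k * g x)%:E = k%:E * \int[m]_x (g x)%:E)%E.
Proof.
move=> k0 mg g0; under eq_integral do rewrite EFinM.
rewrite ge0_integralZl//; first exact/measurable_EFinP.
by move=> x _; rewrite lee_fin.
Qed.

Lemma integral_realD (f g : T -> R) : measurable_fun setT f ->
  measurable_fun setT g -> (forall x, 0 <= f x) -> (forall x, 0 <= g x) ->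
  (\int[m]_x (f x + g x)%:E = \int[m]_x (f x)%:E + \int[m]_x (g x)%:E)%E.
Proof.
move=> mf mg f0 g0; under eq_integral do rewrite EFinD.
rewrite ge0_integralD//; first by move=> x _; rewrite lee_fin.
- exact/measurable_EFinP.
- by move=> x _; rewrite lee_fin.
- exact/measurable_EFinP.
Qed.

Lemma integral_real_sum (I : Type) (s : seq I) (g : I -> T -> R) :
  (forall i, measurable_fun setT (g i)) -> (forall i x, 0 <= g i x) ->
  (\int[m]_x (\sum_(i <- s) g i x)%:E = \sum_(i <- s) \int[m]_x (g i x)%:E)%E.
Proof.
move=> mg g0; under eq_integral do rewrite -sumEFin.
by rewrite ge0_integral_sum//; [move=> i; exact/measurable_EFinP |
  move=> i x _; rewrite lee_fin].
Qed.

Lemma le_integral_real (f g : T -> R) : (forall x, 0 <= f x) ->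
  (forall x, f x <= g x) -> (\int[m]_x (f x)%:E <= \int[m]_x (g x)%:E)%E.
Proof. by move=> f0 fg; apply: ge0_le_integralW => x; rewrite lee_fin. Qed.

Lemma integral_real_ge0 (f : T -> R) : (forall x, 0 <= f x) ->
  (0 <= \int[m]_x (f x)%:E)%E.
Proof. by move=> f0; apply: integral_ge0 => x _; rewrite lee_fin. Qed.

End real_integrands.

Section density_integrals.
Context {R : realType} {d : nat}.
Local Notation Rd := (d.-tuple R).
Local Notation mu := (lebesgue_rd (R := R) d).
Implicit Types (x y z : Rd) (q : Rd -> R).

Lemma integral_natr_bool (b : Rd -> bool) : measurable_fun setT b ->
  (\int[mu]_y ((b y)%:R)%:E = mu [set y | b y])%E.
Proof.
move=> mb; rewrite -[in RHS](setIT [set y | b y]) -integral_indic//; last exact: measurable_set_bool.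
by apply: eq_integral => y _; rewrite indicE mem_setE.
Qed.

Lemma tonelli_rd (H : Rd * Rd -> R) : measurable_fun setT H ->
  (forall p, 0 <= H p) ->
  (\int[mu]_x \int[mu]_z (H (x, z))%:E = \int[mu]_z \int[mu]_x (H (x, z))%:E)%E.
Proof.
move=> mH H0; apply: (@fubini_tonelli _ _ _ _ R mu mu (fun p => (H p)%:E)).
  exact/measurable_EFinP.
by move=> p; rewrite lee_fin.
Qed.

Lemma density_smear (s lam : R) q (A A' : Rd -> bool) :
  0 < s -> 0 <= lam -> measurable_fun setT q -> (forall x, 0 <= q x) ->
  measurable_fun setT A -> measurable_fun setT A' ->
  (forall y, \int[mu]_w ((same_cell s y w)%:R * q w)%:E <= (lam * s ^+ d)%:E)%E ->
  (forall w y, A w -> same_cell s w y -> A' y) ->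
  (\int[mu]_w ((A w)%:R * q w)%:E <= (2 ^+ d * lam)%:E * mu [set y | A' y])%E.
Proof.
move=> s0 lam0 mq q0 mA mA' cellq AA'.
have mAq : measurable_fun setT (fun w => (A w)%:R * q w : R).
  by apply: measurable_funM => //; exact: measurable_natr_bool.
have Aq0 w : 0 <= (A w)%:R * q w by rewrite mulr_ge0.
have mcell x : measurable_fun setT (fun y : Rd => (same_cell s x y)%:R : R).
  by apply: measurable_natr_bool; apply: measurable_same_cell.
set I := (\int[mu]_w _)%E.
have sd0 : 0 < (s / 2) ^+ d by rewrite exprn_gt0// divr_gt0.
suff : (((s / 2) ^+ d)%:E * I <= (lam * s ^+ d)%:E * mu [set y | A' y])%E.
  rewrite -lee_pdivlMl// muleA -EFinM.
  rewrite (_ : ((s / 2) ^+ d)^-1 * (lam * s ^+ d) = 2 ^+ d * lam)//.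
  have : s ^+ d != 0 by rewrite expf_neq0// gt_eqF.
  have : 2 ^+ d != 0 :> R by rewrite expf_neq0.
  rewrite expr_div_n; move: (s ^+ d) (2 ^+ d : R) => u v v0 u0.
  by field; rewrite u0 v0.
rewrite /I -integral_realZl ?(ltW sd0)//.
apply: (@le_trans _ _ (\int[mu]_w \int[mu]_y
    ((A w)%:R * q w * (same_cell s w y)%:R)%:E)%E).
  apply: ge0_le_integralW => w; first by rewrite lee_fin mulr_ge0// ltW.
  rewrite integral_realZl// mulrC EFinM lee_wpmul2l ?lee_fin//.
  rewrite integral_natr_bool; last exact: measurable_same_cell.
  exact: lebesgue_rd_cell.
rewrite (@tonelli_rd (fun p => (A p.1)%:R * q p.1 * (same_cell s p.1 p.2)%:R)); last 2 first.
- apply: measurable_funM; first exact: (measurableT_comp mAq measurable_fst).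
  by apply: measurable_natr_bool; apply: measurable_same_cell.
- by move=> [w y] /=; rewrite mulr_ge0.
rewrite -integral_natr_bool// -integral_realZl ?mulr_ge0 ?exprn_ge0 ?(ltW s0)//; last first.
  exact: measurable_natr_bool.
apply: ge0_le_integralW => y /=.
  by apply: integral_ge0 => w _; rewrite lee_fin mulr_ge0.
have [A'y|nA'y] := boolP (A' y); last first.
  rewrite mulr0 (_ : (\int[mu]_w _)%E = 0%E)//; apply: integral0_eq => w _.
  case: (boolP (A w)) => [Aw|]; last by rewrite !mul0r.
  case: (boolP (same_cell s w y)) => [wy|]; last by rewrite mulr0.
  by rewrite (AA' _ _ Aw wy) in nA'y.
rewrite mulr1; apply: le_trans (cellq y); apply: le_integral_real => w.
  by rewrite mulr_ge0.
rewrite same_cell_sym; case: (A w); case: (same_cell s y w);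
  by rewrite ?(mul1r, mul0r, mulr1, mulr0, lexx, q0).
Qed.

Definition poisson (s : R) x z : R := s / Num.max (eucl_dist x z) s ^+ d.+1.

Lemma poisson_ge0 s x z : 0 <= s -> 0 <= poisson s x z.
Proof. by move=> s0; rewrite divr_ge0// exprn_ge0// le_max s0 orbT. Qed.

Lemma poissonC s x z : poisson s x z = poisson s z x.
Proof. by rewrite /poisson eucl_distC. Qed.

Lemma measurable_poisson dd (T : measurableType dd) s (f g : T -> Rd) : 0 <= s ->
  measurable_fun setT f -> measurable_fun setT g ->
  measurable_fun setT (fun t => poisson s (f t) (g t)).
Proof.
move=> s0 mf mg; apply: measurable_funM => //; apply: measurable_funV_ge0.
  by move=> t; rewrite exprn_ge0// le_max s0 orbT.
apply: measurable_funX; apply: measurable_maxr => //.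
exact: measurable_fun_eucl_dist.
Qed.

Lemma poisson_growth q (s A : R) z : 0 < s -> 0 <= A ->
  measurable_fun setT q -> (forall x, 0 <= q x) ->
  (forall n, \int[mu]_x ((eucl_dist z x <= 2 ^+ n * s)%R%:R * q x)%:E <=
    (A * (2 ^+ n * s) ^+ d)%:E)%E ->
  (\int[mu]_x (poisson s z x * q x)%:E <= (2 ^+ d.+2 * A)%:E)%E.
Proof.
move=> s0 A0 mq q0 growth.
pose c n : R := s / (2 ^+ n * s / 2) ^+ d.+1.
have pow0 n : 0 < 2 ^+ n * s by rewrite mulr_gt0// exprn_gt0.
have c0 n : 0 <= c n by rewrite divr_ge0 ?exprn_ge0 ?divr_ge0// ltW.
pose g n x : R := c n * ((eucl_dist z x <= 2 ^+ n * s)%R%:R * q x).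
have g0 n x : 0 <= g n x by apply: mulr_ge0 => //; exact: mulr_ge0.
have mi n : measurable_fun setT (fun x => (eucl_dist z x <= 2 ^+ n * s)%R%:R * q x : R).
  apply: measurable_funM => //; apply: measurable_natr_bool.
  by apply: measurable_fun_ler => //; apply: measurable_fun_eucl_dist.
apply: (@le_trans _ _ (\int[mu]_x \sum_(n <oo) (g n x)%:E)%E).
  apply: ge0_le_integralW => x.
    by rewrite lee_fin mulr_ge0// poisson_ge0// ltW.
  set u := Num.max (eucl_dist z x) s.
  have [n un nmin] : exists2 n, u <= 2 ^+ n * s &
      forall m, u <= 2 ^+ m * s -> (n <= m)%N.
    have ex : exists n, u <= 2 ^+ n * s.
      exists (Num.truncn (u / s)).+1; rewrite -ler_pdivrMr//.
      rewrite (le_trans (ltW (truncnS_gt _)))// -natrX ler_nat ltnW//.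
      exact: ltn_expl.
    by exists (ex_minn ex); case: ex_minnP.
  have un2 : 2 ^+ n * s / 2 <= u.
    case: n un nmin => [|n] un nmin.
      by rewrite expr0 mul1r (@le_trans _ _ s)// ?le_max ?lexx ?orbT//; lra.
    have : ~~ (u <= 2 ^+ n * s) by apply/negP => /nmin; rewrite ltnn.
    by rewrite -ltNge exprS => ?; lra.
  apply: (@le_trans _ _ (g n x)%:E); last first.
    apply: (@le_trans _ _ (\sum_(0 <= k < n.+1) (g k x)%:E)%E).
      by rewrite big_nat_recr//= leeDr// sume_ge0// => k _; rewrite lee_fin.
    by apply: nneseries_lim_ge => k _; rewrite lee_fin.
  rewrite lee_fin /g (_ : (eucl_dist z x <= _) = true) ?mul1r; last first.
    by rewrite (le_trans _ un)// le_max lexx.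
  have u0 : 0 < u by rewrite lt_max s0 orbT.
  have h0 : 0 < 2 ^+ n * s / 2 by rewrite divr_gt0.
  rewrite ler_wpM2r// ler_wpM2l ?(ltW s0)// lef_pV2 ?posrE ?exprn_gt0//.
  by rewrite ler_pXn2r// ?nnegrE ?(ltW u0) ?(ltW h0).
rewrite integral_nneseries//; last 2 first.
- by move=> n; apply/measurable_EFinP; apply: measurable_funM.
- by move=> n x _; rewrite lee_fin.
have B n : (\int[mu]_x (g n x)%:E <= (2 ^+ d.+1 * A * (2 ^+ n)^-1)%:E)%E.
  rewrite integral_realZl//; last by move=> x; rewrite mulr_ge0.
  apply: (@le_trans _ _ ((c n)%:E * (A * (2 ^+ n * s) ^+ d)%:E)%E).
    by rewrite lee_wpmul2l// lee_fin.
  rewrite -EFinM lee_fin /c expr_div_n invf_div.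
  have := pow0 n; set a := 2 ^+ n; set t := a * s => t0.
  have a0 : 0 < a by rewrite exprn_gt0.
  rewrite [t ^+ d.+1]exprS.
  have td0 : t ^+ d != 0 by rewrite expf_neq0// gt_eqF.
  rewrite le_eqVlt; apply/orP; left; apply/eqP.
  move: (t ^+ d) (2 ^+ d.+1 : R) td0 => v w v0.
  by rewrite /t; field; rewrite v0 !gt_eqF.
apply: nneseries_le_bound => n.
  by apply: integral_ge0 => x _; rewrite lee_fin.
apply: (@le_trans _ _ (\sum_(0 <= k < n) (2 ^+ d.+1 * A * (2 ^+ k)^-1)%:E)%E).
  exact: lee_sum.
rewrite sumEFin lee_fin -mulr_sumr.
have -> : 2 ^+ d.+2 * A = 2 ^+ d.+1 * A * 2 :> R by rewrite [in LHS]exprS; ring.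
by rewrite ler_wpM2l ?sum_geometric_half_le// mulr_ge0.
Qed.

End density_integrals.

(** * Stopping cells *)

Section stopping.
Context {R : realType} {d : nat}.
Local Notation Rd := (d.-tuple R).
Local Notation mu := (lebesgue_rd (R := R) d).
Variables (eta lam : R) (p : Rd -> R) (J : nat).
Hypotheses (eta0 : 0 < eta) (lam0 : 0 < lam).
Hypotheses (mp : measurable_fun setT p) (p0 : forall x, 0 <= p x).
Implicit Types (x y z w : Rd) (i j k : nat).

Let eta_ge0 : 0 <= eta. Proof. exact: ltW. Qed.
Let lam_ge0 : 0 <= lam. Proof. exact: ltW. Qed.
#[local] Hint Resolve eta_ge0 lam_ge0 : core.

Definition scale j : R := 2 ^+ j * eta.

Definition heavy j z : bool :=
  ((lam * scale j ^+ d)%:E <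
     \int[mu]_w ((same_cell (scale j) z w)%:R * p w)%:E)%E.

Hypothesis heavyJ : forall j z, (J <= j)%N -> ~~ heavy j z.

(* The part of the dyadic maximal level set covered by heavy cells of side at
   least [scale i]. *)
Definition stopped i z : bool := [exists j : 'I_J, (i <= j)%N && heavy j z].

(* The maximal heavy cell containing z has side [scale j]. *)
Definition stop_at j z : bool := stopped j z && ~~ stopped j.+1 z.

Lemma scale_gt0 j : 0 < scale j.
Proof. by rewrite mulr_gt0// exprn_gt0. Qed.

Lemma scale_ge0 j : 0 <= scale j.
Proof. exact/ltW/scale_gt0. Qed.
#[local] Hint Resolve scale_gt0 scale_ge0 : core.

Lemma scaleS j : scale j.+1 = 2 * scale j.
Proof. by rewrite /scale exprS mulrA. Qed.

Lemma scale_le i j : (i <= j)%N -> scale i <= scale j.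
Proof. by move=> ij; rewrite ler_pM2r// ler_weXn2l ?ler1n. Qed.

Lemma same_cell_scale i j x y : (i <= j)%N ->
  same_cell (scale i) x y -> same_cell (scale j) x y.
Proof.
move=> /subnK <-; elim: (j - i)%N => [//|n IH] xy.
by rewrite addSn scaleS; apply: same_cell_double; exact: IH.
Qed.

Lemma measurable_cell_mass j : measurable_fun setT (fun x : Rd =>
  (\int[mu]_w ((same_cell (scale j) x w)%:R * p w)%:E)%E).
Proof.
apply: (@measurable_fun_fubini_tonelli_F _ _ _ _ R mu
  (fun u : Rd * Rd => ((same_cell (scale j) u.1 u.2)%:R * p u.2)%:E)).
  apply/measurable_EFinP; apply: measurable_funM.
    by apply: measurable_natr_bool; apply: measurable_same_cell.
  exact: (measurableT_comp mp measurable_snd).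
by move=> u; rewrite lee_fin mulr_ge0.
Qed.

Lemma measurable_heavy j : measurable_fun setT (heavy j).
Proof.
apply: (measurable_fun_bool true); rewrite setTI.
rewrite (_ : _ @^-1` _ = [set: Rd] `&` [set z : Rd | ((lam * scale j ^+ d)%:E <
   \int[mu]_w ((same_cell (scale j) z w)%:R * p w)%:E)%E]); last first.
  by rewrite setTI.
by apply: emeasurable_fun_o_infty => //; exact: measurable_cell_mass.
Qed.

Lemma measurable_stopped i : measurable_fun setT (stopped i).
Proof.
rewrite (_ : stopped i = fun z => ~~ [forall j : 'I_J, ~~ ((i <= j)%N && heavy j z)]).
  apply: measurable_neg; apply: measurable_forall_ord => j.
  apply: measurable_neg; apply: measurable_and => //; exact: measurable_heavy.
by apply/funext => z; rewrite negb_forall; apply: eq_existsb => j; rewrite negbK.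
Qed.

Lemma measurable_stop_at j : measurable_fun setT (stop_at j).
Proof.
by apply: measurable_and; [|apply: measurable_neg]; exact: measurable_stopped.
Qed.

Lemma stopped_mono i j z : (i <= j)%N -> stopped j z -> stopped i z.
Proof.
move=> ij /existsP[k /andP[jk hk]]; apply/existsP; exists k.
by rewrite (leq_trans ij jk).
Qed.

Lemma stopped_ge i z : (J <= i)%N -> stopped i z = false.
Proof.
move=> Ji; apply/existsP => -[k /andP[ik _]].
by have := leq_trans Ji ik; rewrite leqNgt ltn_ord.
Qed.

Lemma heavy_stopped j z : heavy j z -> stopped j z.
Proof.
move=> hj; have [Jj|jJ] := leqP J j; first by rewrite (negbTE (heavyJ z Jj)) in hj.
by apply/existsP; exists (Ordinal jJ); rewrite leqnn.
Qed.

Lemma stop_at_heavy j z : stop_at j z -> heavy j z.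
Proof.
move=> /andP[/existsP[k /andP[jk hk]] ns].
move: jk; rewrite leq_eqVlt => /orP[/eqP -> //|jk].
by case/negP: ns; apply: stopped_mono (heavy_stopped hk).
Qed.

Lemma stopped_stop_at i z : stopped i z -> exists j : 'I_J, (i <= j)%N && stop_at j z.
Proof.
move=> si.
have ex : exists j, (i <= j)%N && stopped j z by exists i; rewrite leqnn.
have ub j : (i <= j)%N && stopped j z -> (j <= J)%N.
  move=> /andP[_ sj]; rewrite leqNgt; apply/negP => /ltnW Jj.
  by rewrite stopped_ge in sj.
case: (ex_maxnP ex ub) => j /andP[ij sj] jmax.
have jJ : (j < J)%N by rewrite ltnNge; apply/negP => Jj; rewrite stopped_ge in sj.
exists (Ordinal jJ); rewrite ij /stop_at sj /=; apply/negP => sj1.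
by have := jmax j.+1; rewrite (leq_trans ij (leqnSn _)) sj1 ltnn => /(_ isT).
Qed.

Lemma stop_at_uniq i j z : stop_at i z -> stop_at j z -> i = j.
Proof.
wlog ij : i j / (i < j)%N => [H si sj|/andP[_ ni] /andP[sj _]].
  by have [ij|ij|//] := ltngtP i j; [exact: H|exact/esym/H].
by rewrite (stopped_mono ij sj) in ni.
Qed.

Lemma sum_stop_at_le1 z : \sum_(j < J) (stop_at j z)%:R <= 1 :> R.
Proof.
have [[j sj]|no] := pselect (exists j : 'I_J, stop_at j z).
  rewrite (bigD1 j)//= big1 ?addr0 ?lern1 ?leq_b1// => k kj.
  case: (boolP (stop_at k z)) => // sk; case/eqP: kj; apply: val_inj.
  exact: stop_at_uniq sk sj.
rewrite big1// => j _; case: (boolP (stop_at j z)) => // sj.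
by case: no; exists j.
Qed.

Lemma heavy_cell i j x y : (i <= j)%N -> same_cell (scale i) x y ->
  heavy j x = heavy j y.
Proof.
move=> ij /(same_cell_scale ij) xy; congr (_ < _)%E.
apply: eq_integral => w _; congr (_%:R * _)%:E; congr nat_of_bool.
by apply/idP/idP; apply: same_cell_trans; rewrite // same_cell_sym.
Qed.

Lemma stopped_cell i j x y : (i <= j)%N -> same_cell (scale i) x y ->
  stopped j x = stopped j y.
Proof.
move=> ij xy; apply: eq_existsb => k; case: (leqP j k) => //= jk.
exact: heavy_cell (leq_trans ij jk) xy.
Qed.

Lemma stop_at_cell j x y : same_cell (scale j) x y -> stop_at j x = stop_at j y.
Proof.
by move=> xy; rewrite /stop_at (stopped_cell (leqnn j) xy)
  (stopped_cell (leqnSn j) xy).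
Qed.

Lemma measurable_unstopped i :
  measurable_fun setT (fun w => (~~ stopped i w)%:R * p w : R).
Proof.
apply: measurable_funM => //; apply: measurable_natr_bool.
by apply: measurable_neg; exact: measurable_stopped.
Qed.

Lemma measurable_stop_at_density j :
  measurable_fun setT (fun w => (stop_at j w)%:R * p w : R).
Proof.
by apply: measurable_funM => //; apply: measurable_natr_bool; exact: measurable_stop_at.
Qed.

Lemma unstopped_cell i y :
  (\int[mu]_w ((same_cell (scale i) y w)%:R * ((~~ stopped i w)%:R * p w))%:E <=
    (lam * scale i ^+ d)%:E)%E.
Proof.
have [hi|nhi] := boolP (heavy i y).
  rewrite (_ : (\int[mu]_w _)%E = 0%E) ?lee_fin ?mulr_ge0 ?exprn_ge0 ?(ltW lam0)//.
  apply: integral0_eq => w _; case: (boolP (same_cell _ y w)) => [yw|]; last by rewrite mul0r.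
  by rewrite -(stopped_cell (leqnn i) yw) heavy_stopped// mul0r mulr0.
move: nhi; rewrite -leNgt; apply: le_trans; apply: le_integral_real => w.
  by do 2 apply: mulr_ge0 => //.
by rewrite ler_wpM2l// ler_piMl// lern1 leq_b1.
Qed.

Definition ball_cst : R := 2 ^+ d * (2 * (1 + 2 * d%:R)) ^+ d.

Lemma ball_cst_ge0 : 0 <= ball_cst.
Proof. by rewrite mulr_ge0 ?exprn_ge0 ?mulr_ge0 ?addr_ge0 ?mulr_ge0. Qed.

Lemma unstopped_ball i y (rho : R) : scale i / 2 <= rho ->
  (\int[mu]_w ((eucl_dist y w <= rho)%R%:R * ((~~ stopped i w)%:R * p w))%:E <=
    (ball_cst * lam * rho ^+ d)%:E)%E.
Proof.
move=> irho; have rho0 : 0 <= rho by rewrite (le_trans _ irho)// divr_ge0.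
pose r' := rho + d%:R * scale i.
have r'0 : 0 <= r' by rewrite addr_ge0 ?mulr_ge0.
have mball (r : R) : measurable_fun setT (fun w : Rd => eucl_dist y w <= r).
  by apply: measurable_fun_ler => //; apply: measurable_fun_eucl_dist.
apply: (@le_trans _ _
    ((2 ^+ d * lam)%:E * mu [set w : Rd | (eucl_dist y w <= r')%R])%E).
  apply: (@density_smear R d (scale i) lam (fun w => (~~ stopped i w)%:R * p w)
    (fun w => eucl_dist y w <= rho) (fun w => eucl_dist y w <= r')) => //.
  - exact: measurable_unstopped.
  - by move=> x; rewrite mulr_ge0.
  - exact: unstopped_cell.
  move=> w z yw wz; rewrite (le_trans (eucl_dist_triangle w _ _))// lerD//.
  exact: same_cell_dist.
apply: (@le_trans _ _ ((2 ^+ d * lam)%:E * ((2 * r') ^+ d)%:E)%E).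
  by rewrite lee_wpmul2l ?lee_fin ?mulr_ge0 ?exprn_ge0 ?(ltW lam0)// lebesgue_rd_ball_le.
rewrite -EFinM lee_fin /ball_cst.
have : (2 * r') ^+ d <= (2 * (1 + 2 * d%:R)) ^+ d * rho ^+ d.
  rewrite -exprMn; apply: lerXn2r; rewrite ?nnegrE.
  - exact: mulr_ge0.
  - by rewrite !mulr_ge0 ?addr_ge0 ?mulr_ge0.
  by have := ler_wpM2l (ler0n R d) irho; rewrite /r'; lra.
have c0 : 0 <= 2 ^+ d * lam by rewrite mulr_ge0// exprn_ge0.
move=> /(ler_wpM2l c0) /le_trans; apply.
by rewrite le_eqVlt; apply/orP; left; apply/eqP; ring.
Qed.

End stopping.

(** * Exceptional functions *)

Section shell_kernels.
Context {R : realType} {d : nat}.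
Local Notation Rd := (d.-tuple R).
Local Notation mu := (lebesgue_rd (R := R) d).
Implicit Types (x y z w : Rd).

Definition inv_dist x z : R := (eucl_dist x z ^+ d)^-1.

Lemma inv_dist_ge0 x z : 0 <= inv_dist x z.
Proof. by rewrite invr_ge0 exprn_ge0// eucl_dist_ge0. Qed.

Lemma measurable_inv_dist dd (T : measurableType dd) (f g : T -> Rd) :
  measurable_fun setT f -> measurable_fun setT g ->
  measurable_fun setT (fun t => inv_dist (f t) (g t)).
Proof.
move=> mf mg; apply: measurable_funV_ge0.
  by move=> t; rewrite exprn_ge0// eucl_dist_ge0.
by apply: measurable_funX; exact: measurable_fun_eucl_dist.
Qed.

Lemma inv_dist_le (c : R) x y z : 0 < c -> 0 < eucl_dist x z ->
  eucl_dist x z <= c * eucl_dist x y -> inv_dist x y <= c ^+ d * inv_dist x z.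
Proof.
move=> c0 xz0 xzy; rewrite /inv_dist.
have xy0 : 0 < eucl_dist x y.
  rewrite lt0r eucl_dist_ge0 andbT; apply/eqP => xy0.
  by move: xzy; rewrite xy0 mulr0 leNgt xz0.
rewrite ler_pdivlMr ?exprn_gt0// mulrC ler_pdivrMr ?exprn_gt0//.
by rewrite -exprMn; apply: lerXn2r; rewrite ?nnegrE ?mulr_ge0 ?(ltW c0) ?eucl_dist_ge0.
Qed.

Definition same_shell (S : R) x z w : bool :=
  `|eucl_dist x z - eucl_dist x w| <= 2 * S.

Lemma measurable_same_shell dd (T : measurableType dd) S (f g h : T -> Rd) :
  measurable_fun setT f -> measurable_fun setT g -> measurable_fun setT h ->
  measurable_fun setT (fun t => same_shell S (f t) (g t) (h t)).
Proof.
move=> mf mg mh; apply: measurable_fun_ler => //; apply: measurableT_comp => //.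
by apply: measurable_funB; exact: measurable_fun_eucl_dist.
Qed.

Lemma integral_poisson (s : R) z : 0 < s ->
  (\int[mu]_x (poisson s x z)%:E <= (2 ^+ d.+2 * 2 ^+ d)%:E)%E.
Proof.
move=> s0; have -> : (\int[mu]_x (poisson s x z)%:E =
    \int[mu]_x (poisson s z x * 1)%:E)%E.
  by apply: eq_integral => x _; rewrite mulr1 poissonC.
apply: poisson_growth => //.
move=> n; have pow0 : 0 <= 2 ^+ n * s by rewrite mulr_ge0 ?exprn_ge0 ?ltW.
rewrite -exprMn; apply: le_trans (lebesgue_rd_ball_le z pow0).
rewrite -integral_natr_bool; last first.
  by apply: measurable_fun_ler => //; apply: measurable_fun_eucl_dist.
by apply: le_integral_real => x; rewrite mulr1.
Qed.

Definition slab_cst : R :=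
  3 ^+ d * 4 ^+ d * (2 ^+ d.+2 * (2 ^+ d.-1 * (8 * d%:R))).

Lemma slab_cst_ge0 : 0 <= slab_cst.
Proof. rewrite /slab_cst; nonneg. Qed.

Lemma integral_same_shell (S : R) z w : (0 < d)%N -> 0 < S ->
  8 * S <= eucl_dist z w ->
  (\int[mu]_x (inv_dist x z * inv_dist x w * (same_shell S x z w)%:R)%:E <=
   (slab_cst * (S / eucl_dist z w ^+ d.+1))%:E)%E.
Proof.
move=> d0 S0 SD; set D := eucl_dist z w in SD *.
have D0 : 0 < D by lra.
pose s := D / 4; have s0 : 0 < s by rewrite divr_gt0.
pose q x : R := (same_shell S x z w)%:R.
have mq : measurable_fun setT q.
  by apply: measurable_natr_bool; apply: measurable_same_shell.
have A0 : 0 <= 2 ^+ d.-1 * (8 * d%:R) * (S / D).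
  nonneg.
have : (\int[mu]_x (poisson s z x * q x)%:E <=
    (2 ^+ d.+2 * (2 ^+ d.-1 * (8 * d%:R) * (S / D)))%:E)%E.
  apply: poisson_growth => // n.
  have pow1 : s <= 2 ^+ n * s by rewrite ler_peMl ?(ltW s0)// exprn_ege1// ler1n.
  set rho := 2 ^+ n * s in pow1 *.
  have r0 : 0 < rho by exact: lt_le_trans s0 pow1.
  have Sr : S <= rho by rewrite (le_trans _ pow1)// /s; lra.
  have := lebesgue_rd_slab d0 D0 (ltW S0) Sr.
  rewrite -integral_natr_bool; last first.
    apply: measurable_and; last exact: measurable_same_shell.
    by apply: measurable_fun_ler => //; apply: measurable_fun_eucl_dist.
  rewrite (_ : (2 * rho) ^+ d.-1 * _ =
      2 ^+ d.-1 * (8 * d%:R) * (S / D) * rho ^+ d); last first.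
    rewrite -[in RHS](prednK d0) exprMn [rho ^+ d.-1.+1]exprS.
    by rewrite (prednK d0); ring.
  apply: le_trans; apply: le_integral_real => x; first by rewrite mulr_ge0.
  rewrite /q /same_shell (eucl_distC z x) -natrM mulnb//.
move=> H; apply: (@le_trans _ _ ((3 ^+ d * (s ^+ d)^-1)%:E *
    (2 ^+ d.+2 * (2 ^+ d.-1 * (8 * d%:R) * (S / D)))%:E)%E); last first.
  rewrite -EFinM lee_fin /slab_cst [D ^+ d.+1]exprS /s expr_div_n.
  have : D ^+ d != 0 by rewrite expf_neq0// gt_eqF.
  have : 4 ^+ d != 0 :> R by rewrite expf_neq0.
  move: (D ^+ d) (4 ^+ d : R) (3 ^+ d : R) (2 ^+ d.+2 : R) (2 ^+ d.-1 : R)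
    => a b e f g b0 a0.
  rewrite le_eqVlt; apply/orP; left; apply/eqP.
  by field; rewrite a0 b0 gt_eqF.
apply: le_trans (lee_wpmul2l _ H); last first.
  rewrite lee_fin; nonneg.
have K0 x : 0 <= poisson s z x * q x by rewrite mulr_ge0// poisson_ge0// ltW.
rewrite -integral_realZl//; last 2 first.
- nonneg.
- by apply: measurable_funM => //; apply: measurable_poisson => //; exact: ltW.
apply: le_integral_real => x; first by rewrite !mulr_ge0 ?inv_dist_ge0.
rewrite /q; case: (boolP (same_shell S x z w)) => [sh|]; last by rewrite !mulr0.
have tri : D <= eucl_dist x z + eucl_dist x w.
  by rewrite (le_trans (eucl_dist_triangle x _ _))// eucl_distC.
move: sh; rewrite /same_shell ler_norml => /andP[sh1 sh2].
have xz : s <= eucl_dist x z by rewrite /s; lra.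
have xz0 : 0 < eucl_dist x z by exact: lt_le_trans xz.
rewrite !mulr1 /poisson (eucl_distC z x) (max_idPl xz).
have xw : inv_dist x w <= 3 ^+ d * inv_dist x z.
  by apply: inv_dist_le => //; lra.
apply: (@le_trans _ _ (inv_dist x z * (3 ^+ d * inv_dist x z))).
  by rewrite ler_wpM2l ?inv_dist_ge0.
rewrite /inv_dist; set u := eucl_dist x z in xz xz0 *.
have powE (v : R) : v ^+ d = v * v ^+ d.-1 by rewrite -exprS (prednK d0).
have -> : (u ^+ d)^-1 * (3 ^+ d * (u ^+ d)^-1) =
   3 ^+ d * ((u ^+ d)^-1 * (u ^+ d.-1)^-1 * u^-1).
  by rewrite !powE !invfM; ring.
have -> : 3 ^+ d * (s ^+ d)^-1 * (s / u ^+ d.+1) =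
   3 ^+ d * ((u ^+ d)^-1 * (s ^+ d.-1)^-1 * u^-1).
  rewrite (powE s) [u ^+ d.+1]exprS.
  have : s ^+ d.-1 != 0 by rewrite expf_neq0// gt_eqF.
  have : u ^+ d != 0 by rewrite expf_neq0// gt_eqF.
  move: (u ^+ d) (s ^+ d.-1) (3 ^+ d : R) => a b e a0 b0.
  by field; rewrite a0 b0 !gt_eqF.
rewrite ler_wpM2l ?exprn_ge0// ler_wpM2r ?invr_ge0 ?(ltW xz0)//.
rewrite ler_wpM2l ?invr_ge0 ?exprn_ge0 ?(ltW xz0)//.
rewrite lef_pV2 ?posrE ?exprn_gt0//.
by apply: lerXn2r; rewrite ?nnegrE ?(ltW s0) ?(ltW xz0).
Qed.

End shell_kernels.

Section exceptional_functions.
Context {R : realType} {d : nat}.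
Local Notation Rd := (d.-tuple R).
Local Notation mu := (lebesgue_rd (R := R) d).
Variables (eta lam : R) (p : Rd -> R) (J : nat).
Hypotheses (eta0 : 0 < eta) (lam0 : 0 < lam).
Hypotheses (mp : measurable_fun setT p) (p0 : forall x, 0 <= p x).
Hypothesis heavyJ : forall j z, (J <= j)%N -> ~~ heavy eta lam p j z.
Implicit Types (x y z w : Rd).
Local Notation slabC := (@slab_cst R d).
Local Notation ballC := (@ball_cst R d).
Local Notation scale := (scale eta).
Local Notation stopped := (stopped eta lam p J).
Local Notation stop_at := (stop_at eta lam p J).
Let scale_gt0 j : 0 < scale j. Proof. exact: scale_gt0. Qed.
Let scale_ge0 j : 0 <= scale j. Proof. exact: scale_ge0. Qed.
#[local] Hint Resolve scale_gt0 scale_ge0 : core.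

Lemma sum_stop_at_integral (c : R) : 0 <= c ->
  (\sum_(j < J) \int[mu]_z (c * ((stop_at j z)%:R * p z))%:E <=
    c%:E * \int[mu]_z (p z)%:E)%E.
Proof.
move=> c0; rewrite -integral_realZl// -integral_real_sum; last 2 first.
- by move=> j; apply: measurable_funM => //; exact: measurable_stop_at_density.
- by move=> j z; nonneg.
apply: le_integral_real => z.
  by apply: sumr_ge0 => j _; nonneg.
rewrite -mulr_sumr -mulr_suml ler_wpM2l// ler_piMl//.
exact: sum_stop_at_le1.
Qed.

Lemma measurable_sum_fubini (Psi : 'I_J -> Rd * Rd -> R) :
  (forall j, measurable_fun setT (Psi j)) -> (forall j u, 0 <= Psi j u) ->
  measurable_fun setT (fun x => \sum_(j < J) \int[mu]_z (Psi j (x, z))%:E)%E.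
Proof.
move=> mPsi Psi0; apply: emeasurable_sum => j.
apply: (@measurable_fun_fubini_tonelli_F _ _ _ _ R mu (fun u => (Psi j u)%:E)).
  exact/measurable_EFinP.
by move=> u; rewrite lee_fin.
Qed.

(* Poisson averages of the mass of the maximal heavy cells: a point at which
   they are at most a multiple of lam stays away from these cells. *)
Definition excess x : \bar R := (\sum_(j < J)
  \int[mu]_z (poisson (scale j) x z * ((stop_at j z)%:R * p z))%:E)%E.

Let Phi (j : 'I_J) (u : Rd * Rd) : R :=
  poisson (scale j) u.1 u.2 * ((stop_at j u.2)%:R * p u.2).

Let mPhi j : measurable_fun setT (Phi j).
Proof.
apply: measurable_funM; first exact: measurable_poisson.
have H : measurable_fun setT (fun w => (stop_at j w)%:R * p w : R).
  exact: measurable_stop_at_density.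
exact: (measurableT_comp H measurable_snd).
Qed.

Let Phi0 j u : 0 <= Phi j u.
Proof. apply: mulr_ge0; [exact: poisson_ge0|nonneg]. Qed.

Lemma measurable_excess : measurable_fun setT excess.
Proof. exact: measurable_sum_fubini mPhi Phi0. Qed.

Lemma excess_ge0 x : (0 <= excess x)%E.
Proof.
apply: sume_ge0 => j _; apply: integral_real_ge0 => z; exact: (Phi0 j (x, z)).
Qed.

Lemma integral_excess :
  (\int[mu]_x excess x <= (2 ^+ d.+2 * 2 ^+ d)%:E * \int[mu]_z (p z)%:E)%E.
Proof.
rewrite /excess ge0_integral_sum//; last 2 first.
- move=> j; apply: (@measurable_fun_fubini_tonelli_F _ _ _ _ R mu (fun u => (Phi j u)%:E)).
    exact/measurable_EFinP.
  by move=> u; rewrite lee_fin.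
- by move=> j x _; apply: integral_real_ge0 => z; exact: (Phi0 j (x, z)).
apply: le_trans (sum_stop_at_integral _); last by nonneg.
apply: lee_sum => j _; rewrite (tonelli_rd (mPhi j) (Phi0 j)).
apply: ge0_le_integralW => z; first by apply: integral_real_ge0 => x.
under eq_integral do rewrite /Phi/= mulrC.
rewrite integral_realZl ?mulr_ge0//; last 2 first.
- exact: measurable_poisson.
- by move=> x; exact: poisson_ge0.
rewrite [X in (_ <= X%:E)%E]mulrC [X in (_ <= X)%E]EFinM.
rewrite lee_wpmul2l ?lee_fin ?mulr_ge0//.
exact: integral_poisson.
Qed.

Definition excess_cst : R := ((1 + d%:R) ^+ d.+1)^-1.

Lemma excess_cst_gt0 : 0 < excess_cst.
Proof. by rewrite invr_gt0 exprn_gt0// ltr_pwDl. Qed.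

(* A point within [scale j] of a maximal heavy cell of that side is charged by
   the whole mass of the cell. *)
Lemma excess_far x j z : (excess x <= (excess_cst * lam)%:E)%E ->
  stop_at j z -> scale j < eucl_dist x z.
Proof.
move=> xN sj; have jJ : (j < J)%N.
  by rewrite ltnNge; apply/negP => Jj; move: sj; rewrite /stop_at /= stopped_ge.
rewrite ltNge; apply/negP => xz.
move: xN; apply/negP; rewrite -ltNge /excess (bigD1 (Ordinal jJ))//=.
set rest := (\sum_(k < J | _) _)%E.
have rest0 : (0 <= rest)%E.
  by apply: sume_ge0 => k _; apply: integral_real_ge0 => w; exact: (Phi0 k (x, w)).
apply: lt_le_trans (leeDl _ rest0).
have h := stop_at_heavy heavyJ sj.
set c := excess_cst / scale j ^+ d.
have c0 : 0 < c by rewrite divr_gt0 ?excess_cst_gt0 ?exprn_gt0.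
apply: (@lt_le_trans _ _ (c%:E *
    \int[mu]_w ((same_cell (scale j) z w)%:R * p w)%:E)%E).
  rewrite (_ : excess_cst * lam = c * (lam * scale j ^+ d)).
    by rewrite EFinM lte_pmul2l.
  rewrite /c; have : scale j ^+ d != 0 by rewrite expf_neq0// gt_eqF.
  by move: (scale j ^+ d) => u u0; field.
have mcell : measurable_fun setT (fun w => (same_cell (scale j) z w)%:R * p w : R).
  apply: measurable_funM => //; apply: measurable_natr_bool.
  by apply: measurable_same_cell.
rewrite -integral_realZl ?(ltW c0)//; last by move=> w; nonneg.
apply: le_integral_real => w; first by nonneg.
case: (boolP (same_cell _ z w)) => [zw|_]; last first.
  by rewrite mul0r mulr0; exact: (Phi0 (Ordinal jJ) (x, w)).
rewrite -(stop_at_cell _ _ _ zw) sj !mul1r ler_wpM2r// /c /poisson.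
have xw : Num.max (eucl_dist x w) (scale j) <= (1 + d%:R) * scale j.
  rewrite ge_max; apply/andP; split; last by rewrite ler_peMl// lerDl.
  rewrite (le_trans (eucl_dist_triangle z _ _))// mulrDl mul1r lerD//.
  exact: same_cell_dist.
have m0 : 0 < Num.max (eucl_dist x w) (scale j) by rewrite lt_max scale_gt0 orbT.
apply: (@le_trans _ _ (scale j / ((1 + d%:R) * scale j) ^+ d.+1)).
  rewrite [(_ * scale j) ^+ d.+1]exprMn [scale j ^+ d.+1]exprS /excess_cst.
  have : scale j ^+ d != 0 by rewrite expf_neq0// gt_eqF.
  have : (1 + d%:R) ^+ d.+1 != 0 :> R by rewrite expf_neq0// gt_eqF// ltr_pwDl.
  have := scale_gt0 j.
  move: (scale j ^+ d) (_ ^+ d.+1) (scale j) => u v s s0 v0 u0.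
  rewrite le_eqVlt; apply/orP; left; apply/eqP.
  by field; rewrite u0 v0 gt_eqF.
rewrite ler_wpM2l// lef_pV2 ?posrE ?exprn_gt0//; last first.
  by rewrite (lt_le_trans m0).
by apply: lerXn2r; rewrite ?nnegrE ?(ltW m0)// (le_trans (ltW m0)).
Qed.

Lemma excess_stopped x i z : (excess x <= (excess_cst * lam)%:E)%E ->
  stopped i z -> scale i < eucl_dist x z.
Proof.
move=> xN /stopped_stop_at [j /andP[ij sj]].
by rewrite (le_lt_trans (scale_le eta0 ij))// excess_far.
Qed.

Lemma scale_ceil (rho : R) : eta <= rho -> exists i, rho <= scale i <= 2 * rho.
Proof.
move=> er.
have ex : exists i, rho <= scale i.
  exists (Num.truncn (rho / eta)).+1; rewrite /scale -ler_pdivrMr//.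
  rewrite (le_trans (ltW (truncnS_gt _)))// -natrX ler_nat ltnW//.
  exact: ltn_expl.
exists (ex_minn ex); case: ex_minnP => -[|n] ri rmin; rewrite ri /=.
  by rewrite /scale expr0 mul1r; move: eta0 er; lra.
rewrite scaleS; have :  ~~ (rho <= scale n) by apply/negP => /rmin; rewrite ltnn.
by rewrite -ltNge => ?; rewrite ler_pM2l// ltW.
Qed.

Lemma excess_ball x (rho : R) : (excess x <= (excess_cst * lam)%:E)%E ->
  eta <= rho ->
  (\int[mu]_w ((eucl_dist x w <= rho)%R%:R * p w)%:E <=
    (ballC * lam * rho ^+ d)%:E)%E.
Proof.
move=> xN er; have [i /andP[ri ir]] := scale_ceil er.
apply: le_trans (@unstopped_ball _ _ eta lam p J eta0 lam0 mp p0 heavyJ i x rho _); last by lra.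
apply: le_integral_real => w; first by nonneg.
case: (boolP (eucl_dist x w <= rho)) => [xw|]; last by rewrite !mul0r.
rewrite (_ : stopped i w = false) ?mul1r//; apply/negbTE/negP => /(excess_stopped xN).
by rewrite ltNge (le_trans xw ri).
Qed.

(* Pairs (z, w) that are far apart relative to the heavy cell of z, and lie in a
   common shell around x at one of the scales up to the side of that cell. *)
Definition far_interaction (j : nat) x z w : R :=
  ((stop_at j z)%:R * p z) * ((((8 * scale j <= eucl_dist z w)%R%:R) *
  ((~~ stopped j.+1 w)%:R * p w)) *
  \sum_(i < j.+1) (inv_dist x z * inv_dist x w * (same_shell (scale i) x z w)%:R)).

Definition interaction x : \bar R :=
  (\sum_(j < J) \int[mu]_z \int[mu]_w (far_interaction j x z w)%:E)%E.

Lemma far_interaction_ge0 j x z w : 0 <= far_interaction j x z w.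
Proof.
rewrite /far_interaction; apply: mulr_ge0; first by nonneg.
apply: mulr_ge0; first by nonneg.
by apply: sumr_ge0 => i _; rewrite mulr_ge0 ?mulr_ge0 ?inv_dist_ge0.
Qed.

Lemma measurable_far_interaction dd (T : measurableType dd) j (f g h : T -> Rd) :
  measurable_fun setT f -> measurable_fun setT g -> measurable_fun setT h ->
  measurable_fun setT (fun t => far_interaction j (f t) (g t) (h t)).
Proof.
move=> mf mg mh; apply: measurable_funM.
  have H : measurable_fun setT (fun w => (stop_at j w)%:R * p w : R).
    exact: measurable_stop_at_density.
  exact: (measurableT_comp H mg).
apply: measurable_funM.
  apply: measurable_funM.
    apply: measurable_natr_bool; apply: measurable_fun_ler => //.
    exact: measurable_fun_eucl_dist.
  have H : measurable_fun setT (fun w => (~~ stopped j.+1 w)%:R * p w : R).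
    exact: measurable_unstopped.
  exact: (measurableT_comp H mh).
apply: measurable_sum => i; apply: measurable_funM.
  by apply: measurable_funM; exact: measurable_inv_dist.
by apply: measurable_natr_bool; exact: measurable_same_shell.
Qed.

Let Fw j (u : Rd * Rd) : \bar R := (\int[mu]_w (far_interaction j u.1 u.2 w)%:E)%E.

Let mFw j : measurable_fun setT (Fw j).
Proof.
apply: (@measurable_fun_fubini_tonelli_F _ _ _ _ R mu
  (fun v : (Rd * Rd) * Rd => (far_interaction j v.1.1 v.1.2 v.2)%:E)).
  apply/measurable_EFinP; apply: measurable_far_interaction.
  - exact: (measurableT_comp measurable_fst measurable_fst).
  - exact: (measurableT_comp measurable_snd measurable_fst).
  - exact: measurable_snd.
by move=> v; rewrite lee_fin far_interaction_ge0.
Qed.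

Let Fw0 j u : (0 <= Fw j u)%E.
Proof. by apply: integral_real_ge0 => w; exact: far_interaction_ge0. Qed.

Lemma measurable_interaction : measurable_fun setT interaction.
Proof.
apply: emeasurable_sum => j.
by apply: (@measurable_fun_fubini_tonelli_F _ _ _ _ R mu (Fw j)).
Qed.

Lemma interaction_ge0 x : (0 <= interaction x)%E.
Proof. by apply: sume_ge0 => j _; apply: integral_ge0 => z _; exact: (Fw0 j (x, z)). Qed.

Lemma sum_scale_le j : \sum_(i < j.+1) scale i <= 2 * scale j.
Proof.
elim: j => [|j IH]; first by rewrite big_ord1; have := scale_gt0 0; lra.
by rewrite big_ord_recr/= scaleS; lra.
Qed.

Definition interaction_cst : R :=
  2 * slabC * (2 ^+ d.+2 * ballC).

Lemma interaction_cst_ge0 : 0 <= interaction_cst.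
Proof.
have := @slab_cst_ge0 R d; have := @ball_cst_ge0 R d => ? ?.
by rewrite /interaction_cst; nonneg.
Qed.

Lemma integral_interaction : (0 < d)%N ->
  (\int[mu]_x interaction x <= (interaction_cst * lam)%:E * \int[mu]_z (p z)%:E)%E.
Proof.
move=> d0; rewrite /interaction ge0_integral_sum//; last 2 first.
- by move=> j; apply: (@measurable_fun_fubini_tonelli_F _ _ _ _ R mu (Fw j)).
- by move=> j x _; apply: integral_ge0 => z _; exact: (Fw0 j (x, z)).
apply: le_trans (sum_stop_at_integral _); last first.
  by rewrite mulr_ge0 ?interaction_cst_ge0 ?ltW.
apply: lee_sum => j _; rewrite (@fubini_tonelli _ _ _ _ R mu mu (Fw j))//.
apply: ge0_le_integralW => z; first by apply: integral_ge0 => x _; exact: (Fw0 j (x, z)).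
rewrite /Fw/= (@tonelli_rd R d (fun u => far_interaction j u.1 z u.2)); last 2 first.
- apply: measurable_far_interaction => //.
- by move=> u; exact: far_interaction_ge0.
pose q w := (~~ stopped j.+1 w)%:R * p w.
have mq : measurable_fun setT q by exact: measurable_unstopped.
have q0 w : 0 <= q w by rewrite /q; nonneg.
pose c := 2 * slabC * ((stop_at j z)%:R * p z).
have c0 : 0 <= c by have := @slab_cst_ge0 R d => ?; rewrite /c; nonneg.
apply: (@le_trans _ _ (\int[mu]_w (c * (poisson (scale j) z w * q w))%:E)%E).
  apply: ge0_le_integralW => w.
    by apply: integral_real_ge0 => x; exact: far_interaction_ge0.
  rewrite /far_interaction; set a := (stop_at j z)%:R * p z.
  set b := (8 * scale j <= eucl_dist z w)%R%:R * ((~~ stopped j.+1 w)%:R * p w).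
  have a0 : 0 <= a by rewrite /a; nonneg.
  have b0 : 0 <= b by rewrite /b; nonneg.
  have mk (i : nat) : measurable_fun setT (fun x =>
      inv_dist x z * inv_dist x w * (same_shell (scale i) x z w)%:R : R).
    apply: measurable_funM; first by apply: measurable_funM; apply: measurable_inv_dist.
    by apply: measurable_natr_bool; apply: measurable_same_shell.
  have k0 (i : nat) x : 0 <= inv_dist x z * inv_dist x w * (same_shell (scale i) x z w)%:R.
    by rewrite mulr_ge0 ?mulr_ge0 ?inv_dist_ge0.
  have ms : measurable_fun setT (fun x => \sum_(i < j.+1)
      (inv_dist x z * inv_dist x w * (same_shell (scale i) x z w)%:R) : R).
    by apply: measurable_sum => i.
  have s0 x : 0 <= \sum_(i < j.+1)
      (inv_dist x z * inv_dist x w * (same_shell (scale i) x z w)%:R).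
    by apply: sumr_ge0 => i _.
  rewrite integral_realZl//; last 2 first.
  - by apply: measurable_funM.
  - by move=> x; exact: mulr_ge0.
  rewrite integral_realZl//.
  have [far|nfar] := boolP (8 * scale j <= eucl_dist z w); last first.
    rewrite /b (negbTE nfar) !mul0r !mul0e mule0 lee_fin.
    by rewrite mulr_ge0// mulr_ge0// poisson_ge0.
  have bE : b = q w by rewrite /b far mul1r.
  set D := eucl_dist z w in far *.
  have sj := scale_gt0 j.
  have D0 : 0 < D by rewrite (lt_le_trans _ far)// mulr_gt0.
  have : (\int[mu]_x (\sum_(i < j.+1)
      (inv_dist x z * inv_dist x w * (same_shell (scale i) x z w)%:R))%:E <=
      (2 * slabC * (scale j / D ^+ d.+1))%:E)%E.
    rewrite (integral_real_sum mu (index_enum _) (g := fun (i : 'I_j.+1) x =>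
       inv_dist x z * inv_dist x w * (same_shell (scale i) x z w)%:R))//.
    apply: (@le_trans _ _ (\sum_(i < j.+1) (slabC *
        (scale i / D ^+ d.+1))%:E)%E).
      apply: lee_sum => i _; apply: integral_same_shell => //.
      apply: le_trans far; rewrite ler_pM2l//; apply: scale_le => //.
      by rewrite -ltnS ltn_ord.
    rewrite sumEFin lee_fin -mulr_sumr -mulr_suml.
    rewrite (_ : 2 * slabC * (scale j / D ^+ d.+1) =
      slabC * (2 * scale j / D ^+ d.+1)); last by ring.
    rewrite ler_wpM2l ?slab_cst_ge0// ler_wpM2r//.
      by rewrite invr_ge0 exprn_ge0// ltW.
    exact: sum_scale_le.
  move=> H; apply: (@le_trans _ _ (a%:E * (b%:E *
      (2 * slabC * (scale j / D ^+ d.+1))%:E))%E).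
    by rewrite lee_wpmul2l ?lee_fin// lee_wpmul2l ?lee_fin.
  rewrite -!EFinM lee_fin bE /poisson (max_idPl _) -/D; last first.
    by rewrite (le_trans _ far)// ler_peMl// ?ler1n// ltW.
  by rewrite le_eqVlt; apply/orP; left; apply/eqP; rewrite /c /a /q; ring.
rewrite integral_realZl//; last 2 first.
- by apply: measurable_funM => //; exact: measurable_poisson.
- by move=> w; rewrite mulr_ge0// poisson_ge0.
have : (\int[mu]_w (poisson (scale j) z w * q w)%:E <=
    (2 ^+ d.+2 * (ballC * lam))%:E)%E.
  apply: poisson_growth => //; first by rewrite mulr_ge0 ?ball_cst_ge0 ?ltW.
  move=> n; apply: unstopped_ball => //.
  rewrite scaleS mulrAC divff// mul1r ler_peMl// exprn_ege1//; exact: ler1n.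
move=> H; apply: (@le_trans _ _ (c%:E * (2 ^+ d.+2 *
    (ballC * lam))%:E)%E); first by rewrite lee_wpmul2l ?lee_fin.
rewrite -EFinM lee_fin /c /interaction_cst.
by rewrite le_eqVlt; apply/orP; left; apply/eqP; ring.
Qed.

End exceptional_functions.

(** * Square sums over shells *)

Lemma sum_cover_integral dd (T : measurableType dd) (R : realType)
    (m : {measure set T -> \bar R}) (Q : Type) (s : seq Q) (D : Q -> T -> bool)
    (B : T -> \bar R) (c : R) :
  (forall q, measurable_fun setT (D q)) -> measurable_fun setT B ->
  (forall z, 0 <= B z)%E ->
  (forall z, \sum_(q <- s) (D q z)%:R <= c) ->
  (\sum_(q <- s) \int[m]_z (((D q z)%:R)%:E * B z) <= c%:E * \int[m]_z B z)%E.
Proof.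
move=> mD mB B0 Dc; have mDB q : measurable_fun setT (fun z => ((D q z)%:R)%:E * B z)%E.
  by apply: emeasurable_funM => //; apply/measurable_EFinP; exact: measurable_natr_bool.
have DB0 q z : (0 <= ((D q z)%:R)%:E * B z)%E by rewrite mule_ge0// lee_fin.
rewrite -ge0_integral_sum//.
have [[z0 _]|no] := pselect (exists z0 : T, True); last first.
  have e f : (\int[m]_z f z = 0)%E.
    by apply: integral0_eq => z _; case: no; exists z.
  by rewrite !e mule0.
have c0 : 0 <= c by rewrite (le_trans _ (Dc z0))// sumr_ge0.
rewrite -ge0_integralZl ?lee_fin//; apply: ge0_le_integralW => z.
  by apply: sume_ge0 => q _.
rewrite -ge0_sume_distrl; last by move=> q _; rewrite lee_fin.
by rewrite sumEFin lee_wpmul2r// lee_fin.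
Qed.

Lemma sqr_telescope (R : realDomainType) (E a : nat -> \bar R) i m : (i <= m)%N ->
  (forall j, 0 <= E j)%E -> (forall j, 0 <= a j)%E ->
  (forall j, (i <= j)%N -> E j.+1 = E j + a j)%E ->
  (E m * E m <= 2%:E * (E i * E i + \sum_(i <= j < m) a j * E j.+1))%E.
Proof.
move=> im E0 a0 Ea; move: im; elim: m => [|m IH].
  rewrite leqn0 => /eqP ->; rewrite big_geq// adde0.
  by rewrite lee_pemull// ?mule_ge0// lee_fin ler1n.
rewrite leq_eqVlt => /orP[/eqP <-|]; last rewrite ltnS => im.
  rewrite big_geq// adde0.
  by rewrite lee_pemull// ?mule_ge0// lee_fin ler1n.
rewrite big_nat_recr//= addeA ge0_muleDr; last 2 first.
- by rewrite adde_ge0 ?mule_ge0// sume_ge0// => j _; rewrite mule_ge0.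
- by rewrite mule_ge0.
apply: le_trans (leeD (IH im) (lexx _)).
have -> : (2%:E * (a m * E m.+1) = a m * E m.+1 + a m * E m.+1)%E.
  by rewrite -[(2%:E)%E]/(1%:E + 1%:E)%E ge0_muleDl ?lee_fin// mul1e.
rewrite Ea// ge0_muleDl// ge0_muleDr// -addeA leeD2l// muleC.
by apply: leeD; rewrite lee_wpmul2l// ?leeDl// leeDr.
Qed.

Section annular_sum.
Context {R : realType} {d : nat}.
Local Notation Rd := (d.-tuple R).
Local Notation mu := (lebesgue_rd (R := R) d).
Variables (eta lam : R) (p : Rd -> R) (J : nat).
Hypotheses (eta0 : 0 < eta) (lam0 : 0 < lam) (d0 : (0 < d)%N).
Hypotheses (mp : measurable_fun setT p) (p0 : forall x, 0 <= p x).
Hypothesis heavyJ : forall j z, (J <= j)%N -> ~~ heavy eta lam p j z.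
Implicit Types (x y z w : Rd).
Local Notation slabC := (@slab_cst R d).
Local Notation ballC := (@ball_cst R d).
Local Notation scale := (scale eta).
Local Notation stopped := (stopped eta lam p J).
Local Notation stop_at := (stop_at eta lam p J).
Local Notation excess := (excess eta lam p J).
Local Notation interaction := (interaction eta lam p J).
Local Notation far_interaction := (far_interaction eta lam p J).
Let scale_gt0 j : 0 < scale j. Proof. exact: scale_gt0. Qed.
Let scale_ge0 j : 0 <= scale j. Proof. exact: scale_ge0. Qed.
#[local] Hint Resolve scale_gt0 scale_ge0 : core.

Definition shell_gap : R := 2 * d%:R + 4.

Lemma shell_gap_ge4 : 4 <= shell_gap.
Proof. by rewrite /shell_gap lerDr mulr_ge0. Qed.

Definition shell_cst : R :=
  2 ^+ d * (2 ^+ d * ((2 * d)%:R * (4 ^+ d.-1 * (4 * d%:R * (d%:R + 2))))).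

Lemma shell_cst_ge0 : 0 <= shell_cst.
Proof. rewrite /shell_cst; nonneg. Qed.

Lemma unstopped_shell i x z : shell_gap * scale i <= eucl_dist x z ->
  (\int[mu]_w ((same_shell (scale i) x z w)%:R * ((~~ stopped i w)%:R * p w))%:E <=
   (2 ^+ d * lam * ((2 * d)%:R * (4 ^+ d.-1 * (4 * d%:R * (d%:R + 2)))) *
     (eucl_dist x z ^+ d.-1 * scale i))%:E)%E.
Proof.
set S := scale i; set rho := eucl_dist x z => hrho.
have S0 : 0 < S by exact: scale_gt0.
have d1 : 1 <= d%:R :> R by rewrite ler1n.
have gapS : (2 * d%:R + 4) * S <= rho by [].
pose c := (d%:R + 2) * S.
have c0 : 0 <= c by rewrite /c; nonneg.
have c2 : 2 * c <= rho by rewrite (le_trans _ gapS)// /c; lra.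
have cS : 0 < c by rewrite /c mulr_gt0// ltr_pwDr.
have al0 : 0 < rho - c by lra.
have albe : rho - c <= rho + c by lra.
apply: (@le_trans _ _ ((2 ^+ d * lam)%:E *
    mu [set y | (rho - c <= eucl_dist x y <= rho + c)%R])%E).
  apply: (@density_smear R d S lam (fun w => (~~ stopped i w)%:R * p w)
    (same_shell S x z) (fun y => rho - c <= eucl_dist x y <= rho + c)) => //.
  - exact: ltW.
  - exact: measurable_unstopped.
  - by move=> w; nonneg.
  - by apply: measurable_same_shell.
  - by apply: measurable_and; apply: measurable_fun_ler => //;
      apply: measurable_fun_eucl_dist.
  - exact: unstopped_cell.
  move=> w y; rewrite /same_shell -/rho ler_norml => /andP[h1 h2] wy.
  have h3 := same_cell_dist S0 wy.
  have h4 := eucl_dist_triangle w x y; have := eucl_dist_triangle y x w.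
  rewrite (eucl_distC y w) => h5.
  by apply/andP; split; rewrite /c; lra.
apply: (@le_trans _ _ ((2 ^+ d * lam)%:E * ((2 * d)%:R * ((2 * (rho + c)) ^+ d.-1 *
    (d%:R * ((rho + c) ^+ 2 - (rho - c) ^+ 2) / (2 * (rho - c)))))%:E)%E).
  rewrite lee_wpmul2l ?lee_fin//; last exact: lebesgue_rd_annulus.
  by rewrite mulr_ge0// ltW.
rewrite -EFinM lee_fin -!mulrA !ler_wpM2l ?exprn_ge0 ?(ltW lam0)//.
have rho0 : 0 <= rho by lra.
apply: (@le_trans _ _ ((4 * rho) ^+ d.-1 * (4 * c * d%:R))).
  apply: ler_pM.
  - by rewrite exprn_ge0//; lra.
  - rewrite subr_sqr mulrA divr_ge0 ?mulr_ge0//; lra.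
  - by apply: lerXn2r; rewrite ?nnegrE; lra.
  rewrite mulrA ler_pdivrMr; last by lra.
  rewrite subr_sqr.
  have -> : d%:R * ((rho + c - (rho - c)) * (rho + c + (rho - c))) =
    (4 * c * d%:R) * rho by ring.
  by rewrite ler_wpM2l//; [nonneg|lra].
rewrite exprMn /c le_eqVlt; apply/orP; left; apply/eqP; ring.
Qed.

Section at_point.
Variables (x : Rd) (i : nat).
Hypothesis small_excess : (excess x <= (@excess_cst R d * lam)%:E)%E.
Hypothesis small_interaction : (interaction x <= (lam ^+ 2)%:E)%E.
Let S := scale i.
Variables (Q : Type) (s : seq Q) (Delta : Q -> Rd -> bool).
Hypothesis mDelta : forall q, measurable_fun setT (Delta q).
Hypothesis Delta_mult : forall z, \sum_(q <- s) (Delta q z)%:R <= 2 :> R.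
Hypothesis Delta_far : forall q z, Delta q z -> shell_gap * S <= eucl_dist x z.
Hypothesis Delta_shell : forall q z w, Delta q z -> Delta q w -> same_shell S x z w.

Let g z : R := inv_dist x z * p z.
Let g0 z : 0 <= g z. Proof. by rewrite mulr_ge0 ?inv_dist_ge0. Qed.
Let mg : measurable_fun setT g.
Proof. by apply: measurable_funM => //; apply: measurable_inv_dist. Qed.
Let S0 : 0 < S. Proof. exact: scale_gt0. Qed.

Let level q m : \bar R :=
  (\int[mu]_z ((Delta q z)%:R * ((~~ stopped m z)%:R * g z))%:E)%E.
Let slice q j : \bar R :=
  (\int[mu]_z ((Delta q z)%:R * ((stop_at j z)%:R * g z))%:E)%E.

Let mD q : measurable_fun setT (fun z => (Delta q z)%:R : R).
Proof. exact: measurable_natr_bool. Qed.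
Let mU m : measurable_fun setT (fun z => (~~ stopped m z)%:R : R).
Proof.
by apply: measurable_natr_bool; apply: measurable_neg; exact: measurable_stopped.
Qed.
Let mM j : measurable_fun setT (fun z => (stop_at j z)%:R : R).
Proof. by apply: measurable_natr_bool; exact: measurable_stop_at. Qed.

Let level_ge0 q m : (0 <= level q m)%E.
Proof. by apply: integral_real_ge0 => z; do 2 apply: mulr_ge0 => //. Qed.
Let slice_ge0 q j : (0 <= slice q j)%E.
Proof. by apply: integral_real_ge0 => z; do 2 apply: mulr_ge0 => //. Qed.

Let levelS q j : (level q j.+1 = level q j + slice q j)%E.
Proof.
rewrite /level /slice -integral_realD; last 4 first.
- by apply: measurable_funM => //; exact: measurable_funM.
- by apply: measurable_funM => //; exact: measurable_funM.
- by move=> z; do 2 apply: mulr_ge0 => //.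
- by move=> z; do 2 apply: mulr_ge0 => //.
apply: eq_integral => z _; congr EFin.
rewrite -mulrDr -mulrDl -natrD; congr (_ * (_%:R * _)).
rewrite /stop_at; have := @stopped_mono R d eta lam p J j j.+1 z (leqnSn j).
by case: (stopped j z); case: (stopped j.+1 z) => //= H; have := H isT.
Qed.

Let Delta_half q z w : Delta q z -> Delta q w -> eucl_dist x z <= 2 * eucl_dist x w.
Proof.
move=> qz qw; have := Delta_shell qz qw; have := Delta_far qz.
have := ler_wpM2r (ltW S0) shell_gap_ge4.
by rewrite /same_shell ler_norml => ? ? /andP[? ?]; lra.
Qed.

Let Delta_pos q z : Delta q z -> 0 < eucl_dist x z.
Proof.
move=> /Delta_far; apply: lt_le_trans; rewrite mulr_gt0//.
exact: lt_le_trans shell_gap_ge4.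
Qed.

Let Delta_inv q z w : Delta q z -> Delta q w ->
  inv_dist x w <= 2 ^+ d * inv_dist x z.
Proof.
move=> qz qw; apply: inv_dist_le => //; first exact: Delta_pos qz.
exact: Delta_half qz qw.
Qed.

Let dist_pow (u : R) : u ^+ d = u * u ^+ d.-1.
Proof. by rewrite -exprS (prednK d0). Qed.

Let level0_le q z : Delta q z ->
  (level q i <= (shell_cst * lam * (S / eucl_dist x z))%:E)%E.
Proof.
move=> qz; have rho0 := Delta_pos qz.
have H := unstopped_shell (Delta_far qz).
apply: (@le_trans _ _ ((2 ^+ d * inv_dist x z)%:E * (\int[mu]_w
    ((same_shell S x z w)%:R * ((~~ stopped i w)%:R * p w))%:E))%E).
  rewrite -integral_realZl; last 3 first.
  - by rewrite mulr_ge0 ?inv_dist_ge0.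
  - apply: measurable_funM; last exact: measurable_funM.
    by apply: measurable_natr_bool; apply: measurable_same_shell.
  - by move=> w; do 2 apply: mulr_ge0 => //.
  apply: le_integral_real => w; first by do 2 apply: mulr_ge0 => //.
  have [qw|_] := boolP (Delta q w); last first.
    by rewrite mul0r; do ?[apply: mulr_ge0 => //]; rewrite inv_dist_ge0.
  rewrite (Delta_shell qz qw) !mul1r /g mulrCA.
  by rewrite ler_wpM2r ?mulr_ge0// (Delta_inv qz qw).
apply: le_trans (lee_wpmul2l _ H) _.
  by rewrite lee_fin mulr_ge0 ?inv_dist_ge0.
rewrite -EFinM lee_fin /inv_dist (dist_pow (eucl_dist x z)) /shell_cst.
have : eucl_dist x z ^+ d.-1 != 0 by rewrite expf_neq0// gt_eqF.
move: (eucl_dist x z ^+ d.-1) => u u0.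
rewrite le_eqVlt; apply/orP; left; apply/eqP; rewrite -/S.
by field; rewrite u0 gt_eqF.
Qed.

Let S_le_dist q z : Delta q z -> S <= eucl_dist x z.
Proof.
move=> /Delta_far; apply: le_trans; rewrite ler_peMl ?(ltW S0)//.
by have := shell_gap_ge4; lra.
Qed.

Let eta_le_S n : eta <= 2 ^+ n * S.
Proof.
rewrite /S /scale mulrA -exprD ler_peMl ?(ltW eta0)// exprn_ege1//.
by rewrite ler1n.
Qed.

Let mulr_indic (f : Rd -> R) (B : Rd -> \bar R) (c : \bar R) q :
  measurable_fun setT f -> (forall z, 0 <= f z) -> (0 <= c)%E ->
  (forall z, 0 <= B z)%E ->
  (forall z, Delta q z -> ((f z)%:E * c <= B z)%E) ->
  ((\int[mu]_z ((Delta q z)%:R * f z)%:E) * c <=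
    \int[mu]_z (((Delta q z)%:R)%:E * B z))%E.
Proof.
move=> mf f0 c0 B0 fB; rewrite -ge0_integralZr//; last 2 first.
- by apply/measurable_EFinP; exact: measurable_funM.
- by move=> z _; rewrite lee_fin mulr_ge0.
apply: ge0_le_integralW => z; first by rewrite mule_ge0// lee_fin mulr_ge0.
have [qz|_] := boolP (Delta q z); last by rewrite !mul0r !mul0e.
by rewrite mul1r mul1e fB.
Qed.

Let good_cst : R := 2 * (shell_cst * (2 ^+ d.+2 * ballC)).

Let sum_level0 :
  (\sum_(q <- s) level q i * level q i <= (good_cst * lam ^+ 2)%:E)%E.
Proof.
pose B z : R := shell_cst * lam * (poisson S x z * p z).
have B0 z : 0 <= B z.
  have := shell_cst_ge0; have := @poisson_ge0 R d S x z (ltW S0) => ? ?.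
  by rewrite /B; nonneg.
have mP : measurable_fun setT (fun z => poisson S x z * p z : R).
  by apply: measurable_funM => //; apply: measurable_poisson => //; exact: ltW.
have mB : measurable_fun setT B by exact: measurable_funM.
apply: (@le_trans _ _ (\sum_(q <- s) \int[mu]_z (((Delta q z)%:R)%:E * (B z)%:E))%E).
  apply: lee_sum => q _; apply: mulr_indic => //.
  - exact: measurable_funM.
  - by move=> z; apply: mulr_ge0.
  move=> z qz; have rho0 := Delta_pos qz.
  apply: (@le_trans _ _ ((g z)%:E * (shell_cst * lam * (S / eucl_dist x z))%:E)%E).
    apply: lee_pmul => //; first by rewrite lee_fin mulr_ge0.
      by rewrite lee_fin ler_piMl// lern1 leq_b1.
    exact: level0_le.
  rewrite -EFinM lee_fin /g /B /poisson /inv_dist (max_idPl (S_le_dist qz)).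
  rewrite [_ ^+ d.+1]exprS.
  have : eucl_dist x z ^+ d != 0 by rewrite expf_neq0// gt_eqF.
  move: (eucl_dist x z ^+ d) => u u0.
  rewrite le_eqVlt; apply/orP; left; apply/eqP.
  by field; rewrite u0 gt_eqF.
have mBe : measurable_fun setT (fun z => (B z)%:E) by exact/measurable_EFinP.
have Be0 z : (0 <= (B z)%:E)%E by rewrite lee_fin.
apply: le_trans (sum_cover_integral mu mDelta mBe Be0 Delta_mult) _.
rewrite /B integral_realZl//; last 2 first.
- by have := shell_cst_ge0 => ?; nonneg.
- by move=> z; rewrite mulr_ge0// poisson_ge0// ltW.
have : (\int[mu]_z (poisson S x z * p z)%:E <= (2 ^+ d.+2 * (ballC * lam))%:E)%E.
  apply: poisson_growth => //; first by rewrite mulr_ge0 ?ball_cst_ge0 ?ltW.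
  by move=> n; apply: (excess_ball eta0 lam0 mp p0 heavyJ small_excess); exact: eta_le_S.
move=> H; apply: (@le_trans _ _ (2%:E * ((shell_cst * lam)%:E *
    (2 ^+ d.+2 * (ballC * lam))%:E))%E).
  by rewrite lee_wpmul2l ?lee_fin// lee_wpmul2l// lee_fin mulr_ge0 ?shell_cst_ge0 ?ltW.
rewrite -!EFinM lee_fin /good_cst.
by rewrite le_eqVlt; apply/orP; left; apply/eqP; ring.
Qed.

Let near_cst : R := 2 ^+ d * (ballC * 8 ^+ d).

Let near_cst_ge0 : 0 <= near_cst.
Proof. by have := @ball_cst_ge0 R d => ?; rewrite /near_cst; nonneg. Qed.

Let sumT j : \bar R := (\int[mu]_z \int[mu]_w (far_interaction j x z w)%:E)%E.
Let sumN j : \bar R :=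
  (\int[mu]_z (poisson (scale j) x z * ((stop_at j z)%:R * p z))%:E)%E.

(* Away from the heavy cell containing z, the mass of the shell is controlled
   by [interaction]; near it, the maximality of the cell bounds the mass. *)
Let sum_slice j : (i <= j)%N ->
  (\sum_(q <- s) slice q j * level q j.+1 <=
    2%:E * ((near_cst * lam)%:E * sumN j + sumT j))%E.
Proof.
move=> ij.
have mPN : measurable_fun setT
    (fun z => poisson (scale j) x z * ((stop_at j z)%:R * p z) : R).
  by apply: measurable_funM; [apply: measurable_poisson|exact: measurable_funM].
have PN0 z : 0 <= poisson (scale j) x z * ((stop_at j z)%:R * p z).
  by have := @poisson_ge0 R d (scale j) x z (scale_ge0 j) => ?; nonneg.
have mF : measurable_fun setT
    (fun z => \int[mu]_w (far_interaction j x z w)%:E)%E.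
  apply: (@measurable_fun_fubini_tonelli_F _ _ _ _ R mu
    (fun u => (far_interaction j x u.1 u.2)%:E)).
    by apply/measurable_EFinP; apply: measurable_far_interaction.
  by move=> u; rewrite lee_fin far_interaction_ge0.
have F0 z : (0 <= \int[mu]_w (far_interaction j x z w)%:E)%E.
  by apply: integral_real_ge0 => w; exact: far_interaction_ge0.
pose B z : \bar R := ((near_cst * lam * (poisson (scale j) x z *
  ((stop_at j z)%:R * p z)))%:E + \int[mu]_w (far_interaction j x z w)%:E)%E.
have nl0 : 0 <= near_cst * lam by rewrite mulr_ge0// ltW.
have nPN0 z : 0 <= near_cst * lam * (poisson (scale j) x z * ((stop_at j z)%:R * p z)).
  exact: mulr_ge0.
have B0 z : (0 <= B z)%E by rewrite adde_ge0// lee_fin.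
have mnPN : measurable_fun setT (fun z => (near_cst * lam *
    (poisson (scale j) x z * ((stop_at j z)%:R * p z)))%:E).
  by apply/measurable_EFinP; exact: measurable_funM.
have mB : measurable_fun setT B by exact: emeasurable_funD.
apply: (@le_trans _ _ (\sum_(q <- s) \int[mu]_z (((Delta q z)%:R)%:E * B z))%E); last first.
  apply: le_trans (sum_cover_integral mu mDelta mB B0 Delta_mult) _.
  rewrite lee_wpmul2l ?lee_fin// /B ge0_integralD//; last first.
    by move=> z _; rewrite lee_fin.
  by rewrite integral_realZl.
apply: lee_sum => q _; apply: mulr_indic => //.
- exact: measurable_funM.
- by move=> z; apply: mulr_ge0.
move=> z qz; have rho0 := Delta_pos qz.
have [sj|] := boolP (stop_at j z); last by rewrite mul0r mul0e.
rewrite mul1r.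
pose nr w : R := 2 ^+ d * inv_dist x z *
  ((eucl_dist z w <= 8 * scale j)%R%:R * ((~~ stopped j.+1 w)%:R * p w)).
pose fr w : R := (8 * scale j <= eucl_dist z w)%R%:R *
  ((same_shell S x z w)%:R * ((~~ stopped j.+1 w)%:R * g w)).
have mball : measurable_fun setT (fun w => (eucl_dist z w <= 8 * scale j)%R%:R : R).
  apply: measurable_natr_bool; apply: measurable_fun_ler => //.
  by apply: measurable_fun_eucl_dist.
have mnr' : measurable_fun setT (fun w => (eucl_dist z w <= 8 * scale j)%R%:R *
    ((~~ stopped j.+1 w)%:R * p w) : R).
  by apply: measurable_funM => //; exact: measurable_funM.
have mnr : measurable_fun setT nr by exact: measurable_funM.
have mfr : measurable_fun setT fr.
  apply: measurable_funM.
    apply: measurable_natr_bool; apply: measurable_fun_ler => //.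
    by apply: measurable_fun_eucl_dist.
  apply: measurable_funM; last exact: measurable_funM.
  by apply: measurable_natr_bool; apply: measurable_same_shell.
have i0 := inv_dist_ge0 x z.
have nr0 w : 0 <= nr w by rewrite /nr; nonneg.
have fr0 w : 0 <= fr w by have := g0 w => ?; rewrite /fr; nonneg.
have levelB : (level q j.+1 <= \int[mu]_w (nr w)%:E + \int[mu]_w (fr w)%:E)%E.
  rewrite -integral_realD//; apply: le_integral_real => w.
    by do 2 apply: mulr_ge0 => //.
  have [qw|_] := boolP (Delta q w); last by rewrite mul0r addr_ge0.
  rewrite mul1r; have [zw|zw] := leP (8 * scale j) (eucl_dist z w).
    by rewrite /fr zw (Delta_shell qz qw) !mul1r lerDr.
  apply: ler_wpDr => //; rewrite /nr (ltW zw) mul1r /g mulrCA.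
  by rewrite ler_wpM2r ?mulr_ge0// (Delta_inv qz qw).
apply: (@le_trans _ _ ((g z)%:E * (\int[mu]_w (nr w)%:E + \int[mu]_w (fr w)%:E))%E).
  by rewrite lee_wpmul2l ?lee_fin.
rewrite ge0_muleDr ?integral_real_ge0//; apply: leeD; last first.
  rewrite -integral_realZl//; apply: le_integral_real => w; first exact: mulr_ge0.
  rewrite /far_interaction sj mul1r /fr.
  set a := (8 * scale j <= _)%R%:R; set b := (~~ _)%:R; set k := (same_shell _ _ _ _)%:R.
  have a0 : 0 <= a by [].
  have b0 : 0 <= b by [].
  have -> : g z * (a * (k * (b * g w))) =
      p z * (a * (b * p w) * (inv_dist x z * inv_dist x w * k)).
    by rewrite /g; ring.
  rewrite ler_wpM2l// ler_wpM2l//; first by nonneg.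
  have ij1 : (i < j.+1)%N by rewrite ltnS.
  rewrite (bigD1 (Ordinal ij1))//= lerDl; apply: sumr_ge0 => k' _.
  by rewrite mulr_ge0 ?mulr_ge0 ?inv_dist_ge0.
rewrite integral_realZl//; last by move=> w; nonneg.
  have H : (\int[mu]_w ((eucl_dist z w <= 8 * scale j)%R%:R *
      ((~~ stopped j.+1 w)%:R * p w))%:E <= (ballC * lam * (8 * scale j) ^+ d)%:E)%E.
    apply: unstopped_ball => //; rewrite scaleS; have := scale_ge0 j; lra.
  apply: (@le_trans _ _ ((g z)%:E * ((2 ^+ d * inv_dist x z)%:E *
      (ballC * lam * (8 * scale j) ^+ d)%:E))%E).
    by rewrite lee_wpmul2l ?lee_fin// lee_wpmul2l// lee_fin mulr_ge0.
  rewrite -!EFinM lee_fin.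
  have sx := excess_far eta0 mp p0 heavyJ small_excess sj.
  rewrite /poisson (max_idPl (ltW sx)) /near_cst /g.
  rewrite [(8 * scale j) ^+ d]exprMn.
  have -> : inv_dist x z * p z * (2 ^+ d * inv_dist x z *
      (ballC * lam * (8 ^+ d * scale j ^+ d))) =
    2 ^+ d * (ballC * 8 ^+ d) * lam * (inv_dist x z * (inv_dist x z * scale j ^+ d) * p z).
    by ring.
  rewrite sj mul1r.
  rewrite ler_wpM2l// ler_wpM2r// /inv_dist.
  set D := eucl_dist x z in rho0 sx *.
  have -> : scale j / D ^+ d.+1 = (D ^+ d)^-1 * (scale j / D).
    by rewrite [D ^+ d.+1]exprS invfM; ring.
  rewrite ler_wpM2l ?invr_ge0 ?exprn_ge0 ?(ltW rho0)//.
  rewrite mulrC -exprVn -exprMn [_ ^+ d]dist_pow ler_piMr//.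
    by rewrite divr_ge0 ?(ltW rho0).
  rewrite exprn_ile1//; first by rewrite divr_ge0 ?(ltW rho0).
  by rewrite ler_pdivrMr// mul1r ltW.
by rewrite mulr_ge0.
Qed.

Definition annular_cst : R := 2 * (2 * (shell_cst * (2 ^+ d.+2 * ballC)) +
  2 * (2 ^+ d * (ballC * 8 ^+ d) * @excess_cst R d + 1)).

Lemma annular_square_sum :
  (\sum_(q <- s) (\int[mu]_z ((Delta q z)%:R * (inv_dist x z * p z))%:E) *
      (\int[mu]_z ((Delta q z)%:R * (inv_dist x z * p z))%:E) <=
    (annular_cst * lam ^+ 2)%:E)%E.
Proof.
pose M := maxn i J.
have levelM q : (\int[mu]_z ((Delta q z)%:R * (inv_dist x z * p z))%:E = level q M)%E.
  by apply: eq_integral => z _; rewrite stopped_ge ?mul1r// leq_maxr.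
under eq_bigr do rewrite levelM.
have sumN0 j : (0 <= sumN j)%E.
  apply: integral_real_ge0 => z.
  by have := @poisson_ge0 R d (scale j) x z (scale_ge0 j) => ?; nonneg.
have sumT0 j : (0 <= sumT j)%E.
  by apply: integral_ge0 => z _; apply: integral_real_ge0 => w; exact: far_interaction_ge0.
have nl0 : 0 <= near_cst * lam by rewrite mulr_ge0// ltW.
have t0 j : (0 <= (near_cst * lam)%:E * sumN j + sumT j)%E.
  by rewrite adde_ge0// mule_ge0// lee_fin.
have t2 j : (0 <= 2%:E * ((near_cst * lam)%:E * sumN j + sumT j))%E.
  by rewrite mule_ge0// lee_fin.
apply: (@le_trans _ _ (\sum_(q <- s) 2%:E * (level q i * level q i +
    \sum_(i <= j < M) slice q j * level q j.+1))%E).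
  by apply: lee_sum => q _; apply: sqr_telescope => //; exact: leq_maxl.
rewrite -ge0_sume_distrr; last first.
  by move=> q _; rewrite adde_ge0 ?mule_ge0// sume_ge0// => j _; rewrite mule_ge0.
rewrite /annular_cst -mulrA EFinM lee_wpmul2l ?lee_fin// big_split/=.
rewrite mulrDl EFinD; apply: leeD; first exact: sum_level0.
rewrite exchange_big/=.
apply: (@le_trans _ _ (\sum_(i <= j < M) 2%:E * ((near_cst * lam)%:E * sumN j + sumT j))%E).
  by rewrite !big_nat; apply: lee_sum => j /andP[ij _]; exact: sum_slice.
apply: (@le_trans _ _ (\sum_(0 <= j < J) 2%:E * ((near_cst * lam)%:E * sumN j + sumT j))%E).
  rewrite /M; have [iJ|Ji] := leqP i J; last first.
    rewrite big_geq//.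
    by apply: sume_ge0 => j _; exact: t2.
  rewrite [leRHS](big_cat_nat _ iJ)//= leeDr//.
  by apply: sume_ge0 => j _; exact: t2.
rewrite big_mkord -ge0_sume_distrr//.
rewrite -[X in (_ <= X%:E)%E]mulrA [X in (_ <= X)%E]EFinM lee_wpmul2l ?lee_fin//.
rewrite big_split/=.
rewrite mulrDl mul1r [X in (_ <= X)%E]EFinD; apply: leeD; last exact: small_interaction.
rewrite -ge0_sume_distrr//.
apply: (@le_trans _ _ ((near_cst * lam)%:E * (@excess_cst R d * lam)%:E)%E).
  by rewrite lee_wpmul2l ?lee_fin.
rewrite -EFinM lee_fin /near_cst.
by rewrite le_eqVlt; apply/orP; left; apply/eqP; ring.
Qed.

End at_point.
End annular_sum.

(** * The Dini condition *)

Section reflection.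
Context {R : realType}.
Local Notation leb := (@lebesgue_measure R).

Lemma measurable_reflect (c : R) :
  measurable_fun setT (fun u : measurableTypeR R => c - u : measurableTypeR R).
Proof. exact: measurable_funB. Qed.

Lemma lebesgue_measure_reflect (c : R) (A : set (measurableTypeR R)) : measurable A ->
  pushforward leb (fun u : measurableTypeR R => c - u : measurableTypeR R) A = leb A.
Proof.
move=> mA; apply/esym.
have mr := measurable_reflect c.
apply: (@lebesgue_measure_unique R (pushforward leb
  (fun u : measurableTypeR R => c - u : measurableTypeR R))) => //.
move=> _ [[a b]] _ <-; rewrite /pushforward.
rewrite [RHS](_ : _ = leb (`[c - b, c - a[%classic : set (measurableTypeR R))); last first.
  congr (leb _); apply/seteqP; split => u /=; rewrite !in_itv/= => /andP[? ?];
    by apply/andP; split; lra.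
rewrite !lebesgue_measure_itv/= !lte_fin.
have -> : (c - b < c - a) = (a < b) by rewrite ltrD2l ltrN2.
by case: ifP => // _; rewrite -!EFinD; congr EFin; ring.
Qed.

Lemma ge0_integral_reflect (c : R) (f : measurableTypeR R -> \bar R) :
  measurable_fun setT f -> (forall u, 0 <= f u)%E ->
  (\int[leb]_u f (c - u)%R = \int[leb]_u f u)%E.
Proof.
move=> mf f0; have mr := measurable_reflect c.
have := @ge0_integral_pushforward _ _ _ _ R _ mr leb setT f measurableT mf.
rewrite preimage_setT => <-//.
by apply: eq_measure_integral => A mA _; exact: lebesgue_measure_reflect.
Qed.

End reflection.

Section dini.
Context {R : realType}.
Local Notation leb := (@lebesgue_measure R).
Variable omega : R -> R.
Hypothesis omega_mod : modulus_of_continuity omega.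
Hypothesis momega : measurable_fun (`]0, 1[ : set R) omega.

Let om : R -> R := omega \_ `]0, 1[.

Let omE u : om u = if 0 < u < 1 then omega u else 0.
Proof. by rewrite /om patchE mem_setE in_itv. Qed.

Let om0 u : 0 <= om u.
Proof.
rewrite omE; case: ifP => // /andP[u0 _]; apply: (proj1 omega_mod); exact: ltW.
Qed.

Let mom : measurable_fun setT om.
Proof. by apply/(measurable_restrictT _ _).1. Qed.

Definition dini_mass (t : R) : \bar R := (\int[leb]_u (om u * (u < t)%R%:R)%:E)%E.

Let mom_lt (t : R) : measurable_fun setT (fun u : R => om u * (u < t)%R%:R).
Proof.
apply: measurable_funM => //; apply: measurable_natr_bool.
exact: measurable_fun_ltr.
Qed.

Let om_lt0 t u : 0 <= om u * (u < t)%R%:R.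
Proof. exact: mulr_ge0. Qed.

Lemma dini_mass_ge0 t : (0 <= dini_mass t)%E.
Proof. exact: integral_real_ge0. Qed.

Lemma dini_mass_mono t t' : t <= t' -> (dini_mass t <= dini_mass t')%E.
Proof.
move=> tt'; apply: le_integral_real => u //; rewrite ler_wpM2l// ler_nat.
by case: (ltP u t) => // /lt_le_trans/(_ tt') ->.
Qed.

(* Subadditivity gives omega t <= omega u + omega (t - u); averaging over u in
   ]0, t[ replaces the missing monotonicity of omega. *)
Lemma omega_average t : 0 < t < 1 ->
  ((t * omega t)%:E <= 2%:E * dini_mass t)%E.
Proof.
move=> /andP[t0 t1]; pose f (u : R) := om u * (u < t)%R%:R.
have mf : measurable_fun [set: measurableTypeR R] (fun u => (f u)%:E).
  by apply/measurable_EFinP; exact: (mom_lt t).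
have f0 (u : R) : (0 <= (f u)%:E)%E by rewrite lee_fin om_lt0.
have omt0 : 0 <= omega t by apply: (proj1 omega_mod); exact: ltW.
have -> : (2%:E * dini_mass t = \int[leb]_u ((f u)%:E + (f (t - u))%:E))%E.
  rewrite ge0_integralD//; last first.
    by apply: (measurableT_comp mf); exact: measurable_reflect.
  rewrite (ge0_integral_reflect t mf f0) /dini_mass -[(2%:E)%E]/(1%:E + 1%:E)%E.
  by rewrite ge0_muleDl ?lee_fin// mul1e.
have m1 : measurable_fun setT (\1_(`]0, t[%classic : set R) : R -> R).
  by apply: measurable_indic; exact: measurable_itv.
apply: (@le_trans _ _ (\int[leb]_u (omega t * \1_(`]0, t[%classic : set R) u)%:E)%E).
  rewrite integral_realZl// integral_indic//= setIT.
  have := @lebesgue_measure_itv R `]0, t[; rewrite /= lte_fin t0 => ->.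
  by rewrite sube0 -EFinM mulrC.
apply: ge0_le_integralW => u; first by rewrite lee_fin mulr_ge0.
rewrite indicE; have [|_] := boolP (u \in _); last first.
  by rewrite mulr0 adde_ge0.
rewrite mem_setE in_itv/= mulr1 -EFinD lee_fin => /andP[u0 ut].
rewrite /f !omE ut (_ : t - u < t); last by lra.
rewrite (_ : 0 < u < 1); last by apply/andP; split; lra.
rewrite (_ : 0 < t - u < 1); last by apply/andP; split; lra.
rewrite !mulr1 -[in leLHS](subrK u t) addrC.
by apply: (proj2 omega_mod); lra.
Qed.

Lemma sum_pow_lt_le (v : R) n : 0 <= v ->
  \sum_(0 <= k < n) 2 ^+ k * (2 ^+ k < v)%R%:R <= 2 * v.
Proof.
move=> v0; pose f k := 2 ^+ k * (2 ^+ k < v)%R%:R : R.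
have H : \sum_(0 <= k < n) f k <= 2 * v /\ \sum_(0 <= k < n) f k <= 2 ^+ n.
  elim: n => [|n [IH1 IH2]].
    by rewrite !big_nil expr0; split => //; rewrite mulr_ge0.
  rewrite !big_nat_recr//= exprS /f.
  have : 0 <= 2 ^+ n :> R by exact: exprn_ge0.
  by case: (ltP (2 ^+ n) v) => ? ?; rewrite ?mulr1 ?mulr0; split; lra.
by case: H.
Qed.

Lemma sum_dini_mass :
  (\sum_(n <oo) (2 ^+ n)%:E * dini_mass (2 ^+ n)^-1 <= 2%:E * dini_norm omega)%E.
Proof.
have mh n : measurable_fun setT (fun u : R => 2 ^+ n * (om u * (u < (2 ^+ n)^-1)%R%:R)).
  exact: measurable_funM.
have h0 n u : 0 <= 2 ^+ n * (om u * (u < (2 ^+ n)^-1)%R%:R).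
  by rewrite mulr_ge0// exprn_ge0.
rewrite (_ : (\sum_(n <oo) _)%E = (\int[leb]_u \sum_(n <oo)
    (2 ^+ n * (om u * (u < (2 ^+ n)^-1)%R%:R))%:E)%E); last first.
  rewrite integral_nneseries//; last 2 first.
  - by move=> n; apply/measurable_EFinP; exact: (mh n).
  - by move=> n u _; rewrite lee_fin h0.
  apply: eq_eseriesr => n _; rewrite integral_realZl ?exprn_ge0//.
  exact: (mom_lt _).
have mv : measurable_fun (`]0%R, 1%R[%classic : set R) (fun t => (omega t / t)%:E).
  apply/measurable_EFinP; apply: measurable_funM => //.
  apply: open_continuous_measurable_fun; first exact: interval_open.
  move=> u; rewrite inE/= in_itv/= => /andP[u0 _].
  by apply: inv_continuous; rewrite gt_eqF.
have v0 t : (`]0%R, 1%R[%classic : set R) t -> (0 <= (omega t / t)%:E)%E.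
  rewrite /= in_itv/= => /andP[t0 _].
  by rewrite lee_fin divr_ge0 ?(ltW t0)//; apply: (proj1 omega_mod); exact: ltW.
have m01 : measurable (`]0%R, 1%R[%classic : set (measurableTypeR R)) by exact: measurable_itv.
have t2 : (0 <= 2%:E :> \bar R)%E by rewrite lee_fin.
rewrite /dini_norm -(ge0_integralZl leb m01 mv v0 t2).
rewrite [leRHS]integral_mkcond; apply: ge0_le_integralW => u.
  by apply: nneseries_ge0 => n _ _; rewrite lee_fin.
rewrite patchE mem_setE in_itv/= omE; case: ifP => [/andP[u0 u1]|_]; last first.
  rewrite eseries0// => n _ _.
  by rewrite mul0r mulr0.
have om0' : 0 <= omega u by apply: (proj1 omega_mod); exact: ltW.
apply: nneseries_le_bound => n.
  by rewrite lee_fin !mulr_ge0 ?exprn_ge0.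
rewrite sumEFin -EFinM lee_fin.
rewrite (eq_bigr (fun k => omega u * (2 ^+ k * (2 ^+ k < u^-1)%R%:R))); last first.
  move=> k _; rewrite mulrCA; congr (_ * (_ * _%:R)); congr nat_of_bool.
  by rewrite -[in RHS](invrK (2 ^+ k)) ltf_pV2// posrE ?invr_gt0 ?exprn_gt0.
rewrite -mulr_sumr mulrCA ler_wpM2l//.
by apply: sum_pow_lt_le; rewrite invr_ge0 ltW.
Qed.

Context {d : nat}.
Local Notation Rd := (d.-tuple R).
Local Notation mu := (lebesgue_rd (R := R) d).

Lemma dini_tail (q : Rd -> R) (x : Rd) (t rho A : R) :
  measurable_fun setT q -> (forall w, 0 <= q w) -> 0 < t -> 2 * t <= rho -> 0 <= A ->
  (forall r, (rho <= r)%R ->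
    \int[mu]_w ((eucl_dist x w <= r)%R%:R * q w)%:E <= (A * r ^+ d)%:E)%E ->
  (\int[mu]_w ((rho < eucl_dist x w)%R%:R *
     (omega (t / eucl_dist x w) * inv_dist x w) * q w)%:E <=
   (2 ^+ d * 8 * A)%:E * dini_norm omega)%E.
Proof.
move=> mq q0 t0 trho A0 growth.
have pow0 n : 0 < 2 ^+ n * t by rewrite mulr_gt0// exprn_gt0.
pose e n := dini_mass (2 ^+ n)^-1.
have e0 n : (0 <= e n)%E by exact: dini_mass_ge0.
pose c n : R := 4 * 2 ^+ n * (2 ^+ n * t) ^- d * (rho <= 2 ^+ n.+1 * t)%R%:R.
have c0 n : 0 <= c n by have := pow0 n => ?; rewrite /c; nonneg.
pose h n w : R := (eucl_dist x w <= 2 ^+ n.+1 * t)%R%:R * q w.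
have h0 n w : 0 <= h n w by exact: mulr_ge0.
have mh n : measurable_fun setT (h n).
  apply: measurable_funM => //; apply: measurable_natr_bool.
  by apply: measurable_fun_ler => //; apply: measurable_fun_eucl_dist.
have ce0 n : (0 <= (c n)%:E * e n)%E by rewrite mule_ge0// lee_fin.
have omx0 w : 0 <= omega (t / eucl_dist x w).
  by apply: (proj1 omega_mod); rewrite divr_ge0 ?eucl_dist_ge0// ltW.
apply: (@le_trans _ _ (\int[mu]_w \sum_(n <oo) ((c n)%:E * e n * (h n w)%:E))%E).
  apply: ge0_le_integralW => w.
    by rewrite lee_fin; have := inv_dist_ge0 x w; have := omx0 w => ? ?; nonneg.
  have s0 n : (0 <= (c n)%:E * e n * (h n w)%:E)%E by rewrite mule_ge0// lee_fin.
  have [rw|_] := ltP rho (eucl_dist x w); last first.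
    by rewrite !mul0r; apply: nneseries_ge0 => n _ _.
  set D := eucl_dist x w in rw *; have D0 : 0 < D by lra.
  have [n n1 n2] : exists2 n, 2 ^+ n * t < D & D <= 2 ^+ n.+1 * t.
    have ex : exists n, D <= 2 ^+ n.+1 * t.
      exists (Num.truncn (D / t)); rewrite -ler_pdivrMr//.
      rewrite (le_trans (ltW (truncnS_gt _)))// -natrX ler_nat ltnW//.
      exact: ltn_expl.
    exists (ex_minn ex); case: ex_minnP => // -[|n] Dn nmin.
      by rewrite expr0 mul1r; lra.
    by rewrite ltNge; apply/negP => /nmin; rewrite ltnn.
  apply: (@le_trans _ _ ((c n)%:E * e n * (h n w)%:E)%E); last first.
    apply: (@le_trans _ _ (\sum_(0 <= k < n.+1) ((c k)%:E * e k * (h k w)%:E))%E).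
      by rewrite big_nat_recr//= leeDr// sume_ge0.
    by apply: nneseries_lim_ge => k _.
  rewrite /c /h -/D n2 (_ : (rho <= 2 ^+ n.+1 * t) = true); last by lra.
  rewrite !mul1r mulr1 EFinM lee_wpmul2r ?lee_fin//.
  have tD0 : 0 < t / D by rewrite divr_gt0.
  have tD1 : t / D < 1 by rewrite ltr_pdivrMr// mul1r; lra.
  have /andP tD : 0 < t / D < 1 by rewrite tD0.
  have H := omega_average (introT andP tD).
  have ele : (dini_mass (t / D) <= e n)%E.
    apply: dini_mass_mono; rewrite ler_pdivrMr//.
    by rewrite mulrC ler_pdivlMr ?exprn_gt0// mulrC ltW.
  have omle : ((omega (t / D))%:E <= (4 * 2 ^+ n)%:E * e n)%E.
    apply: (@le_trans _ _ ((D / t)%:E * (t / D * omega (t / D))%:E)%E).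
      by rewrite -EFinM lee_fin mulrA mulrA mulfVK ?gt_eqF// divff ?mul1r// gt_eqF.
    apply: (@le_trans _ _ ((2 ^+ n.+1)%:E * (2%:E * e n))%E).
      apply: lee_pmul => //.
      - by rewrite lee_fin divr_ge0 ?(ltW D0) ?(ltW t0).
      - by rewrite lee_fin mulr_ge0 ?(ltW tD0)//; exact: omx0.
      - by rewrite lee_fin ler_pdivrMr.
      by apply: (le_trans H); rewrite lee_wpmul2l ?lee_fin.
    by rewrite muleA -EFinM exprS (_ : 2 * 2 ^+ n * 2 = 4 * 2 ^+ n)//; ring.
  rewrite EFinM [X in (_ <= X * _)%E]EFinM muleAC.
  apply: lee_pmul; rewrite ?lee_fin ?inv_dist_ge0//; first exact: omx0.
  rewrite /inv_dist -/D lef_pV2 ?posrE ?exprn_gt0//.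
  by apply: lerXn2r; rewrite ?nnegrE; exact: ltW.
rewrite integral_nneseries//; last 2 first.
- by move=> n; apply: measurable_funeM; exact/measurable_EFinP.
- by move=> n w _; rewrite mule_ge0// lee_fin.
apply: (@le_trans _ _ (\sum_(n <oo) (4 * 2 ^+ d * A)%:E * ((2 ^+ n)%:E * e n))%E).
  apply: lee_nneseries => [n _ _|n _].
    by apply: integral_ge0 => w _; rewrite mule_ge0// lee_fin.
  rewrite ge0_integralZl//; last 2 first.
  - exact/measurable_EFinP.
  - by move=> w _; rewrite lee_fin.
  rewrite /c; have [rn|_] := leP rho (2 ^+ n.+1 * t); last first.
    by rewrite mulr0 !mul0e; rewrite !mule_ge0// lee_fin; nonneg.
  rewrite mulr1; apply: (@le_trans _ _ ((4 * 2 ^+ n * (2 ^+ n * t) ^- d)%:E * e n *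
      (A * (2 ^+ n.+1 * t) ^+ d)%:E)%E).
    rewrite lee_wpmul2l//; last exact: growth.
    by rewrite mule_ge0// lee_fin; have := pow0 n => ?; nonneg.
  rewrite muleAC -EFinM muleA -EFinM lee_wpmul2r// lee_fin.
  rewrite exprS -(mulrA 2 (2 ^+ n)) [(2 * _) ^+ d]exprMn.
  have : (2 ^+ n * t) ^+ d != 0 by rewrite expf_neq0// gt_eqF.
  move: ((2 ^+ n * t) ^+ d) => u u0.
  by rewrite le_eqVlt; apply/orP; left; apply/eqP; field.
rewrite nneseriesZl//; last by move=> n _; rewrite mule_ge0// lee_fin exprn_ge0.
apply: (@le_trans _ _ ((4 * 2 ^+ d * A)%:E * (2%:E * dini_norm omega))%E).
  rewrite lee_wpmul2l ?sum_dini_mass// lee_fin; nonneg.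
rewrite muleA -EFinM (_ : 4 * 2 ^+ d * A * 2 = 2 ^+ d * 8 * A)//; ring.
Qed.

End dini.

(** * Norms of variation sequences *)

Section lr_norms.
Context {R : realType}.
Implicit Types (r : \bar R) (v : seq R).

Lemma lr_norm_bound (r : R) v (B : R) : 0 < r -> 0 <= B ->
  \sum_(u <- v) powR u r <= powR B r -> lr_norm r%:E v <= B.
Proof.
move=> r0 B0 H; rewrite /lr_norm.
have v0 : 0 <= \sum_(u <- v) powR u r by apply: sumr_ge0 => u _; exact: powR_ge0.
apply: (@le_trans _ _ (powR (powR B r) r^-1)).
  by apply: ge0_ler_powR; rewrite ?nnegrE ?invr_ge0 ?powR_ge0 ?(ltW r0).
by rewrite -powRrM divff ?powRr1// gt_eqF.
Qed.

Lemma lr_norm_sum (r : R) v (B : R) : 0 < r -> 0 <= B ->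
  lr_norm r%:E v <= B -> \sum_(u <- v) powR u r <= powR B r.
Proof.
move=> r0 B0; rewrite /lr_norm => H.
have v0 : 0 <= \sum_(u <- v) powR u r by apply: sumr_ge0 => u _; exact: powR_ge0.
have : powR (powR (\sum_(u <- v) powR u r) r^-1) r <= powR B r.
  by apply: ge0_ler_powR; rewrite ?nnegrE ?powR_ge0 ?(ltW r0).
by rewrite -powRrM mulVf ?powRr1// gt_eqF.
Qed.

Lemma bigmax_le_iff v (B : R) : 0 <= B ->
  (\big[Num.max/0]_(u <- v) u <= B) <-> (forall u, u \in v -> u <= B).
Proof.
move=> B0; elim: v => [|u v IH]; first by rewrite big_nil.
rewrite big_cons ge_max; split.
  move=> /andP[uB /IH vB] w; rewrite inE => /orP[/eqP -> //|]; exact: vB.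
move=> H; rewrite H ?mem_head//=; apply/IH => w wv.
by apply: H; rewrite inE wv orbT.
Qed.

Lemma sum_sqr_le (I : Type) (s : seq I) (P : I -> R) : (forall q, 0 <= P q) ->
  \sum_(q <- s) P q ^+ 2 <= (\sum_(q <- s) P q) ^+ 2.
Proof.
move=> P0; elim: s => [|q s IH]; first by rewrite !big_nil expr0n.
rewrite !big_cons; have : 0 <= \sum_(q <- s) P q by exact: sumr_ge0.
move: IH; set A := \sum_(q <- s) _ ^+ 2; set B := \sum_(q <- s) P q => IH B0.
have -> : (P q + B) ^+ 2 = P q ^+ 2 + (2 * (P q * B) + B ^+ 2) by ring.
by rewrite lerD2l (le_trans IH)// lerDr !mulr_ge0.
Qed.

Lemma lr_norm_perturb (I : eqType) (s : seq I) (Y A P D E : I -> R) r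
    (lam c1 c2 c3 : R) : (2%:E < r)%E -> 0 < lam -> 0 <= c3 ->
  (forall q, 0 <= Y q) -> (forall q, 0 <= A q) -> (forall q, 0 <= P q) ->
  (forall q, 0 <= D q) -> (forall q, 0 <= E q) ->
  (forall q, q \in s -> Y q <= A q + 2 * (P q + D q + E q)) ->
  lr_norm r [seq A q | q <- s] <= lam ->
  \sum_(q <- s) P q <= c1 * lam -> \sum_(q <- s) D q <= c2 * lam ->
  \sum_(q <- s) E q ^+ 2 <= c3 * lam ^+ 2 ->
  lr_norm r [seq Y q | q <- s] <= 4 * (1 + 12 * (c1 ^+ 2 + c2 ^+ 2 + c3)) * lam.
Proof.
move=> r2 lam0 c30 Y0 A0 P0 D0 E0 YA Alam Pc Dc Ec.
set c := 1 + _; pose X q := 2 * (P q + D q + E q).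
have X0 q : 0 <= X q by rewrite /X; nonneg.
have c1' : 1 <= c by rewrite lerDl; have := sqr_ge0 c1; have := sqr_ge0 c2; lra.
have c0 : 0 < c by lra.
have clam0 : 0 < c * lam by exact: mulr_gt0.
have lamc : lam <= c * lam by rewrite ler_peMl// ltW.
have sumP0 : 0 <= \sum_(q <- s) P q by exact: sumr_ge0.
have sumD0 : 0 <= \sum_(q <- s) D q by exact: sumr_ge0.
have X2 : \sum_(q <- s) X q ^+ 2 <= (c * lam) ^+ 2.
  apply: (@le_trans _ _ (\sum_(q <- s) 12 * (P q ^+ 2 + D q ^+ 2 + E q ^+ 2))).
    apply: ler_sum => q _; rewrite /X -subr_ge0.
    rewrite (_ : _ - _ = 4 * ((P q - D q) ^+ 2 + (P q - E q) ^+ 2 + (D q - E q) ^+ 2)).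
      by rewrite mulr_ge0// !addr_ge0// sqr_ge0.
    by ring.
  rewrite -mulr_sumr !big_split/=.
  have P2 : \sum_(q <- s) P q ^+ 2 <= c1 ^+ 2 * lam ^+ 2.
    rewrite (le_trans (sum_sqr_le s P0))// -exprMn.
    by apply: lerXn2r; rewrite ?nnegrE// (le_trans sumP0).
  have D2 : \sum_(q <- s) D q ^+ 2 <= c2 ^+ 2 * lam ^+ 2.
    rewrite (le_trans (sum_sqr_le s D0))// -exprMn.
    by apply: lerXn2r; rewrite ?nnegrE// (le_trans sumD0).
  apply: (@le_trans _ _ (c * lam ^+ 2)); last first.
    by rewrite exprMn ler_wpM2r ?sqr_ge0// expr2 ler_peMl// ltW.
  have : 0 <= lam ^+ 2 by exact: sqr_ge0.
  rewrite /c; set l2 := lam ^+ 2 in P2 D2 Ec * => l20.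
  set sP := \sum_(q <- s) P q ^+ 2 in P2 *.
  set sD := \sum_(q <- s) D q ^+ 2 in D2 *.
  set sE := \sum_(q <- s) E q ^+ 2 in Ec *.
  nra.
have Xle q : q \in s -> X q <= c * lam.
  move=> qs; rewrite -(@ler_pXn2r _ 2)// ?nnegrE ?X0 ?(ltW clam0)//.
  apply: le_trans X2; rewrite (big_rem q)//= lerDl; apply: sumr_ge0 => i _.
  exact: sqr_ge0.
case: r r2 Alam => [r|_|//]; last first.
  rewrite /lr_norm => /(bigmax_le_iff _ (ltW lam0)) Ale.
  have B0 : 0 <= 4 * c * lam by rewrite -mulrA mulr_ge0// ltW.
  apply/(bigmax_le_iff _ B0) => _ /mapP[q qs ->].
  have := YA q qs; have := Xle q qs; have := Ale _ (map_f A qs).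
  by rewrite /X -[4 * c * lam]mulrA; lra.
rewrite lte_fin => r2 Alam.
have r0 : 0 < r by lra.
apply: lr_norm_bound => //; first by rewrite -mulrA mulr_ge0// ltW.
have := lr_norm_sum r0 (ltW lam0) Alam; rewrite !big_map => SA.
have SX : \sum_(q <- s) powR (X q) r <= powR (c * lam) r.
  apply: (@le_trans _ _ (\sum_(q <- s) powR (c * lam) (r - 2) * X q ^+ 2)).
    rewrite !big_seq; apply: ler_sum => q qs.
    have -> : powR (X q) r = powR (X q) (r - 2) * X q ^+ 2.
      rewrite -powR_mulrn// -powRD ?subrK//.
      by apply/implyP => /eqP; lra.
    rewrite ler_wpM2r ?sqr_ge0//; apply: ge0_ler_powR; rewrite ?nnegrE//.
    - lra.
    - exact: ltW.
    exact: Xle.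
  rewrite -mulr_sumr.
  have -> : powR (c * lam) r = powR (c * lam) (r - 2) * (c * lam) ^+ 2.
    rewrite -powR_mulrn ?(ltW clam0)// -powRD ?subrK//.
    by apply/implyP => /eqP; lra.
  by rewrite ler_wpM2l ?powR_ge0.
apply: (@le_trans _ _ (\sum_(q <- s) powR 2 r * (powR (A q) r + powR (X q) r))).
  rewrite !big_seq; apply: ler_sum => q qs.
  apply: (@le_trans _ _ (powR (2 * Num.max (A q) (X q)) r)).
    apply: ge0_ler_powR; rewrite ?nnegrE ?(ltW r0)//.
      by rewrite mulr_ge0// le_max A0.
    apply: (le_trans (YA q qs)).
    have : A q <= Num.max (A q) (X q) by rewrite le_max lexx.
    have : X q <= Num.max (A q) (X q) by rewrite le_max lexx orbT.
    by rewrite {1}/X; lra.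
  rewrite powRM ?le_max ?A0// ler_wpM2l ?powR_ge0//.
  by case: (leP (A q) (X q)) => _; rewrite ?lerDl ?lerDr powR_ge0.
rewrite -mulr_sumr big_split/=.
have -> : 4 * c * lam = 2 * (2 * (c * lam)) by ring.
have clam0' := ltW clam0.
have c2lam0 : 0 <= 2 * (c * lam) by exact: mulr_ge0.
rewrite (powRM _ (ler0n R 2) c2lam0) ler_wpM2l ?powR_ge0//.
rewrite (powRM _ (ler0n R 2) clam0').
have h1 : powR lam r <= powR (c * lam) r.
  by apply: ge0_ler_powR; rewrite ?nnegrE ?(ltW r0) ?(ltW lam0) ?(ltW clam0).
have h2 : 2 <= powR 2 r.
  by rewrite -[leLHS]powRr1// ler_powR ?ler1n//; lra.
apply: (@le_trans _ _ (2 * powR (c * lam) r)); first by lra.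
by rewrite ler_wpM2r ?powR_ge0.
Qed.

Lemma lr_norm_cons0 r v : (2%:E < r)%E -> lr_norm r (0 :: v) = lr_norm r v.
Proof.
case: r => [r|_|//] /=.
  rewrite lte_fin => r2; rewrite big_cons powR0 ?add0r// gt_eqF//; lra.
rewrite big_cons; apply: max_r; elim: v => [|u v IH]; first by rewrite big_nil.
by rewrite big_cons le_max IH orbT.
Qed.

Lemma lr_norm_nil r : (2%:E < r)%E -> lr_norm r [::] = 0.
Proof.
case: r => [r|_|//] /=; last by rewrite big_nil.
by rewrite lte_fin big_nil => r2; rewrite powR0// invr_eq0 gt_eqF//; lra.
Qed.

Definition segments (t1 : R) (ts : seq R) : seq (R * R) := pairmap pair t1 ts.

Lemma map_segments (T : Type) (h : R -> R -> T) t1 ts :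
  [seq h q.1 q.2 | q <- segments t1 ts] = pairmap h t1 ts.
Proof. by elim: ts t1 => //= t2 ts IH t1; rewrite -IH. Qed.

Lemma segments_ge (t1 : R) ts (q : R * R) : path <%R t1 ts ->
  q \in segments t1 ts -> t1 <= q.1 /\ q.1 < q.2.
Proof.
elim: ts t1 => //= t2 ts IH t1 /andP[t12 pt].
rewrite inE => /orP[/eqP -> //=|/(IH _ pt)[h1 h2]].
by split => //; rewrite (le_trans (ltW t12)).
Qed.

Lemma segments_disjoint (t1 : R) ts (u : R) : path <%R t1 ts ->
  \sum_(q <- segments t1 ts) (q.1 < u < q.2)%R%:R <= (1 : R).
Proof.
elim: ts t1 => [|t2 ts IH] t1 /=; first by rewrite big_nil.
move=> /andP[t12 pt]; rewrite big_cons /=.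
have [/andP[h1 h2]|_] := boolP (t1 < u < t2); last by rewrite add0r; exact: IH.
rewrite big_seq big1 ?addr0// => q /(segments_ge pt)[h3 _].
by rewrite (_ : q.1 < u = false)//; apply/negbTE; rewrite -leNgt; lra.
Qed.

End lr_norms.

(** * Comparison of truncations *)

Section complex_norm.
Context {R : realType}.
Local Notation normc := Normc.normc.
Implicit Types z w : R[i].

Lemma normc_ge0 z : 0 <= normc z.
Proof. by case: z => a b; exact: sqrtr_ge0. Qed.

Lemma Re_le_normc z : `|complex.Re z| <= normc z.
Proof.
case: z => a b /=; rewrite -sqrtr_sqr ler_wsqrtr// lerDl; exact: sqr_ge0.
Qed.

Lemma Im_le_normc z : `|complex.Im z| <= normc z.
Proof.
case: z => a b /=; rewrite -sqrtr_sqr ler_wsqrtr// lerDr; exact: sqr_ge0.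
Qed.

Lemma normc_le_ReIm z : normc z <= `|complex.Re z| + `|complex.Im z|.
Proof.
case: z => a b /=.
rewrite -(@ler_pXn2r _ 2)// ?nnegrE ?sqrtr_ge0 ?addr_ge0//.
rewrite sqr_sqrtr ?addr_ge0 ?sqr_ge0// sqrrD !real_normK ?num_real//.
by rewrite addrAC lerDl mulrn_wge0// mulr_ge0.
Qed.

Lemma normcD_le z w : normc (z + w) <= normc z + normc w.
Proof. exact: le_normcD. Qed.

Lemma normcB_sym z w : normc (z - w) = normc (w - z).
Proof. by rewrite -[RHS]normcN; congr normc; rewrite opprB. Qed.

Lemma normc_zero : normc (0 : R[i]) = 0.
Proof. exact: Normc.normc0. Qed.

Lemma ReB z w : complex.Re (z - w) = complex.Re z - complex.Re w.
Proof. by case: z; case: w. Qed.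

Lemma ImB z w : complex.Im (z - w) = complex.Im z - complex.Im w.
Proof. by case: z; case: w. Qed.

Lemma ReMc z w : complex.Re (z * w) =
  complex.Re z * complex.Re w - complex.Im z * complex.Im w.
Proof. by case: z; case: w. Qed.

Lemma ImMc z w : complex.Im (z * w) =
  complex.Re z * complex.Im w + complex.Im z * complex.Re w.
Proof. by case: z => a b; case: w. Qed.

Lemma measurable_normc dd (T : measurableType dd) (f : T -> R[i]) :
  cmeasurable_fun setT f -> measurable_fun setT (fun x => normc (f x)).
Proof.
move=> [mr mi].
rewrite (_ : (fun x => _) = (fun x => Num.sqrt (complex.Re (f x) ^+ 2 + complex.Im (f x) ^+ 2))).
  apply: (@measurableT_comp _ _ _ _ _ _ (@Num.sqrt R)).
    by apply: continuous_measurable_fun; exact: sqrt_continuous.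
  by apply: measurable_funD; exact: measurable_funX.
by apply/funext => x; case: (f x).
Qed.

End complex_norm.

Lemma mem_set_bool (T : Type) (b : T -> bool) z : (z \in [set z | b z]) = b z.
Proof. by apply/idP/idP; rewrite inE. Qed.

Section integral_perturbation.
Context {R : realType} {d : nat}.
Local Notation Rd := (d.-tuple R).
Local Notation mu := (lebesgue_rd (R := R) d).
Local Notation normc := Normc.normc.

Lemma Rintegral_perturb (A B : set Rd) (g h H : Rd -> R) :
  measurable A -> measurable B ->
  mu.-integrable A (EFin \o g) -> mu.-integrable B (EFin \o h) ->
  (forall z, `|(g \_ A) z - (h \_ B) z| <= H z) ->
  ((`|\int[mu]_(z in A) g z - \int[mu]_(z in B) h z|)%:E <= \int[mu]_z (H z)%:E)%E.
Proof.
move=> mA mB ig ih HH.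
have ig' : mu.-integrable setT (EFin \o (g \_ A)).
  by rewrite -restrict_EFin; apply/(integrable_mkcond (EFin \o g) mA).1.
have ih' : mu.-integrable setT (EFin \o (h \_ B)).
  by rewrite -restrict_EFin; apply/(integrable_mkcond (EFin \o h) mB).1.
rewrite Rintegral_mkcond [X in _ - X]Rintegral_mkcond -RintegralB//.
have igh : mu.-integrable setT (EFin \o (fun z => (g \_ A) z - (h \_ B) z)).
  rewrite (_ : _ \o _ = (EFin \o (g \_ A)) \- (EFin \o (h \_ B)))%E//.
  exact: integrableB.
rewrite EFin_normr_Rintegral//; apply: le_trans (le_abse_integral mu measurableT _) _.
  by case/integrableP: igh.
by apply: ge0_le_integralW => z; [exact: abse_ge0|rewrite /= lee_fin].
Qed.

Lemma cintegral_perturb (A B : Rd -> bool) (g h : Rd -> R[i]) (H : Rd -> R) :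
  measurable_fun setT A -> measurable_fun setT B ->
  mu.-integrable [set z | A z] (fun z => (complex.Re (g z))%:E) ->
  mu.-integrable [set z | A z] (fun z => (complex.Im (g z))%:E) ->
  mu.-integrable [set z | B z] (fun z => (complex.Re (h z))%:E) ->
  mu.-integrable [set z | B z] (fun z => (complex.Im (h z))%:E) ->
  (forall z, normc ((if A z then g z else 0) - (if B z then h z else 0)) <= H z) ->
  ((normc (cintegral [set z | A z] g))%:E <=
    (normc (cintegral [set z | B z] h))%:E + 2%:E * \int[mu]_z (H z)%:E)%E.
Proof.
move=> mA mB igr igi ihr ihi HH.
have mA' := measurable_set_bool mA; have mB' := measurable_set_bool mB.
have part (T : R[i] -> R) (z : Rd) : T 0 = 0 ->
    ((T \o g) \_ [set z | A z]) z - ((T \o h) \_ [set z | B z]) z =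
    T (if A z then g z else 0) - T (if B z then h z else 0).
  by move=> T0; rewrite !patchE !mem_set_bool; case: (A z); case: (B z); rewrite /= ?T0.
have HR := @Rintegral_perturb _ _ (fun z => complex.Re (g z))
  (fun z => complex.Re (h z)) H mA' mB' igr ihr.
have HI := @Rintegral_perturb _ _ (fun z => complex.Im (g z))
  (fun z => complex.Im (h z)) H mA' mB' igi ihi.
apply: (@le_trans _ _ ((normc (cintegral [set z | B z] h))%:E +
   (normc (cintegral [set z | A z] g - cintegral [set z | B z] h))%:E)%E).
  by rewrite -EFinD lee_fin; apply: (le_trans _ (normcD_le _ _)); rewrite addrC subrK.
rewrite leeD2l//.
apply: (@le_trans _ _ ((`|complex.Re (cintegral [set z | A z] g - cintegral [set z | B z] h)|)%:E +
   (`|complex.Im (cintegral [set z | A z] g - cintegral [set z | B z] h)|)%:E)%E).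
  by rewrite -EFinD lee_fin normc_le_ReIm.
rewrite ReB ImB /cintegral /=.
have H0 z : 0 <= H z by exact: le_trans (normc_ge0 _) (HH z).
rewrite -[(2%:E)%E]/(1%:E + 1%:E)%E ge0_muleDl ?lee_fin// mul1e.
apply: leeD.
  apply: HR => z; rewrite (part (@complex.Re R))// -ReB.
  exact: le_trans (Re_le_normc _) (HH z).
apply: HI => z; rewrite (part (@complex.Im R))// -ImB.
exact: le_trans (Im_le_normc _) (HH z).
Qed.

End integral_perturbation.

Section CZ_truncations.
Context {R : realType} {d : nat}.
Local Notation Rd := (d.-tuple R).
Local Notation mu := (lebesgue_rd (R := R) d).
Local Notation normc := Normc.normc.
Variables (omega : R -> R) (K : Rd -> Rd -> R[i]) (f : Rd -> R[i]).
Hypotheses (hK : CZ_kernel omega K) (hf : inL1 f).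
Implicit Types x y z : Rd.

Lemma eucl_dist_gt0 x z : (0 < eucl_dist x z) = (x != z).
Proof.
rewrite lt0r eucl_dist_ge0 andbT; congr (~~ _); apply/eqP/eqP => [|->].
  exact: eucl_dist_eq0.
exact: eucl_distxx.
Qed.

Lemma measurable_offdiag : measurable [set p : Rd * Rd | p.1 <> p.2].
Proof.
rewrite (_ : [set p | _] = [set p : Rd * Rd | 0 < eucl_dist p.1 p.2]).
  apply: measurable_set_bool; apply: measurable_fun_ltr => //.
  exact: measurable_eucl_dist.
by apply/seteqP; split => p /=; rewrite eucl_dist_gt0 => /eqP.
Qed.

Let annulus x (u v : R) z := u < eucl_dist x z < v.

Lemma measurable_annulus x u v : measurable_fun setT (annulus x u v).
Proof.
by apply: measurable_and; apply: measurable_fun_ltr => //;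
  apply: measurable_fun_eucl_dist.
Qed.

Lemma measurable_kernel_section (p : R[i] -> R) x u v : 0 < u ->
  measurable_fun [set p : Rd * Rd | p.1 <> p.2] (fun w => p (K w.1 w.2)) ->
  measurable_fun [set z | annulus x u v z] (fun z => p (K x z)).
Proof.
move=> u0 mK; apply: (@measurable_comp _ _ _ _ _ _ [set p : Rd * Rd | p.1 <> p.2]
  (fun w => p (K w.1 w.2)) [set z | annulus x u v z] (fun z => (x, z)) measurable_offdiag _ mK).
  move=> _ [z /andP[uz _] <-] /= xz.
  by move: uz; rewrite xz eucl_distxx ltNge (ltW u0).
by apply: measurable_funTS; exact: pair1_measurable.
Qed.

Lemma CZ_size_ge0 : exists2 CK : R, 0 <= CK & forall x z, 0 < eucl_dist x z ->
  normc (K x z) <= CK * inv_dist x z.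
Proof.
have [CK H] := CZ_size hK; exists (Num.max CK 0); first by rewrite le_max lexx orbT.
move=> x z; rewrite eucl_dist_gt0 => /eqP xz; apply: (le_trans (H x z xz)).
by rewrite ler_wpM2r ?inv_dist_ge0// le_max lexx.
Qed.

Lemma truncation_integrable x u v : 0 < u ->
  mu.-integrable [set z | annulus x u v z] (fun z => (complex.Re (K x z * f z))%:E) /\
  mu.-integrable [set z | annulus x u v z] (fun z => (complex.Im (K x z * f z))%:E).
Proof.
move=> u0; have mA := measurable_set_bool (measurable_annulus x u v).
have [CK CK0 size] := CZ_size_ge0.
have [mKr mKi] := CZ_measurable hK.
have mr : measurable_fun [set z | annulus x u v z] (fun z => complex.Re (K x z)).
  exact: (measurable_kernel_section u0 mKr).
have mi : measurable_fun [set z | annulus x u v z] (fun z => complex.Im (K x z)).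
  exact: (measurable_kernel_section u0 mKi).
have [[mfr mfi] foo] := hf.
have mfr' : measurable_fun [set z | annulus x u v z] (fun z => complex.Re (f z)).
  exact: measurable_funTS.
have mfi' : measurable_fun [set z | annulus x u v z] (fun z => complex.Im (f z)).
  exact: measurable_funTS.
have bound (p : R[i] -> R) : (forall w, `|p w| <= normc w) ->
    (\int[mu]_(z in [set z | annulus x u v z]) `|(p (K x z * f z))%:E| < +oo)%E.
  move=> pn; apply: (@le_lt_trans _ _ (\int[mu]_z
      (CK * (u ^+ d)^-1 * normc (f z))%:E)%E).
    rewrite integral_mkcond; apply: ge0_le_integralW => z.
      by rewrite erestrict_ge0.
    have n0 := normc_ge0 (f z).
    rewrite patchE mem_set_bool; case: ifP => [/andP[uz _]|_]; last first.
      by rewrite lee_fin; have := ltW u0 => ?; nonneg.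
    rewrite /= lee_fin (le_trans (pn _))// Normc.normcM ler_wpM2r//.
    rewrite (le_trans (size _ _ (lt_trans u0 uz)))// ler_wpM2l//.
    rewrite /inv_dist lef_pV2 ?posrE ?exprn_gt0// ?(lt_trans u0 uz)//.
    by apply: lerXn2r; rewrite ?nnegrE ?eucl_dist_ge0 ?(ltW u0)// ltW.
  rewrite integral_realZl//.
  - rewrite lte_mul_pinfty// lee_fin; have := ltW u0 => ?; nonneg.
  - have := ltW u0 => ?; nonneg.
  - exact: measurable_normc.
  - by move=> z; exact: normc_ge0.
split; apply/integrableP; split.
- apply/measurable_EFinP; rewrite (_ : (fun z => _) = (fun z =>
    complex.Re (K x z) * complex.Re (f z) - complex.Im (K x z) * complex.Im (f z))); last first.
    by apply/funext => z /=; rewrite ReMc.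
  by apply: measurable_funB; exact: measurable_funM.
- exact: bound (@Re_le_normc R).
- apply/measurable_EFinP; rewrite (_ : (fun z => _) = (fun z =>
    complex.Re (K x z) * complex.Im (f z) + complex.Im (K x z) * complex.Re (f z))); last first.
    by apply/funext => z /=; rewrite ImMc.
  by apply: measurable_funD; exact: measurable_funM.
- exact: bound (@Im_le_normc R).
Qed.

Lemma truncation_perturb x y u v u' (H : Rd -> R) : 0 < u -> 0 < u' ->
  (forall z, normc ((if u < eucl_dist y z < v then K y z * f z else 0) -
     (if u' < eucl_dist x z < v then K x z * f z else 0)) <= H z) ->
  ((normc (truncation K f y u v))%:E <=
    (normc (truncation K f x u' v))%:E + 2%:E * \int[mu]_z (H z)%:E)%E.
Proof.
move=> u0 u'0 HH; have [ir ii] := truncation_integrable y v u0.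
have [jr ji] := truncation_integrable x v u'0.
by apply: cintegral_perturb => //; exact: measurable_annulus.
Qed.

Lemma truncation_empty x (u v : R) : v <= u -> truncation K f x u v = 0.
Proof.
move=> vu; rewrite /truncation (_ : [set z | _] = set0); last first.
  by rewrite -subset0 => z /= /andP[h1 h2]; move: (lt_trans h1 h2); rewrite ltNge vu.
by rewrite /cintegral !Rintegral_set0.
Qed.

Lemma lr_norm_truncation_cut x (cut B : R) (r : \bar R) (t1 : R) ts :
  (2%:E < r)%E -> 0 <= B -> path <%R t1 ts ->
  (forall t ts', path <%R t ts' -> cut <= t ->
    lr_norm r (pairmap (fun u w => normc (truncation K f x u w)) t ts') <= B) ->
  lr_norm r [seq normc (truncation K f x (Num.max q.1 cut) q.2) |
    q <- segments t1 ts] <= B.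
Proof.
move=> r2 B0 + H; elim: ts t1 => [|t2 ts IH] t1; first by rewrite lr_norm_nil.
rewrite [path _ _ _]/= => /andP[t12 pt].
rewrite -[segments t1 (t2 :: ts)]/((t1, t2) :: segments t2 ts) map_cons.
rewrite [(t1, t2).1]/= [(t1, t2).2]/=.
have [t2c|ct2] := leP t2 cut.
  rewrite truncation_empty ?normc_zero ?lr_norm_cons0//; first exact: IH.
  by rewrite le_max t2c orbT.
have -> : [seq normc (truncation K f x (Num.max q.1 cut) q.2) | q <- segments t2 ts]
   = [seq normc (truncation K f x q.1 q.2) | q <- segments t2 ts].
  apply/eq_in_map => q /(segments_ge pt)[h1 _].
  by rewrite (max_idPl _)// (le_trans (ltW ct2)).
rewrite (map_segments (fun u w => normc (truncation K f x u w))).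
apply: (H (Num.max t1 cut) (t2 :: ts)) => /=.
  by rewrite gt_max t12 ct2.
by rewrite le_max lexx orbT.
Qed.

End CZ_truncations.

Lemma fine_sum_le (R : realType) (Q : eqType) (s : seq Q) (I : Q -> \bar R) (B : R) :
  (forall q, 0 <= I q)%E -> (\sum_(q <- s) I q <= B%:E)%E ->
  (forall q, q \in s -> I q = (fine (I q))%:E) /\
  \sum_(q <- s) fine (I q) <= B.
Proof.
move=> I0 H; have fin q : q \in s -> I q = (fine (I q))%:E.
  move=> qs; rewrite fineK// ge0_fin_numE//.
  apply: (@le_lt_trans _ _ B%:E); last exact: ltry.
  apply: le_trans H; rewrite (big_rem q)//= leeDl// sume_ge0//.
split=> //; rewrite -lee_fin -sumEFin; apply: le_trans H.
by rewrite le_eqVlt; apply/orP; left; apply/eqP; apply: eq_big_seq => q /fin.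
Qed.

Lemma fine_sum_sqr_le (R : realType) (Q : eqType) (s : seq Q) (I : Q -> \bar R) (B : R) :
  (forall q, 0 <= I q)%E -> (\sum_(q <- s) I q * I q <= B%:E)%E ->
  (forall q, q \in s -> I q = (fine (I q))%:E) /\
  \sum_(q <- s) fine (I q) ^+ 2 <= B.
Proof.
move=> I0 H; have II0 q : (0 <= I q * I q)%E by rewrite mule_ge0.
have [fin le] := fine_sum_le II0 H.
have fin' q : q \in s -> I q = (fine (I q))%:E.
  move=> /fin; case: (I q) (I0 q) => [//| |//] _.
  by rewrite mulyy.
split=> //; apply: le_trans le; rewrite le_eqVlt; apply/orP; left; apply/eqP.
by apply: eq_big_seq => q /fin' ->; rewrite -EFinM/= expr2.
Qed.

Section comparison.
Context {R : realType} {d : nat}.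
Local Notation Rd := (d.-tuple R).
Local Notation mu := (lebesgue_rd (R := R) d).
Local Notation normc := Normc.normc.
Variables (omega : R -> R) (K : Rd -> Rd -> R[i]) (f : Rd -> R[i]) (r : \bar R).
Hypotheses (hK : CZ_kernel omega K) (hf : inL1 f) (r2 : (2%:E < r)%E).
Hypothesis d0 : (0 < d)%N.
Variables (a CK eta lam : R) (J : nat).
Hypotheses (a0 : 0 < a) (CK0 : 0 <= CK) (eta0 : 0 < eta) (lam0 : 0 < lam).
Hypothesis size_bound : forall x z : Rd, 0 < eucl_dist x z ->
  normc (K x z) <= CK * inv_dist x z.
Let p (z : Rd) : R := normc (f z).
Hypothesis heavyJ : forall j z, (J <= j)%N -> ~~ heavy eta lam p j z.
Implicit Types x y z w : Rd.
Local Notation ballC := (@ball_cst R d).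
Local Notation gap := (@shell_gap R d).

Definition size_cst : R := CK * ballC * ((gap + 2) * (2 * (1 + a))) ^+ d.
Definition smooth_cst : R := 2 ^+ d * 8 * ballC * fine (dini_norm omega).
Definition edge_cst : R := 4 * CK ^+ 2 * @annular_cst R d.

Variables (x y : Rd) (s : R).
Hypotheses (xy : eucl_dist x y < a * s) (xy0 : 0 < eucl_dist x y) (es : eta <= s).
Hypothesis small_excess : (excess eta lam p J x <= (@excess_cst R d * lam)%:E)%E.
Hypothesis small_interaction : (interaction eta lam p J x <= (lam ^+ 2)%:E)%E.
Hypothesis variation_x : forall t ts, path <%R t ts -> 0 < t ->
  lr_norm r (pairmap (fun u v => normc (truncation K f x u v)) t ts) <= lam.
Variables (t1 : R) (ts : seq R).
Hypotheses (st1 : s <= t1) (pt : path <%R t1 ts).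

Let s0 : 0 < s. Proof. exact: lt_le_trans es. Qed.
Let p0 z : 0 <= p z. Proof. exact: normc_ge0. Qed.
Let mp : measurable_fun setT p. Proof. by apply: measurable_normc; case: hf. Qed.

Let scale_exists : exists i, (1 + a) * s <= scale eta i <= 2 * ((1 + a) * s).
Proof.
apply: scale_ceil => //; apply: (le_trans es); rewrite mulrDl mul1r lerDl.
by rewrite mulr_ge0// ltW.
Qed.
Let i := projT1 (cid scale_exists).
Let S := scale eta i.
Let S_ge : (1 + a) * s <= S. Proof. by case/andP: (projT2 (cid scale_exists)). Qed.
Let S_le : S <= 2 * ((1 + a) * s). Proof. by case/andP: (projT2 (cid scale_exists)). Qed.
Let S0 : 0 < S. Proof. exact: scale_gt0. Qed.
Let as0 : 0 < a * s. Proof. exact: mulr_gt0. Qed.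
Let t := eucl_dist x y.
Let tS : t < S. Proof. by apply: lt_le_trans S_ge; rewrite mulrDl mul1r; apply: (lt_trans xy); rewrite ltrDr. Qed.
Let etaS : eta <= S.
Proof. by apply: le_trans S_ge; rewrite mulrDl mul1r (le_trans es)// lerDl ltW. Qed.
Let gap4 : 4 <= gap. Proof. exact: shell_gap_ge4. Qed.
Let gapS4 : 4 * S <= gap * S. Proof. by rewrite ler_wpM2r// ltW. Qed.
Let cut := gap * S + S.
Let cut0 : 0 < cut. Proof. by have := S0; have := gapS4; rewrite /cut; lra. Qed.

Let dist_xy z : eucl_dist x z <= eucl_dist y z + t /\ eucl_dist y z <= eucl_dist x z + t.
Proof.
split; first by rewrite addrC; exact: eucl_dist_triangle.
by rewrite addrC /t (eucl_distC x y); exact: eucl_dist_triangle.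
Qed.

Let inner_y (q : R * R) z := q.1 < eucl_dist y z < q.2.
Let outer_y (q : R * R) z := Num.max q.1 cut < eucl_dist y z < q.2.
Let outer_x (q : R * R) z := Num.max q.1 cut < eucl_dist x z < q.2.
Let edge q z := outer_y q z && ~~ outer_x q z || outer_x q z && ~~ outer_y q z.
Let edge_lo q z := edge q z && (`|eucl_dist x z - Num.max q.1 cut| <= S).
Let edge_hi q z := edge q z && (`|eucl_dist x z - q.2| <= S).

Let mdist w : measurable_fun setT (fun z => eucl_dist w z).
Proof. by apply: measurable_fun_eucl_dist. Qed.

Let m_shell w u v : measurable_fun setT (fun z => u < eucl_dist w z < v).
Proof. by apply: measurable_and; apply: measurable_fun_ltr. Qed.

Let m_edge q : measurable_fun setT (edge q).
Proof.
by apply: measurable_or; apply: measurable_and; rewrite ?/outer_x ?/outer_y;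
  try apply: measurable_neg; exact: m_shell.
Qed.

Let m_near (c : R) : measurable_fun setT (fun z => `|eucl_dist x z - c| <= S).
Proof.
apply: measurable_fun_ler => //; apply: measurableT_comp => //.
exact: measurable_funB.
Qed.

Let m_edge_lo q : measurable_fun setT (edge_lo q).
Proof. exact: measurable_and. Qed.
Let m_edge_hi q : measurable_fun setT (edge_hi q).
Proof. exact: measurable_and. Qed.

Let edge_far q z : edge q z -> gap * S <= eucl_dist x z.
Proof.
have [h1 h2] := dist_xy z; have := tS.
rewrite /edge /outer_x /outer_y !gt_max => ? /orP[] /andP[/andP[/andP[_ h] _] _];
  move: h; rewrite /cut; lra.
Qed.

Let edge_cover q z : edge q z -> edge_lo q z || edge_hi q z.
Proof.
move=> e; rewrite /edge_lo /edge_hi e /= !ler_norml.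
have [h1 h2] := dist_xy z; have ht := tS.
move: e; rewrite /edge /outer_x /outer_y; set m := Num.max q.1 cut.
rewrite !negb_and -!leNgt => /orP[] /andP[/andP[u1 u2] /orP[] v1].
- by apply/orP; left; apply/andP; split; lra.
- by apply/orP; right; apply/andP; split; lra.
- by apply/orP; left; apply/andP; split; lra.
- by apply/orP; right; apply/andP; split; lra.
Qed.

Let edge_mult z : \sum_(q <- segments t1 ts) (edge q z)%:R <= (2 : R).
Proof.
apply: (@le_trans _ _ (\sum_(q <- segments t1 ts)
  ((q.1 < eucl_dist x z < q.2)%R%:R + (q.1 < eucl_dist y z < q.2)%R%:R))).
  apply: ler_sum => q _; rewrite -natrD ler_nat.
  rewrite /edge /outer_x /outer_y !gt_max.
  by case: (q.1 < eucl_dist x z); case: (q.1 < eucl_dist y z);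
     case: (cut < eucl_dist x z); case: (cut < eucl_dist y z);
     case: (eucl_dist x z < q.2); case: (eucl_dist y z < q.2).
rewrite big_split/= -[2]/(1 + 1) lerD// segments_disjoint//.
Qed.

Let sub_edge_mult (e : R * R -> Rd -> bool) :
  (forall q z, e q z -> edge q z) ->
  forall z, \sum_(q <- segments t1 ts) (e q z)%:R <= (2 : R).
Proof.
move=> ee z; apply: le_trans (edge_mult z); apply: ler_sum => q _.
by rewrite ler_nat; case: (boolP (e q z)) => // /ee ->.
Qed.

Let g z : R := inv_dist x z * p z.
Let g0 z : 0 <= g z. Proof. by rewrite mulr_ge0 ?inv_dist_ge0. Qed.
Let mg : measurable_fun setT g.
Proof. by apply: measurable_funM => //; apply: measurable_inv_dist. Qed.

Let om : R -> R := omega \_ `]0, 1[.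
Let om_ge0 u : 0 <= om u.
Proof.
rewrite /om patchE; case: ifPn => // /set_mem; rewrite /= in_itv/= => /andP[u0 _].
by have [+ _] := CZ_modulus hK; apply; exact: ltW.
Qed.
Let mom : measurable_fun setT om.
Proof. by apply/(measurable_restrictT _ _).1 => //; exact: CZ_modulus_measurable hK. Qed.

Let omE z : gap * S < eucl_dist x z -> om (t / eucl_dist x z) = omega (t / eucl_dist x z).
Proof.
move=> h; have h4 := gapS4; have h5 := S0; have X0 : 0 < eucl_dist x z by lra.
rewrite /om patchE mem_set//= in_itv/= divr_gt0//= ltr_pdivrMr// mul1r.
have := tS; lra.
Qed.

Let Pf (q : R * R) z : R := (inner_y q z)%:R *
  (CK * (s ^+ d)^-1 * ((eucl_dist x z <= (gap + 2) * S)%R%:R * p z)).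
Let Df (q : R * R) z : R := (inner_y q z)%:R *
  ((gap * S < eucl_dist x z)%R%:R * (om (t / eucl_dist x z) * inv_dist x z) * p z).
Let Ef (e : R * R -> Rd -> bool) (q : R * R) z : R := (e q z)%:R * g z.

Let sd0 : 0 <= (s ^+ d)^-1. Proof. by have := ltW s0 => ?; nonneg. Qed.
Let Pf0 q z : 0 <= Pf q z. Proof. by rewrite /Pf; nonneg. Qed.
Let Df0 q z : 0 <= Df q z.
Proof. by have := om_ge0; have := inv_dist_ge0 x z => ? ?; rewrite /Df; nonneg. Qed.
Let Ef0 e q z : 0 <= Ef e q z. Proof. exact: mulr_ge0. Qed.

Let m_inner q : measurable_fun setT (fun z => (inner_y q z)%:R : R).
Proof. by apply: measurable_natr_bool; exact: m_shell. Qed.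

Let m_ball (c : R) : measurable_fun setT (fun z => (eucl_dist x z <= c)%R%:R * p z : R).
Proof.
by apply: measurable_funM => //; apply: measurable_natr_bool; exact: measurable_fun_ler.
Qed.

Let m_smooth : measurable_fun setT (fun z => (gap * S < eucl_dist x z)%R%:R *
  (om (t / eucl_dist x z) * inv_dist x z) * p z : R).
Proof.
apply: measurable_funM => //; apply: measurable_funM.
  by apply: measurable_natr_bool; exact: measurable_fun_ltr.
apply: measurable_funM; last exact: measurable_inv_dist.
apply: (measurableT_comp mom); apply: measurable_funM => //.
by apply: measurable_funV_ge0 => // z; exact: eucl_dist_ge0.
Qed.

Let mPf q : measurable_fun setT (Pf q).
Proof. by apply: measurable_funM => //; exact: measurable_funM. Qed.
Let mDf q : measurable_fun setT (Df q).
Proof. exact: measurable_funM. Qed.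
Let mEf e q : measurable_fun setT (e q) -> measurable_fun setT (Ef e q).
Proof. by move=> me; apply: measurable_funM => //; exact: measurable_natr_bool. Qed.

Let inner_mult z : \sum_(q <- segments t1 ts) (inner_y q z)%:R <= (1 : R).
Proof. exact: segments_disjoint. Qed.

Let inner_sum (h : Rd -> R) : measurable_fun setT h -> (forall z, 0 <= h z) ->
  (\sum_(q <- segments t1 ts) \int[mu]_z ((inner_y q z)%:R * h z)%:E <=
    \int[mu]_z (h z)%:E)%E.
Proof.
move=> mh h0; rewrite -[leRHS]mul1e.
apply: (@le_trans _ _ (\sum_(q <- segments t1 ts)
   \int[mu]_z (((inner_y q z)%:R)%:E * (h z)%:E))%E).
  by apply: lee_sum => q _; apply: ge0_le_integralW => z; rewrite -?EFinM// lee_fin mulr_ge0.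
apply: sum_cover_integral => //.
- by move=> q; exact: m_shell.
- exact/measurable_EFinP.
Qed.

Let sumP : (\sum_(q <- segments t1 ts) \int[mu]_z (Pf q z)%:E <= (size_cst * lam)%:E)%E.
Proof.
apply: le_trans (inner_sum _ _) _; first exact: measurable_funM.
  by move=> z; nonneg.
rewrite integral_realZl//; last 2 first.
- by nonneg.
- by move=> z; nonneg.
have H := @excess_ball R d eta lam p J eta0 lam0 mp p0 heavyJ x ((gap + 2) * S) small_excess.
apply: (@le_trans _ _ ((CK * (s ^+ d)^-1)%:E * (ballC * lam * ((gap + 2) * S) ^+ d)%:E)%E).
  rewrite lee_wpmul2l ?lee_fin ?mulr_ge0//; apply: H.
  by rewrite (le_trans etaS)// ler_peMl ?(ltW S0)//; have := gap4; lra.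
rewrite -EFinM lee_fin /size_cst.
have g2 : 0 <= gap + 2 by have := gap4; lra.
have : ((gap + 2) * S) ^+ d <= ((gap + 2) * (2 * (1 + a))) ^+ d * s ^+ d.
  rewrite -exprMn; apply: lerXn2r; rewrite ?nnegrE.
  - by nonneg.
  - by nonneg.
  rewrite -[leRHS]mulrA ler_wpM2l//.
  by have := S_le; rewrite mulrA.
move=> H2; have c0 : 0 <= CK * (s ^+ d)^-1 * (ballC * lam).
  by have := @ball_cst_ge0 R d => ?; nonneg.
rewrite [leLHS]mulrA; apply: (le_trans (ler_wpM2l c0 H2)).
rewrite le_eqVlt; apply/orP; left; apply/eqP.
have : s ^+ d != 0 by rewrite expf_neq0// gt_eqF.
move: (s ^+ d) (((gap + 2) * (2 * (1 + a))) ^+ d) => u v u0.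
by field.
Qed.

Let sumD : (\sum_(q <- segments t1 ts) \int[mu]_z (Df q z)%:E <= (smooth_cst * lam)%:E)%E.
Proof.
have h0 z : 0 <= (gap * S < eucl_dist x z)%R%:R * (om (t / eucl_dist x z) * inv_dist x z) * p z.
  by have := om_ge0; have := inv_dist_ge0 x z => ? ?; nonneg.
apply: le_trans (inner_sum m_smooth h0) _.
have blam0 : 0 <= ballC * lam by rewrite mulr_ge0 ?ball_cst_ge0 ?ltW.
have trho : 2 * t <= gap * S by have := tS; have := gapS4; have := S0; lra.
have growth u : gap * S <= u ->
    (\int[mu]_w ((eucl_dist x w <= u)%R%:R * p w)%:E <= (ballC * lam * u ^+ d)%:E)%E.
  move=> gu; apply: (excess_ball eta0 lam0 mp p0 heavyJ small_excess).
  by have := etaS; have := gapS4; have := S0; lra.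
have H := dini_tail (CZ_modulus hK) (CZ_modulus_measurable hK) mp p0 xy0 trho blam0 growth.
apply: (@le_trans _ _ ((2 ^+ d * 8 * (ballC * lam))%:E * dini_norm omega)%E).
  apply: le_trans H; apply: le_integral_real => z //.
  by have [/omE ->|_] := boolP (gap * S < eucl_dist x z); rewrite ?mul0r.
have dfin : dini_norm omega \is a fin_num.
  rewrite ge0_fin_numE ?(CZ_dini hK)//; apply: integral_ge0 => u /=.
  rewrite in_itv/= => /andP[u0 _]; rewrite lee_fin divr_ge0 ?(ltW u0)//.
  by have [+ _] := CZ_modulus hK; apply; exact: ltW.
rewrite -(fineK dfin) -EFinM lee_fin /smooth_cst.
by rewrite le_eqVlt; apply/orP; left; apply/eqP; ring.
Qed.

Let sumE (e : R * R -> Rd -> bool) (c : R * R -> R) :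
  (forall q, measurable_fun setT (e q)) ->
  (forall q z, e q z -> edge q z && (`|eucl_dist x z - c q| <= S)) ->
  (\sum_(q <- segments t1 ts) (\int[mu]_z (Ef e q z)%:E) * (\int[mu]_z (Ef e q z)%:E) <=
    (@annular_cst R d * lam ^+ 2)%:E)%E.
Proof.
move=> me ee; apply: (annular_square_sum eta0 lam0 d0 mp p0 heavyJ (i := i)) => //.
- by apply: sub_edge_mult => q z /ee/andP[].
- by move=> q z /ee/andP[/edge_far].
move=> q z w /ee/andP[_ +] /ee/andP[_]; rewrite /same_shell !ler_norml -/S.
by move=> /andP[? ?] /andP[? ?]; apply/andP; split; lra.
Qed.

Let pointwise q z : s <= q.1 ->
  normc ((if q.1 < eucl_dist y z < q.2 then K y z * f z else 0) -
     (if Num.max q.1 cut < eucl_dist x z < q.2 then K x z * f z else 0)) <=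
  Pf q z + Df q z + (CK * Ef edge_lo q z + CK * Ef edge_hi q z).
Proof.
move=> sq; have [h1 h2] := dist_xy z; have ht := tS.
have h4 := gapS4; have h5 := S0; have h6 := cut0; have h7 := s0.
have E0 : 0 <= CK * Ef edge_lo q z + CK * Ef edge_hi q z.
  by rewrite addr_ge0// mulr_ge0.
have edgeE : edge q z -> CK * g z <= CK * Ef edge_lo q z + CK * Ef edge_hi q z.
  move=> /edge_cover; rewrite /Ef => /orP[] ->; rewrite mul1r ?lerDl ?lerDr mulr_ge0//;
    exact: mulr_ge0.
have Kx : 0 < eucl_dist x z -> normc (K x z * f z) <= CK * g z.
  by move=> xz; rewrite Normc.normcM /g -/(p z) [leRHS]mulrA ler_wpM2r//; exact: size_bound.
have Ky : 0 < eucl_dist y z -> normc (K y z * f z) <= CK * inv_dist y z * p z.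
  by move=> yz; rewrite Normc.normcM -/(p z) ler_wpM2r//; exact: size_bound.
rewrite -/(inner_y q z) -/(outer_x q z).
have PD0 : 0 <= Pf q z + Df q z by rewrite addr_ge0.
have [inn|ninn] := boolP (inner_y q z); last first.
  have [ox|nox] := boolP (outer_x q z); last by rewrite subr0 normc_zero addr_ge0.
  rewrite sub0r normcN ler_wpDl//; apply: le_trans (edgeE _).
    apply: Kx; move: ox; rewrite /outer_x gt_max => /andP[/andP[_ h] _].
    by have := cut0; lra.
  rewrite /edge ox /= orbC (_ : ~~ outer_y q z)//; apply: contra ninn.
  by rewrite /outer_y gt_max /inner_y => /andP[/andP[-> _] ->].
move: (inn); rewrite /inner_y => /andP[qy yq].
have y0 : 0 < eucl_dist y z by have := s0; lra.
have [ycut|cuty] := leP (eucl_dist y z) cut.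
  have Ple : normc (K y z * f z) <= Pf q z.
    apply: (le_trans (Ky y0)); rewrite /Pf inn mul1r.
    rewrite (_ : (eucl_dist x z <= _) = true) ?mul1r; last first.
      by rewrite mulrDl; move: ycut; rewrite /cut; lra.
    rewrite ler_wpM2r// ler_wpM2l// /inv_dist lef_pV2 ?posrE ?exprn_gt0//.
    by apply: lerXn2r; rewrite ?nnegrE ?eucl_dist_ge0 ?(ltW s0)//; lra.
  have [ox|nox] := boolP (outer_x q z); last first.
    by rewrite subr0 (le_trans Ple)// -addrA lerDl addr_ge0.
  apply: (le_trans (normcD_le _ _)); rewrite normcN; apply: lerD.
    by rewrite (le_trans Ple)// lerDl.
  apply: le_trans (edgeE _).
    apply: Kx; move: ox; rewrite /outer_x gt_max => /andP[/andP[_ h] _].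
    by have := cut0; lra.
  rewrite /edge ox /= orbC (_ : ~~ outer_y q z)//.
  by rewrite /outer_y gt_max (ltNge cut) ycut andbF.
have gx : gap * S < eucl_dist x z by move: cuty; rewrite /cut; lra.
have x0 : 0 < eucl_dist x z by lra.
have Dle : normc (K y z * f z - K x z * f z) <= Df q z.
  rewrite -mulrBl Normc.normcM /Df inn gx !mul1r ler_wpM2r ?normc_ge0//.
  rewrite omE// normcB_sym.
  have := CZ_smooth hK (x := x) (x' := y) (y := z) _ xy0.
  rewrite -/(inv_dist x z) => H.
  apply: le_trans (H _); first by rewrite lerDl normc_ge0.
  by rewrite -/t; lra.
have [ox|nox] := boolP (outer_x q z).
  by apply: (le_trans Dle); rewrite -addrA addrCA lerDl addr_ge0.
rewrite subr0 -[K y z * f z](subrK (K x z * f z)).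
apply: (le_trans (normcD_le _ _)); apply: lerD.
  by rewrite (le_trans Dle)// lerDr.
apply: le_trans (Kx x0) (edgeE _).
by rewrite /edge nox /outer_y gt_max qy cuty yq.
Qed.

Lemma variation_comparison :
  lr_norm r (pairmap (fun u v => normc (truncation K f y u v)) t1 ts) <=
  4 * (1 + 12 * (size_cst ^+ 2 + smooth_cst ^+ 2 + edge_cst)) * lam.
Proof.
rewrite -(map_segments (fun u v => normc (truncation K f y u v))).
pose iP q : \bar R := (\int[mu]_z (Pf q z)%:E)%E.
pose iD q : \bar R := (\int[mu]_z (Df q z)%:E)%E.
pose iL q : \bar R := (\int[mu]_z (Ef edge_lo q z)%:E)%E.
pose iH q : \bar R := (\int[mu]_z (Ef edge_hi q z)%:E)%E.
have iP0 q : (0 <= iP q)%E by exact: integral_real_ge0.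
have iD0 q : (0 <= iD q)%E by exact: integral_real_ge0.
have iL0 q : (0 <= iL q)%E by exact: integral_real_ge0.
have iH0 q : (0 <= iH q)%E by exact: integral_real_ge0.
have [finP leP] := fine_sum_le iP0 sumP.
have [finD leD] := fine_sum_le iD0 sumD.
have HL : (\sum_(q <- segments t1 ts) iL q * iL q <= (@annular_cst R d * lam ^+ 2)%:E)%E.
  by apply: (sumE (c := fun q => Num.max q.1 cut)).
have HH : (\sum_(q <- segments t1 ts) iH q * iH q <= (@annular_cst R d * lam ^+ 2)%:E)%E.
  by apply: (sumE (c := fun q => q.2)).
have [finL leL] := fine_sum_sqr_le iL0 HL.
have [finH leH] := fine_sum_sqr_le iH0 HH.
pose E q := CK * fine (iL q) + CK * fine (iH q).
have annular0 : 0 <= @annular_cst R d * lam ^+ 2.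
  by apply: le_trans leL; apply: sumr_ge0 => q _; exact: sqr_ge0.
have edge0 : 0 <= edge_cst.
  have : 0 <= @annular_cst R d by move: annular0; rewrite pmulr_lge0// exprn_gt0.
  by move=> ?; rewrite /edge_cst; nonneg.
apply: (@lr_norm_perturb R _ (segments t1 ts) _
  (fun q => normc (truncation K f x (Num.max q.1 cut) q.2))
  (fun q => fine (iP q)) (fun q => fine (iD q)) E r lam size_cst smooth_cst edge_cst) => //.
- by move=> q; exact: normc_ge0.
- by move=> q; exact: normc_ge0.
- by move=> q; exact: fine_ge0.
- by move=> q; exact: fine_ge0.
- by move=> q; rewrite /E addr_ge0// mulr_ge0// fine_ge0.
- move=> q qs; have [tq q12] := segments_ge pt qs.
  have sq : s <= q.1 by exact: le_trans st1 tq.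
  have q0 : 0 < q.1 by exact: lt_le_trans sq.
  have m0 : 0 < Num.max q.1 cut by rewrite lt_max q0.
  rewrite -lee_fin.
  apply: le_trans (truncation_perturb hK hf q0 m0 (fun z => pointwise z sq)) _.
  have mCL : measurable_fun setT (fun z => CK * Ef edge_lo q z).
    by apply: measurable_funM => //; exact: mEf.
  have mCH : measurable_fun setT (fun z => CK * Ef edge_hi q z).
    by apply: measurable_funM => //; exact: mEf.
  have CL0 z : 0 <= CK * Ef edge_lo q z by exact: mulr_ge0.
  have CH0 z : 0 <= CK * Ef edge_hi q z by exact: mulr_ge0.
  rewrite integral_realD//; last 4 first.
  - exact: measurable_funD.
  - exact: measurable_funD.
  - by move=> z; rewrite addr_ge0.
  - by move=> z; rewrite addr_ge0.
  rewrite (integral_realD mu (mPf q) (mDf q))// (integral_realD mu mCL mCH)//.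
  rewrite !integral_realZl//; try exact: mEf.
  rewrite -/(iP q) -/(iD q) -/(iL q) -/(iH q).
  rewrite (finP q qs) (finD q qs) (finL q qs) (finH q qs) -!EFinM -!EFinD.
  exact: lexx.
- apply: lr_norm_truncation_cut => //; first exact: ltW.
  by move=> u us pu cu; apply: variation_x => //; exact: lt_le_trans cu.
apply: (@le_trans _ _ (\sum_(q <- segments t1 ts)
   2 * CK ^+ 2 * (fine (iL q) ^+ 2 + fine (iH q) ^+ 2))).
  apply: ler_sum => q _; rewrite /E -subr_ge0.
  rewrite (_ : _ - _ = (CK * (fine (iL q) - fine (iH q))) ^+ 2); first exact: sqr_ge0.
  by ring.
rewrite -mulr_sumr big_split/= /edge_cst.
have := lerD leL leH; have : 0 <= 2 * CK ^+ 2 by rewrite mulr_ge0// sqr_ge0.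
move=> c0 /(ler_wpM2l c0) /le_trans; apply.
by rewrite le_eqVlt; apply/orP; left; apply/eqP; ring.
Qed.

End comparison.

(** * The weak-type estimate *)

Section open_sets.
Context {R : realType} {d : nat}.
Local Notation Rd := (d.-tuple R).
Local Notation mu := (lebesgue_rd (R := R) d).
Implicit Types x y z : Rd.

Lemma measurable_cell_invariant (s : R) (B : set Rd) :
  (forall x y, same_cell s x y -> B x -> B y) -> measurable B.
Proof.
move=> inv; pose index x : d.-tuple int := [tuple Num.floor (tnth x i / s) | i < d].
have indexE x y : index x = index y -> same_cell s x y.
  move=> xy; apply/forallP => i; apply/eqP.
  by have := congr1 (fun v => tnth v i) xy; rewrite !tnth_mktuple.
pose C (k : nat) : set Rd := [set x | unpickle k = Some (index x) /\ B x].
have -> : B = \bigcup_k C k.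
  apply/seteqP; split => [x Bx|x [k _ []]//].
  by exists (pickle (index x)) => //; split => //; rewrite pickleK.
apply: bigcupT_measurable => k.
have [->|/set0P[x [kx Bx]]] := eqVneq (C k) set0; first exact: measurable0.
rewrite (_ : C k = [set y | same_cell s x y]).
  by apply: measurable_set_bool; apply: measurable_same_cell.
apply/seteqP; split => y /=.
  by move=> [ky _]; apply: indexE; apply: Some_inj; rewrite -kx ky.
move=> xy; split; last exact: inv Bx.
rewrite kx; congr Some; apply: eq_from_tnth => i; rewrite !tnth_mktuple.
exact/eqP/(forallP xy).
Qed.

Lemma measurable_open_rd (A : set Rd) :
  (forall x, A x -> exists2 e, 0 < e & forall z, eucl_dist x z < e -> A z) ->
  measurable A.
Proof.
move=> oA.
have -> : A = \bigcup_n [set x | forall y, same_cell (2 ^+ n)^-1 x y -> A y].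
  apply/seteqP; split => [x Ax|x [n _]]; last by apply; exact: same_cell_refl.
  have [e e0 xe] := oA x Ax; pose n := (Num.truncn (d%:R / e)).+1.
  exists n => // y xy; apply: xe.
  have p0 : 0 < (2 : R) ^+ n by rewrite exprn_gt0.
  have v0 : 0 < ((2 : R) ^+ n)^-1 by rewrite invr_gt0.
  apply: (le_lt_trans (same_cell_dist v0 xy)).
  rewrite ltr_pdivrMr// mulrC -ltr_pdivrMr// (lt_le_trans (truncnS_gt _))//.
  by rewrite -natrX ler_nat ltnW// ltn_expl.
apply: bigcupT_measurable => n.
apply: (@measurable_cell_invariant ((2 ^+ n)^-1)) => x y xy Bx z yz.
by apply: Bx; exact: same_cell_trans yz.
Qed.

Lemma markov_rd (g : Rd -> \bar R) (c : R) : measurable_fun setT g ->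
  (forall x, 0 <= g x)%E -> 0 < c ->
  (c%:E * mu [set x | c%:E < g x] <= \int[mu]_x g x)%E.
Proof.
move=> mg g0 c0.
have mA : measurable [set x | (c%:E < g x)%E].
  by rewrite -[X in measurable X]setTI; exact: emeasurable_fun_o_infty.
rewrite -[in leLHS](setIT [set x | (c%:E < g x)%E]) -integral_indic//.
have i0 x : 0 <= \1_[set x | (c%:E < g x)%E] x :> R by rewrite indicE.
rewrite -(integral_realZl mu (ltW c0) (measurable_indic mA) i0).
apply: ge0_le_integralW => x; first by rewrite lee_fin mulr_ge0// ltW.
rewrite indicE; have [|_] := boolP (x \in _); last by rewrite mulr0.
by rewrite inE /= mulr1 => /ltW.
Qed.

End open_sets.

Section assembly.
Context {R : realType} {d : nat}.
Local Notation Rd := (d.-tuple R).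
Local Notation mu := (lebesgue_rd (R := R) d).
Local Notation normc := Normc.normc.
Variables (omega : R -> R) (K : Rd -> Rd -> R[i]) (r : \bar R).
Hypotheses (hK : CZ_kernel omega K) (r2 : (2%:E < r)%E).
Implicit Types x y z : Rd.

Let V (f : Rd -> R[i]) := homogeneous_variation r (truncation K f).

Definition level_set (f : Rd -> R[i]) (a eta la : R) : set Rd :=
  [set x | exists y s t, [/\ eta <= s, s < t, eucl_dist x y < a * s &
    (la%:E < V f y s t)%E]].

Lemma measurable_level_set f a eta la : measurable (level_set f a eta la).
Proof.
apply: measurable_open_rd => x [y [s [t [es st xy lV]]]].
exists (a * s - eucl_dist x y) => [|z xz]; first by rewrite subr_gt0.
exists y, s, t; split => //.
apply: (le_lt_trans (eucl_dist_triangle x z y)).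
by rewrite (eucl_distC z x); lra.
Qed.

Lemma variation_le_max0 f x (lam : R) :
  (nontangential_max0 (V f) x <= lam%:E)%E ->
  forall t ts, path <%R t ts -> 0 < t ->
  lr_norm r (pairmap (fun u v => normc (truncation K f x u v)) t ts) <= lam.
Proof.
move=> H t ts pt t0; rewrite -lee_fin; apply: le_trans H.
have tl : t <= last t ts.
  elim: ts t pt {t0} => [|u ts IH] t //= /andP[tu pu].
  by rewrite (le_trans (ltW tu))// IH.
apply: (@le_trans _ _ (V f x t (last t ts + 1))).
  apply: ereal_sup_ubound; exists t, ts; split => //.
  by rewrite lerDl.
apply: ereal_sup_ubound; exists t, (last t ts + 1); split => //.
by rewrite (le_lt_trans tl)// ltrDl.
Qed.

Lemma max0_of_level_set f (a CK eta lam C : R) J x :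
  inL1 f -> (0 < d)%N -> 0 < a -> 0 <= CK -> 0 < eta -> 0 < lam ->
  (forall y z, 0 < eucl_dist y z -> normc (K y z) <= CK * inv_dist y z) ->
  (forall j z, (J <= j)%N -> ~~ heavy eta lam (fun z => normc (f z)) j z) ->
  C = 4 * (1 + 12 * (@size_cst R d a CK ^+ 2 + @smooth_cst R d omega ^+ 2 +
    @edge_cst R d CK)) -> 1 <= C ->
  (excess eta lam (fun z => normc (f z)) J x <= (@excess_cst R d * lam)%:E)%E ->
  (interaction eta lam (fun z => normc (f z)) J x <= (lam ^+ 2)%:E)%E ->
  level_set f a eta (C * lam) x ->
  (lam%:E < nontangential_max0 (V f) x)%E.
Proof.
move=> hf d0 a0 CK0 eta0 lam0 size heavyJ CE C1 ex inter [y [s [t [es st xy lV]]]].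
rewrite ltNge; apply/negP => /variation_le_max0 Hx.
have [_ [t1 [ts [st1 pt lt ->]]]] := ereal_sup_gt lV.
apply/negP; rewrite -leNgt lee_fin.
have s0 : 0 < s by exact: lt_le_trans es.
have [xy0|] := ltP 0 (eucl_dist x y).
  rewrite CE.
  by apply: (variation_comparison hK hf r2 d0 a0 CK0 eta0 lam0 size heavyJ xy xy0
    es ex inter Hx st1 pt).
move=> yx; have -> : y = x.
  by apply/esym/eucl_dist_eq0/eqP; rewrite eq_le yx eucl_dist_ge0.
apply: (le_trans (Hx _ _ pt _)); first exact: lt_le_trans st1.
by rewrite ler_peMl// ltW.
Qed.

Lemma heavy_bound f (eta lam : R) : inL1 f -> (0 < d)%N -> 0 < eta -> 0 < lam ->
  exists J, forall j z, (J <= j)%N -> ~~ heavy eta lam (fun z : Rd => normc (f z)) j z.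
Proof.
move=> [mf foo] d0 eta0 lam0.
have L0 : (0 <= L1norm f)%E by apply: integral_real_ge0 => z; exact: normc_ge0.
have Lfin : L1norm f \is a fin_num by rewrite ge0_fin_numE.
have ed0 : 0 < lam * eta ^+ d by rewrite mulr_gt0// exprn_gt0.
pose M := fine (L1norm f) / (lam * eta ^+ d).
exists (Num.truncn M).+1 => j z Jj; rewrite /heavy -leNgt.
apply: (@le_trans _ _ (L1norm f)).
  apply: le_integral_real => w; first by rewrite mulr_ge0// normc_ge0.
  by rewrite ler_piMl ?normc_ge0// lern1 leq_b1.
rewrite -(fineK Lfin) lee_fin /scale exprMn.
have -> : lam * ((2 ^+ j) ^+ d * eta ^+ d) = (2 ^+ j) ^+ d * (lam * eta ^+ d) by ring.
rewrite -ler_pdivrMr// -/M (le_trans (ltW (truncnS_gt _)))//.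
rewrite -!natrX ler_nat (leq_trans Jj)// (leq_trans (ltnW (ltn_expl j (ltnSn 1))))//.
by rewrite -expnM leq_exp2l// leq_pmulr.
Qed.

Lemma level_set_measure (a CK A0 : R) : (0 < d)%N -> 0 < a -> 0 <= CK ->
  (forall y z, 0 < eucl_dist y z -> normc (K y z) <= CK * inv_dist y z) ->
  (forall f, inL1 f -> forall la : R, 0 < la ->
    (mu [set x | la%:E < nontangential_max0 (V f) x] <= (A0 / la)%:E * L1norm f)%E) ->
  exists C : R, forall f (eta la : R), inL1 f -> 0 < eta -> 0 < la ->
    (mu (level_set f a eta la) <= (C / la)%:E * L1norm f)%E.
Proof.
move=> d0 a0 CK0 size weak0.
pose C := 4 * (1 + 12 * (@size_cst R d a CK ^+ 2 + @smooth_cst R d omega ^+ 2 +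
  @edge_cst R d CK)).
have C1 : 1 <= C.
  have : 0 <= @edge_cst R d CK.
    have := @shell_cst_ge0 R d; have := @ball_cst_ge0 R d.
    have := @excess_cst_gt0 R d => ? ? ?.
    by rewrite /edge_cst /annular_cst; nonneg.
  by have := sqr_ge0 (@size_cst R d a CK);
    have := sqr_ge0 (@smooth_cst R d omega); rewrite /C; lra.
have C0 : 0 < C by lra.
pose c0 := @excess_cst R d; have c00 : 0 < c0 by exact: excess_cst_gt0.
pose Ce : R := 2 ^+ d.+2 * 2 ^+ d.
exists ((A0 + Ce / c0 + @interaction_cst R d) * C) => f eta la hf eta0 la0.
pose lam := la / C; have lam0 : 0 < lam by exact: divr_gt0.
have laE : la = C * lam by rewrite /lam mulrCA divff ?mulr1// gt_eqF.
pose p z := normc (f z).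
have p0 z : 0 <= p z by exact: normc_ge0.
have mp : measurable_fun setT p by apply: measurable_normc; case: hf.
have [J heavyJ] := heavy_bound hf d0 eta0 lam0.
pose N := excess eta lam p J; pose T := interaction eta lam p J.
have mN : measurable_fun setT N by exact: measurable_excess.
have mT : measurable_fun setT T by exact: measurable_interaction.
pose B1 := [set x | ((c0 * lam)%:E < N x)%E].
pose B2 := [set x | ((lam ^+ 2)%:E < T x)%E].
have mB1 : measurable B1 by rewrite -[B1]setTI; exact: emeasurable_fun_o_infty.
have mB2 : measurable B2 by rewrite -[B2]setTI; exact: emeasurable_fun_o_infty.
have mA := measurable_level_set f a eta la.
have L0 : (0 <= L1norm f)%E by exact: integral_real_ge0.
have cl0 : 0 < c0 * lam by exact: mulr_gt0.
have l20 : 0 < lam ^+ 2 by exact: exprn_gt0.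
have M1 : (mu B1 <= (Ce / (c0 * lam))%:E * L1norm f)%E.
  have N0 x : (0 <= N x)%E by exact: excess_ge0.
  have intN : (\int[mu]_x N x <= Ce%:E * L1norm f)%E by exact: integral_excess.
  have H := le_trans (markov_rd mN N0 cl0) intN.
  by rewrite mulrC EFinM -muleA lee_pdivlMl.
have M2 : (mu B2 <= (@interaction_cst R d / lam)%:E * L1norm f)%E.
  have T0 x : (0 <= T x)%E by exact: interaction_ge0.
  have intT : (\int[mu]_x T x <= (@interaction_cst R d * lam)%:E * L1norm f)%E.
    exact: integral_interaction.
  have H := le_trans (markov_rd mT T0 l20) intT.
  have -> : @interaction_cst R d / lam = (lam ^+ 2)^-1 * (@interaction_cst R d * lam).
    by rewrite expr2; field; rewrite gt_eqF.
  by rewrite EFinM -muleA lee_pdivlMl.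
have mD : measurable (level_set f a eta la `\` (B1 `|` B2)).
  by apply: measurableD => //; exact: measurableU.
have cover : level_set f a eta la `<=`
    (level_set f a eta la `\` (B1 `|` B2)) `|` (B1 `|` B2).
  by move=> x Ax; have [B|nB] := pselect ((B1 `|` B2) x); [right|left].
apply: (le_trans (lebesgue_rd_mono cover)).
apply: (le_trans (measureU2 _ mD (measurableU _ _ mB1 mB2))).
apply: (@le_trans _ _ ((A0 / lam)%:E * L1norm f +
    ((Ce / (c0 * lam))%:E * L1norm f + (@interaction_cst R d / lam)%:E * L1norm f))%E).
  apply: leeD; last by apply: (le_trans (measureU2 _ mB1 mB2)); exact: leeD.
  (* The level set of [nontangential_max0] need not be known to be Borel: it is
     only compared with a smaller Borel set. *)
  apply: le_trans (weak0 f hf lam lam0); apply: lebesgue_rd_mono => x /= [Ax nB].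
  have x1 : (N x <= (c0 * lam)%:E)%E.
    by rewrite leNgt; apply/negP => h; apply: nB; left.
  have x2 : (T x <= (lam ^+ 2)%:E)%E.
    by rewrite leNgt; apply/negP => h; apply: nB; right.
  apply: (@max0_of_level_set f a CK eta lam C J) => //.
  by rewrite -laE.
have Lfin : L1norm f \is a fin_num by rewrite ge0_fin_numE//; case: hf.
rewrite -(fineK Lfin) -!EFinM -!EFinD lee_fin le_eqVlt; apply/orP; left; apply/eqP.
rewrite laE; field.
by rewrite !gt_eqF.
Qed.

Lemma nontangential_weak_type (a CK A0 : R) : (0 < d)%N -> 0 < a -> 0 <= CK ->
  (forall y z, 0 < eucl_dist y z -> normc (K y z) <= CK * inv_dist y z) ->
  (forall f, inL1 f -> forall la : R, 0 < la ->
    (mu [set x | la%:E < nontangential_max0 (V f) x] <= (A0 / la)%:E * L1norm f)%E) ->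
  exists C : R, forall f, inL1 f -> forall la : R, 0 < la ->
    (mu [set x | la%:E < nontangential_max a (V f) x] <= (C / la)%:E * L1norm f)%E.
Proof.
move=> d0 a0 CK0 size weak0.
have [C HC] := level_set_measure d0 a0 CK0 size weak0.
exists C => f hf la la0.
pose F n := level_set f a ((2 : R) ^+ n)^-1 la.
have mF n : measurable (F n) by exact: measurable_level_set.
have -> : [set x | (la%:E < nontangential_max a (V f) x)%E] = \bigcup_n F n.
  apply/seteqP; split => [x /= /ereal_sup_gt [_ [y [s [t [s0 st xy ->]]]] lV]|].
    pose n := (Num.truncn s^-1).+1.
    exists n => //; exists y, s, t; split => //.
    rewrite -[leRHS]invrK lef_pV2 ?posrE ?invr_gt0 ?exprn_gt0//.
    rewrite (le_trans (ltW (truncnS_gt _)))// -natrX ler_nat ltnW//.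
    exact: ltn_expl.
  move=> x [n _ [y [s [t [es st xy lV]]]]] /=.
  apply: (lt_le_trans lV); apply: ereal_sup_ubound; exists y, s, t; split => //.
  by apply: lt_le_trans es; rewrite invr_gt0 exprn_gt0.
have ndF : nondecreasing_seq F.
  move=> m n mn; apply/subsetPset => x [y [s [t [es st xy lV]]]].
  exists y, s, t; split => //; apply: le_trans es.
  by rewrite lef_pV2 ?posrE ?exprn_gt0// ler_weXn2l// ler1n.
have := @nondecreasing_cvg_mu _ _ _ mu F mF (bigcupT_measurable F mF) ndF.
move=> /cvg_lim <- //; apply: lime_le.
  apply: ereal_nondecreasing_is_cvgn => m n mn; apply: lebesgue_rd_mono.
  exact/subsetPset/ndF.
by apply: nearW => n; apply: HC => //; rewrite invr_gt0 exprn_gt0.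
Qed.

Lemma variation_dim0 f y s t : d = 0%N -> 0 < s -> (V f y s t <= 0)%E.
Proof.
move=> dE s0; apply: ge_ereal_sup => _ [t1 [ts [st1 pt _ ->]]].
rewrite lee_fin; have t10 : 0 < t1 by exact: lt_le_trans st1.
have dist0 x z : eucl_dist x z = 0.
  rewrite /eucl_dist big1 ?sqrtr0// => i; exfalso.
  by have := ltn_ord i; rewrite [X in (_ < X)%N]dE.
have F0 u v : 0 < u -> truncation K f y u v = 0.
  move=> u0; rewrite /truncation (_ : [set z | _] = set0).
    by rewrite /cintegral !Rintegral_set0.
  rewrite -subset0 => z /= /andP[+ _].
  by rewrite dist0 ltNge (ltW u0).
set g := fun u v => _.
have g0 u v : 0 < u -> g u v = 0 by move=> u0; rewrite /g F0// normc_zero.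
elim: ts t1 t10 pt {st1} => [|u ts IH] t1 t10 /=; first by rewrite lr_norm_nil.
move=> /andP[tu pu]; rewrite g0// lr_norm_cons0//; apply: IH => //.
exact: lt_trans tu.
Qed.

End assembly.

Theorem theorem1p5 (R : realType) (d : nat) (omega : R -> R)
    (K : d.-tuple R -> d.-tuple R -> R[i]) (r : \bar R)
    (hK : CZ_kernel omega K) (hr : (2%:E < r)%E)
    (h0 : weak_type11 (nontangential_max0 \o homogeneous_variation r \o truncation K))
    (a : R) (ha : 0 < a) :
  weak_type11 (nontangential_max a \o homogeneous_variation r \o truncation K).
Proof.
have [d0|d0] := posnP d.
  exists 0 => f hf la la0; rewrite mul0r mul0e.
  rewrite (_ : [set x | _] = set0) ?measure0//.
  rewrite -subset0 => x /= /ereal_sup_gt [_ [y [s [t [s0 _ _ ->]]]]].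
  move=> /lt_le_trans/(_ (variation_dim0 K hr f y t d0 s0)).
  by rewrite lte_fin ltNge (ltW la0).
have [A0 weak0] := h0; have [CK CK0 size] := CZ_size_ge0 hK.
exact: (nontangential_weak_type hK hr d0 ha CK0 size weak0).
Qed.
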